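(* There exists a constant $C=C(\rho)>0$ such that, for every $n\in\mathbb N$, every $L\in\mathbb N$, every $t>0$ and every function $v\in\ell^2(\mathbb Z)$, $$\mathbb E^n_\rho\Big[\Big(\int_0^t\sum_{x\in\mathbb Z}v(x)\Big\{\bar\eta_{sn^a}(x)\,\bar\eta_{sn^a}(x+1)-\big(\overrightarrow{\eta}^{L}_{sn^a}(x)\big)^2+\frac{\chi(\rho)}{L}\Big\}ds\Big)^2\Big]\le Ct\Big\{\frac{L}{n^{a-1}}+\frac{tn}{L^2}\Big\}\|v\|_{2,n}^2 .$$
   Context: Setting. Fix $a>0$. For each scaling parameter $n\in\mathbb N$, $\{\eta^n_{tn^a}(x)\,;\,x\in\mathbb Z,\,t\ge0\}$ (written simply $\eta_{tn^a}$) is a Markov process with generator $n^a\mathcal L_n$ on $\Omega=\mathcal X^{\mathbb Z}$, where $\mathcal X$ is the space of values of the (real) variables $\eta(x)$ (e.g. $\{0,1\}$ or $\mathbb R$). It is a conservative one-dimensional interacting particle system, the conserved quantity being $\sum_x\eta(x)$. For $x\in\mathbb Z$, $(\tau_x\eta)(y)=\eta(x+y)$ and $(\tau_xh)(\eta)=h(\tau_x\eta)$ for $h:\Omega\to\mathbb R$; $\eta^{z,z+1}$ is $\eta$ with the values at $z$ and $z+1$ exchanged; $\nabla_{z,z+1}f(\eta)=f(\eta^{z,z+1})-f(\eta)$. (A1) There is a family of probability measures $\{\nu_\rho;\rho\in I\}$ invariant for the process; each $\nu_\rho$ is a product measure on $\Omega$, translation invariant, with $\int\eta(x)\,d\nu_\rho=\rho$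 for all $x$, and $\int|\eta(x)|^k\,d\nu_\rho<\infty$ for $k=2,3,4$. A value $\rho\in I$ is fixed. $\bar\eta(x)=\eta(x)-\rho$, and $\bar\psi=\psi-\int\psi\,d\nu_\rho$ for $\psi:\Omega\to\mathbb R$. $\chi(\rho)=\int(\eta(x)-\rho)^2d\nu_\rho$. $\mathcal L_n=\mathcal S_n+\mathcal A_n$ with $\mathcal S_n=(\mathcal L_n+\mathcal L_n^* )/2$, $\mathcal A_n=(\mathcal L_n-\mathcal L_n^* )/2$ (adjoint in $\mathbb L^2(\nu_\rho)$). Dirichlet form: $D_n(f)=-\int f\mathcal L_nf\,d\nu_\rho=-\int f\mathcal S_nf\,d\nu_\rho$ for local $f\in\mathbb L^2(\nu_\rho)$. Currents: $\mathcal S_n\eta(x)=j^{n,s}_{x-1,x}-j^{n,s}_{x,x+1}$ and $\mathcal A_n\eta(x)=j^{n,a}_{x-1,x}-j^{n,a}_{x,x+1}$. (A2) There are $\delta>0$ and functions $\zeta^n_{0,1}:\Omega\to[\delta,\delta^{-1}]$ such that $D_n(f)=\sum_{z\in\mathbb Z}I^n_{z,z+1}(f)$, $I^n_{z,z+1}(f)=\int\zeta^n_{z,z+1}(\eta)(\nabla_{z,z+1}f(\eta))^2\,\nu_\rho(d\eta)$, where $\zeta^n_{z,z+1}=\tau_z\zeta^n_{0,1}$. (A3) There are local functions $h=h(n),\,g=g(n):\Omega\to\mathbb R$ and a constant $c=c(n)$ such that for all $x$: $\bar j^{n,s}_{x,x+1}=\tau_xh-\tau_{x+1}h$ and $\bar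 j^{n,a}_{x,x+1}=c\,\bar\eta(x)\bar\eta(x+1)+\tau_xg$, and for every Schwartz function $H$, $\lim_{n\to\infty}\mathbb E^n_\rho\big[\big(\int_0^t\frac{n^{a-1}}{\sqrt n}\sum_x\nabla_nH(\tfrac xn)\,\tau_xg(\eta_{sn^a})ds\big)^2\big]=0$, where $\nabla_nH(\frac xn)=n[H(\frac{x+1}n)-H(\frac xn)]$. $\mathbb P^n_\rho$, $\mathbb E^n_\rho$: law and expectation of the process $\{\eta_{tn^a}\}_{t\ge0}$ started from $\nu_\rho$. Notation: $\|v\|_{2,n}^2=n^{-1}\sum_{x\in\mathbb Z}v^2(x)$ and $\overrightarrow{\eta}^{L}(x)=\frac1L\sum_{y=x+1}^{x+L}\bar\eta(y)$. *)

(* Defs.v *)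
From mathcomp Require Import all_boot all_order all_algebra finmap.
From mathcomp Require Import all_classical all_reals all_analysis.

Set Implicit Arguments.
Unset Strict Implicit.
Unset Printing Implicit Defensive.

Import Order.TTheory GRing.Theory Num.Theory.
Import numFieldNormedType.Exports.

Local Open Scope classical_set_scope.
Local Open Scope ring_scope.

Section Configurations.
Context {dX : measure_display} (X : measurableType dX).

Definition cylinders : set (set (int -> X)) :=
  [set B | exists (x : int) (A : set X),
     measurable A /\ B = [set eta | A (eta x)]].

(** The configuration space [X ^ Z] with its product sigma-algebra. *)
Definition config : Type := g_sigma_algebraType cylinders.

Definition shift (x : int) (eta : config) : config := fun y => eta (x + y).

(** Exchange of the values at the sites [z] and [z + 1]. *)
Definition exchange (z : int) (eta : config) : config :=
  fun y => if y == z then eta (z + 1) else if y == z + 1 then eta z else eta y.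

End Configurations.

Section Functions.
Context {R : realType} {dX : measure_display} {X : measurableType dX}.
Implicit Types (nu : probability (config X) R) (f : config X -> R).

Definition local_fun f : Prop :=
  exists m : nat, forall eta xi : config X,
    (forall x : int, (`|x| <= m)%N -> eta x = xi x) -> f eta = f xi.

Definition nabla (z : int) f (eta : config X) : R := f (exchange z eta) - f eta.

Definition centered nu f (eta : config X) : R := f eta - \int[nu]_xi f xi.

Definition L2norm nu f : \bar R := 'N[nu]_(2%:E)[EFin \o f]%E.

(** [F] is a version of the sum over [Z] of the [u x], the series converging
    unconditionally in [L2(nu)]. *)
Definition L2_sum nu (u : int -> config X -> R) (F : config X -> R) : Prop :=
  F \in Lfun nu 2%:E /\
  forall e : R, 0 < e -> exists A0 : {fset int}, forall A : {fset int},
    fsubset A0 A ->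
    (L2norm nu (fun eta => F eta - \sum_(x <- A) u x eta)%R < e%:E)%E.

Definition translation_invariant nu : Prop :=
  forall (x : int) (A : set (config X)), measurable A ->
    nu (@shift _ X x @^-1` A) = nu A.

Definition product_measure_on_Z nu : Prop :=
  forall (S : {fset int}) (A : int -> set X), (forall x, measurable (A x)) ->
    nu [set eta | forall x, x \in S -> A x (eta x)] =
    (\prod_(x <- S) nu [set eta | A x (eta x)])%E.

End Functions.

Section Semigroup.
Context {R : realType} {dX : measure_display} {X : measurableType dX}.

(** [k (t, eta)] is the law at time [t] of the process started from [eta];
    only the times [0 <= t] are meaningful. *)
Variable k : R.-pker (R * config X) ~> (config X).
Variable nu : probability (config X) R.

Definition evolve (t : R) (f : config X -> R) (eta : config X) : R :=
  \int[k (t, eta)]_xi f xi.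

Definition invariant_measure : Prop :=
  forall (t : R) (A : set (config X)), 0 <= t -> measurable A ->
    (\int[nu]_eta k (t, eta) A = nu A)%E.

(** Unbounded operators on [L2(nu)] are represented by their graphs, which
    are stable under modification of the functions on [nu]-null sets. *)
Definition generator (f g : config X -> R) : Prop :=
  [/\ f \in Lfun nu 2%:E, g \in Lfun nu 2%:E &
      L2norm nu (fun eta => t^-1 * (evolve t f eta - f eta) - g eta)
        @[t --> 0^'+] --> 0%E].

(** A Markov semigroup, strongly continuous on [L2(nu)], whose generator is
    the closure of its restriction to local functions. *)
Record markov_semigroup : Prop := MarkovSemigroup {
  semigroup0 : forall (eta : config X) (A : set (config X)), measurable A ->
    k (0, eta) A = \d_eta A ;
  semigroupD : forall (s t : R) (eta : config X) (A : set (config X)),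
    0 <= s -> 0 <= t -> measurable A ->
    (k ((s + t)%R, eta) A = \int[k (s, eta)]_xi k (t, xi) A)%E ;
  semigroup_cont : forall f, f \in Lfun nu 2%:E ->
    L2norm nu (fun eta => evolve t f eta - f eta) @[t --> 0^'+] --> 0%E ;
  local_core : forall f g, generator f g -> forall e : R, 0 < e ->
    exists f' g', [/\ local_fun f', generator f' g',
      (L2norm nu (fun eta => f eta - f' eta)%R < e%:E)%E &
      (L2norm nu (fun eta => g eta - g' eta)%R < e%:E)%E] }.

Context {dW : measure_display} {W : measurableType dW}.
Variables (P : probability W R) (xi : R -> W -> config X).

Definition past (s : R) : set (set W) :=
  <<s \bigcup_(r in `[0, s]) preimage_set_system setT (xi r) measurable >>.

(** [xi] is a jointly measurable Markov process with transition function [k]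
    and initial law [nu]; the Markov property is with respect to the natural
    filtration of [xi]. *)
Record markov_process : Prop := MarkovProcess {
  process_measurable : measurable_fun
    (`[0%R, +oo[ `*` [set: W] : set (R * W)) (fun p => xi p.1 p.2) ;
  process_init : forall A : set (config X), measurable A ->
    P (xi 0 @^-1` A) = nu A ;
  process_markov : forall (s t : R) (B : set W) (A : set (config X)),
    0 <= s -> s <= t -> past s B -> measurable A ->
    (P (B `&` xi t @^-1` A) = \int[P]_(w in B) k ((t - s)%R, xi s w) A)%E }.

(** Expectation of the square of the integral of [F (xi s)] over [0, t]. *)
Definition mean_square_time_integral (F : config X -> R) (t : R) : \bar R :=
  (\int[P]_w ((\int[lebesgue_measure]_(s in `[0%R, t]) (F (xi s w))%:E) ^+ 2))%E.

End Semigroup.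

Section Operators.
Context {R : realType} {dX : measure_display} {X : measurableType dX}.
Variable nu : probability (config X) R.
Variable L : (config X -> R) -> (config X -> R) -> Prop.

Definition adjoint (f g : config X -> R) : Prop :=
  [/\ f \in Lfun nu 2%:E, g \in Lfun nu 2%:E &
      forall phi psi, L phi psi ->
        \int[nu]_eta (f eta * psi eta) = \int[nu]_eta (g eta * phi eta)].

Definition dirichlet_form (f : config X -> R) (d : R) : Prop :=
  exists2 g, L f g & d = - \int[nu]_eta (f eta * g eta).

Definition symmetric_part (f g : config X -> R) : Prop :=
  exists g1 g2, [/\ L f g1, adjoint f g2 &
    g = (fun eta => (g1 eta + g2 eta) / 2)].

Definition antisymmetric_part (f g : config X -> R) : Prop :=
  exists g1 g2, [/\ L f g1, adjoint f g2 &
    g = (fun eta => (g1 eta - g2 eta) / 2)].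

End Operators.

Section Schwartz.
Context {R : realType}.

Definition schwartz (H : R -> R) : Prop :=
  (forall m x, derivable (derive1n m H) x 1) /\
  (forall m p : nat, exists M : R, forall x, `|x ^+ p * (derive1n m H) x| <= M).

Definition discrete_gradient (n : nat) (H : R -> R) (x : int) : R :=
  n%:R * (H ((x + 1)%:~R / n%:R) - H (x%:~R / n%:R)).

Definition l2 (v : int -> R) : Prop :=
  (\esum_(x in [set: int]) ((v x) ^+ 2)%:E < +oo)%E.

Definition sqnorm2 (n : nat) (v : int -> R) : \bar R :=
  ((n%:R^-1)%:E * \esum_(x in [set: int]) ((v x) ^+ 2)%:E)%E.

End Schwartz.

Section Model.
Context {R : realType} {dX : measure_display} {X : measurableType dX}.

(** The set of single-site values is [X], seen in [R] through [value] (assumed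
    injective and measurable), so the real variable at [x] is [value (eta x)]. *)
Variable value : X -> R.

Section InvariantMeasures.
Variable k : nat -> R.-pker (R * config X) ~> (config X).
Variables (I : set R) (nu : R -> probability (config X) R).

Record assumption_A1 : Prop := AssumptionA1 {
  A1_invariant : forall n r, (0 < n)%N -> I r -> invariant_measure (k n) (nu r) ;
  A1_product : forall r, I r -> product_measure_on_Z (nu r) ;
  A1_translation : forall r, I r -> translation_invariant (nu r) ;
  A1_mean : forall r (x : int), I r ->
    (\int[nu r]_eta (value (eta x))%:E = r%:E)%E ;
  A1_moments : forall r (x : int) (p : nat), I r -> (2 <= p <= 4)%N ->
    (\int[nu r]_eta (`|value (eta x)| ^+ p)%:E < +oo)%E }.

End InvariantMeasures.

Variables (a rho : R) (nu : probability (config X) R).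

(** [k n] is the transition function of the process accelerated by [n ^ a],
    so that its generator is [n ^ a] times the operator [scaled_generator]. *)
Variable k : nat -> R.-pker (R * config X) ~> (config X).

Definition scaled_generator (n : nat) (f g : config X -> R) : Prop :=
  generator (k n) nu f (fun eta => n%:R `^ a * g eta).

Definition exchange_energy (zeta : config X -> R) (z : int) (f : config X -> R)
    : \bar R :=
  (\int[nu]_eta (zeta (shift z eta) * (nabla z f eta) ^+ 2)%:E)%E.

Definition assumption_A2 : Prop :=
  exists (delta : R) (zeta : nat -> config X -> R), 0 < delta /\
  forall n, (0 < n)%N ->
    [/\ measurable_fun setT (zeta n),
        forall eta, delta <= zeta n eta <= delta^-1 &
        forall f d, local_fun f -> dirichlet_form nu (scaled_generator n) f d ->
          d%:E = \esum_(z in [set: int]) exchange_energy (zeta n) z f].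

Definition etabar (x : int) (eta : config X) : R := value (eta x) - rho.

Definition chi : R := \int[nu]_eta (etabar 0 eta) ^+ 2.

Definition right_average (L : nat) (x : int) (eta : config X) : R :=
  L%:R^-1 * \sum_(1 <= i < L.+1) etabar (x + i%:Z) eta.

Definition local_difference (L : nat) (x : int) (eta : config X) : R :=
  etabar x eta * etabar (x + 1) eta - (right_average L x eta) ^+ 2 + chi / L%:R.

Context {dW : nat -> measure_display} {W : forall n, measurableType (dW n)}.
Variables (P : forall n, probability (W n) R)
  (xi : forall n, R -> W n -> config X).

(** [js n x] and [ja n x] are the currents through the bond [{x, x + 1}], and
    [xi n] is the accelerated process. Identities between elements of [L2(nu)]
    are almost sure. *)
Definition assumption_A3 : Prop :=
  exists (js ja : nat -> int -> config X -> R) (h g : nat -> config X -> R)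
         (c : nat -> R),
  (forall n, (0 < n)%N ->
    [/\ local_fun (h n) /\ measurable_fun setT (h n),
        local_fun (g n) /\ measurable_fun setT (g n) &
        forall x : int,
        [/\ js n x \in Lfun nu 2%:E /\ ja n x \in Lfun nu 2%:E,
            symmetric_part nu (scaled_generator n) (fun eta => value (eta x))
              (fun eta => js n (x - 1) eta - js n x eta),
            antisymmetric_part nu (scaled_generator n) (fun eta => value (eta x))
              (fun eta => ja n (x - 1) eta - ja n x eta),
            {ae nu, forall eta, centered nu (js n x) eta =
               h n (shift x eta) - h n (shift (x + 1) eta)} &
            {ae nu, forall eta, centered nu (ja n x) eta =
               c n * etabar x eta * etabar (x + 1) eta + g n (shift x eta)}]])
  /\
  forall (H : R -> R) (t : R) (G : nat -> config X -> R),
    schwartz H -> 0 < t ->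
    (forall n, (0 < n)%N -> L2_sum nu
       (fun x eta => discrete_gradient n H x * g n (shift x eta)) (G n)) ->
    mean_square_time_integral (P n) (@xi n)
      (fun eta => n%:R `^ (a - 1) / Num.sqrt n%:R * G n eta) t
      @[n --> \oo] --> 0%E.

End Model.

(* Main.v *)
Require Import Defs.
From HB Require Import structures.
From mathcomp Require Import all_boot all_order all_algebra finmap ring lra zify.
From mathcomp Require Import all_classical all_reals all_analysis.
From mathcomp Require Import measurable_realfun.

Set Implicit Arguments.
Unset Strict Implicit.
Unset Printing Implicit Defensive.

Import Order.TTheory GRing.Theory Num.Theory.
Import numFieldNormedType.Exports.

Local Open Scope classical_set_scope.
Local Open Scope ring_scope.

(** The function whose time integral is estimated splits into a part that the dynamics
    averages out and a small static remainder.

    Static part. For [a j] the centred variable at the site [x + j], summation by parts writes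
    [a 0 * a 1] minus the square of the average of [a 1], .., [a L] as a weighted sum of
    products of a gradient [a i - a i.+1] by a factor that is invariant under the exchange of
    [a i] and [a i.+1], minus [(a 0 - a 1) ^ 2 / (2 * L)] ([one_block_decomposition]). The mean
    of that square is [2 * chi], so the term [chi / L] leaves a centred local fluctuation
    of size [1 / L]. Summed against [v], these fluctuations have a mean square of order
    [L ^ (-2)] times the sum of the [v x ^ 2], and by stationarity they contribute
    [t ^ 2 / L ^ 2] to the bound. The gradient terms, collected bond by bond, form a sum of
    functions [Phi y] antisymmetric under the exchange over the bond [y]. Since [nu] is
    invariant under exchanges, the integral of [Phi y * f] is minus half that of
    [Phi y * nabla y f], so testing against [f] costs a multiple of the Dirichlet form of [f]
    plus the mean squares of the [Phi y]. By independence the latter sum to [L] times the sum of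
    the [v x ^ 2], and not [L ^ 2] times it ([sqr_bond_sum_le], [one_block_split]).

    Dynamic part. The process is not assumed reversible, so the bound on the variance of
    additive functionals is proved without spectral theory ([mean_square_variational]). Let [W s]
    be the integral over [[0, s]] of the semigroup applied to a bounded [U]. The Markov property
    and stationarity give twice the integral over [[0, t]] of [<U, W s>] as the mean
    square. The function [W s] belongs to the domain of the generator, which maps it to
    [evolve k s U - U] ([generator_duhamel]). If [2 <U, f> <= A + <f, - L f>] on the domain, then
    [f := W s] yields [<U, W s> <= A - <W s, evolve k s U>], and the last term integrates over
    [[0, t]] to half of the squared norm of [W t], which has a sign
    ([time_integral_correlation_ge0]). The inequality is only known for local functions, but they
    form a core of the generator ([core_extension]).

    With the lower bound [delta] on the exchange rates and the acceleration [n ^ a], the constant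
    [A] is of order [L / n ^ a] times the sum of the [v x ^ 2], which gives the first term of
    the bound. The series over the sites converges unconditionally by
    [unconditional_L2_sum]; the estimates are made on a finite partial sum, and the error
    vanishes. *)

(** * Bounded measurable functions *)

Lemma probability_total_lty d (T : measurableType d) (R : realType)
  (P : probability T R) : (P setT < +oo)%E.
Proof. by rewrite ltey_eq fin_num_measure. Qed.

Lemma kernel_total_lty d d' (T : measurableType d) (T' : measurableType d')
  (R : realType) (l : R.-pker T ~> T') x : (l x setT < +oo)%E.
Proof. by rewrite (@prob_kernel _ _ _ _ _ l) ltry. Qed.

Lemma finite_total_lty d (T : measurableType d) (R : realType)
  (m : {finite_measure set T -> \bar R}) : (m setT < +oo)%E.
Proof. by rewrite ltey_eq fin_num_measure. Qed.

#[local] Hint Extern 0 (is_true (_ < +oo)%E) =>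
  solve [exact: finite_total_lty | exact: probability_total_lty | exact: kernel_total_lty] : core.

Section BoundedMeasurable.
Context {R : realType}.

Definition bounded_measurable d (T : measurableType d) (f : T -> R) : Prop :=
  measurable_fun [set: T] f /\ exists M : R, forall x, `|f x| <= M.

Section OneSpace.
Context d (T : measurableType d).
Implicit Types f g : T -> R.

Lemma bounded_measurable_integrable (m : {measure set T -> \bar R}) f :
  (m setT < +oo)%E -> bounded_measurable f -> m.-integrable setT (EFin \o f).
Proof.
move=> moo [mf [M fM]]; apply: measurable_bounded_integrable => //.
exists M; split; first exact: num_real.
by move=> N MN x _ /=; rewrite (le_trans (fM x))// ltW.
Qed.

Lemma bounded_measurable_cst (c : R) : bounded_measurable (fun _ : T => c).
Proof. by split; [exact: measurable_cst|exists `|c|]. Qed.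

Lemma bounded_measurableD f g :
  bounded_measurable f -> bounded_measurable g ->
  bounded_measurable (fun x => f x + g x).
Proof.
move=> [mf [M fM]] [mg [N gN]]; split; first exact: measurable_funD.
by exists (M + N) => x; rewrite (le_trans (ler_normD _ _))// lerD.
Qed.

Lemma bounded_measurableM f g :
  bounded_measurable f -> bounded_measurable g ->
  bounded_measurable (fun x => f x * g x).
Proof.
move=> [mf [M fM]] [mg [N gN]]; split; first exact: measurable_funM.
by exists (M * N) => x; rewrite normrM ler_pM.
Qed.

Lemma bounded_measurableN f :
  bounded_measurable f -> bounded_measurable (fun x => - f x).
Proof.
move=> [mf [M fM]]; split; first exact: measurable_funN.
by exists M => x; rewrite normrN.
Qed.

Lemma bounded_measurableB f g :
  bounded_measurable f -> bounded_measurable g ->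
  bounded_measurable (fun x => f x - g x).
Proof. by move=> bf bg; apply: bounded_measurableD => //; exact: bounded_measurableN. Qed.

Lemma bounded_measurableX f n :
  bounded_measurable f -> bounded_measurable (fun x => f x ^+ n).
Proof.
move=> bf; elim: n => [|n IH]; first exact: bounded_measurable_cst.
by under eq_fun do rewrite exprS; exact: bounded_measurableM.
Qed.

Lemma bounded_measurable_indic (A : set T) :
  measurable A -> bounded_measurable (\1_A : T -> R).
Proof.
by move=> mA; split => //; exists 1 => x; rewrite indicE; case: (_ \in _) => /=;
  rewrite ?normr1 ?normr0.
Qed.

End OneSpace.

Lemma bounded_measurable_comp d1 d2 (T1 : measurableType d1)
    (T2 : measurableType d2) (f : T2 -> R) (h : T1 -> T2) :
  bounded_measurable f -> measurable_fun setT h ->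
  bounded_measurable (fun x => f (h x)).
Proof.
move=> [mf [M fM]] mh; split; last by exists M.
exact: (measurableT_comp mf mh).
Qed.

Lemma le_norm_Rintegral_bounded d (T : measurableType d)
    (m : {measure set T -> \bar R}) (f : T -> R) (M : R) : (m setT < +oo)%E ->
  measurable_fun setT f -> (forall x, `|f x| <= M) ->
  `|\int[m]_x f x| <= M * fine (m setT).
Proof.
move=> moo mf fM.
have bf : bounded_measurable f by split => //; exists M.
apply: (le_trans (le_normr_Rintegral measurableT (bounded_measurable_integrable moo bf))).
rewrite -Rintegral_cst//; apply: le_Rintegral => //.
  apply: bounded_measurable_integrable => //; split; first exact: measurableT_comp.
  by exists M => x; rewrite normr_id.
exact/bounded_measurable_integrable/bounded_measurable_cst.
Qed.

Section TwoSpaces.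
Context d1 d2 (T1 : measurableType d1) (T2 : measurableType d2).

Lemma bounded_measurable_section2 (f : T1 * T2 -> R) x :
  bounded_measurable f -> bounded_measurable (fun y => f (x, y)).
Proof. by move=> bf; apply: (bounded_measurable_comp bf). Qed.

Lemma bounded_measurable_section1 (f : T1 * T2 -> R) y :
  bounded_measurable f -> bounded_measurable (fun x => f (x, y)).
Proof. by move=> bf; apply: (bounded_measurable_comp bf). Qed.

(** Measurability of the integral is known for nonnegative integrands, so the function is
    raised by its bound first. *)
Lemma bounded_measurable_integral_kernel (l : R.-pker T1 ~> T2) (f : T1 * T2 -> R) :
  bounded_measurable f -> bounded_measurable (fun x => \int[l x]_y f (x, y)).
Proof.
move=> bf; have [mf [M fM]] := bf; split; last first.
  exists M => x; have := @le_norm_Rintegral_bounded _ _ (l x) (fun y => f (x, y)) M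
    (kernel_total_lty l x) (bounded_measurable_section2 x bf).1 (fun y => fM (x, y)).
  by rewrite (@prob_kernel _ _ _ _ _ l) /= mulr1.
have mpos : measurable_fun setT (fun x => (\int[l x]_y (f (x, y) + M)%:E)%E).
  apply: (@measurable_fun_integral_finite_kernel _ _ _ _ _
    (fun z => (f z + M)%:E) l).
    by move=> z; rewrite lee_fin -lerBlDr sub0r; have := fM z; rewrite ler_norml => /andP[].
  by apply/measurable_EFinP; apply: measurable_funD.
have -> : (fun x => \int[l x]_y f (x, y)) =
    (fun x => fine (\int[l x]_y (f (x, y) + M)%:E)%E - M).
  apply/funext => x; rewrite -/(Rintegral _ _ _) RintegralD//.
  - by rewrite Rintegral_cst// (@prob_kernel _ _ _ _ _ l) /= mulr1 addrK.
  - exact/bounded_measurable_integrable/bounded_measurable_section2.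
  - exact/bounded_measurable_integrable/bounded_measurable_cst.
by apply: measurable_funB => //; apply: measurableT_comp.
Qed.

Lemma bounded_measurable_Rintegral (m : {finite_measure set T2 -> \bar R})
    (f : T1 * T2 -> R) :
  bounded_measurable f -> bounded_measurable (fun x => \int[m]_y f (x, y)).
Proof.
move=> bf; have [mf [M fM]] := bf; split; last first.
  exists (M * fine (m setT)) => x.
  exact: (le_norm_Rintegral_bounded (finite_total_lty m)
    (bounded_measurable_section2 x bf).1 (fun y => fM (x, y))).
have mpos : measurable_fun setT (fun x => (\int[m]_y (f (x, y) + M)%:E)%E).
  apply: (@measurable_fun_fubini_tonelli_F _ _ _ _ _ m (fun z => (f z + M)%:E)).
    by apply/measurable_EFinP; apply: measurable_funD.
  by move=> z; rewrite lee_fin -lerBlDr sub0r; have := fM z; rewrite ler_norml => /andP[].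
have -> : (fun x => \int[m]_y f (x, y)) =
    (fun x => fine (\int[m]_y (f (x, y) + M)%:E)%E - M * fine (m setT)).
  apply/funext => x; rewrite -/(Rintegral _ _ _) RintegralD//.
  - by rewrite Rintegral_cst//= addrK.
  - exact/bounded_measurable_integrable/bounded_measurable_section2.
  - exact/bounded_measurable_integrable/bounded_measurable_cst.
by apply: measurable_funB => //; apply: measurableT_comp.
Qed.

Section FubiniFinite.
Variables (m1 : {finite_measure set T1 -> \bar R})
          (m2 : {finite_measure set T2 -> \bar R}).

Let product_integrable (f : T1 * T2 -> R) : bounded_measurable f ->
  (m1 \x m2)%E.-integrable setT (EFin \o f).
Proof.
move=> bf; have [mf [M fM]] := bf; apply/integrable12ltyP => /=; first exact/measurable_EFinP.
apply: (@le_lt_trans _ _ (\int[m1]_x (M%:E * m2 setT))%E).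
  apply: ge0_le_integral => //=.
  - by move=> x _; apply: integral_ge0.
  - apply: (@measurable_fun_fubini_tonelli_F _ _ _ _ _ m2 (fun z => `|(f z)%:E|)%E) => //.
    by apply: measurableT_comp => //; exact/measurable_EFinP.
  - move=> x _; rewrite -integral_cst//; apply: ge0_le_integral => //=.
    + apply/measurable_EFinP; apply: measurableT_comp => //.
      exact: (bounded_measurable_section2 x bf).1.
    + by move=> y _; rewrite lee_fin.
rewrite integral_cst// ltey_eq fin_numM// ?fin_num_measure//.
by rewrite fin_numM// fin_num_measure.
Qed.

Let Rintegral_section (f : T1 * T2 -> R) x : bounded_measurable f ->
  ((\int[m2]_y f (x, y))%:E = \int[m2]_y (f (x, y))%:E)%E.
Proof.
move=> bf; rewrite fineK//; apply: integrable_fin_num => //.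
exact/bounded_measurable_integrable/bounded_measurable_section2.
Qed.

Lemma Rintegral_Fubini (f : T1 * T2 -> R) : bounded_measurable f ->
  \int[m1]_x \int[m2]_y f (x, y) = \int[m2]_y \int[m1]_x f (x, y).
Proof.
move=> bf; rewrite /Rintegral; congr fine.
transitivity (\int[m1]_x \int[m2]_y (f (x, y))%:E)%E.
  by apply: eq_integral => x _; exact: Rintegral_section.
rewrite (Fubini (product_integrable bf)); apply: eq_integral => y _.
rewrite fineK//; apply: integrable_fin_num => //.
exact/bounded_measurable_integrable/bounded_measurable_section1.
Qed.

End FubiniFinite.
End TwoSpaces.
End BoundedMeasurable.

(** * Square-integrable functions *)

Section SquareIntegrable.
Context d (T : measurableType d) (R : realType) (mu : probability T R).
Implicit Types f g : T -> R.

Lemma L2normE f : ('N[mu]_(2%:E)[EFin \o f] = sqrte (\int[mu]_x (f x ^+ 2)%:E))%E.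
Proof.
rewrite Lnorm.unlock -poweR12_sqrt; last by apply: integral_ge0 => x _; rewrite lee_fin sqr_ge0.
congr (_ `^ _)%E; apply: eq_integral => x _.
by rewrite /= powR_mulrn ?normr_ge0// real_normK ?num_real.
Qed.

Lemma L2norm_lt f (e : R) : 0 < e ->
  ('N[mu]_(2%:E)[EFin \o f] < e%:E)%E = (\int[mu]_x (f x ^+ 2)%:E < (e ^+ 2)%:E)%E.
Proof.
move=> e0; rewrite L2normE.
have e20 : (0 <= (e ^+ 2)%:E)%E by rewrite lee_fin sqr_ge0.
rewrite -[e%:E]gee0_abs ?lee_fin ?ltW// -sqrte_sqr -EFin_expe.
by rewrite !ltNge lee_sqrt// integral_ge0// => x _; rewrite lee_fin sqr_ge0.
Qed.

Lemma Lfun2P f : f \in Lfun mu 2%:E <->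
  measurable_fun setT f /\ (\int[mu]_x (f x ^+ 2)%:E < +oo)%E.
Proof.
have i0 : (0 <= \int[mu]_x (f x ^+ 2)%:E)%E.
  by apply: integral_ge0 => x _; rewrite lee_fin sqr_ge0.
split=> [|[mf f2]].
  move=> fL; have /andP[mf _] := fL; rewrite inE/= in mf; split => //.
  by have /integrable_lty := Lfun2_integrable_sqr fL; apply.
apply/andP; split; first by rewrite inE.
rewrite inE/= /finite_norm L2normE.
by rewrite ltey_eq sqrte_fin_num// ge0_fin_numE// f2.
Qed.

End SquareIntegrable.

Section RealIntegrable.
Context d (T : measurableType d) (R : realType) (mu : {measure set T -> \bar R}).
Implicit Types f g : T -> R.

Lemma integrable_realD f g : mu.-integrable setT (EFin \o f) ->
  mu.-integrable setT (EFin \o g) ->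
  mu.-integrable setT (EFin \o (fun x => f x + g x)).
Proof. by move=> fi gi; have := integrableD measurableT fi gi. Qed.

Lemma integrable_realZ c f : mu.-integrable setT (EFin \o f) ->
  mu.-integrable setT (EFin \o (fun x => c * f x)).
Proof. by move=> fi; have := integrableZl measurableT c fi. Qed.

Lemma integrable_realB f g : mu.-integrable setT (EFin \o f) ->
  mu.-integrable setT (EFin \o g) ->
  mu.-integrable setT (EFin \o (fun x => f x - g x)).
Proof. by move=> fi gi; have := integrableB measurableT fi gi. Qed.

Lemma integrable_real_sum (I : Type) (s : seq I) (F : I -> T -> R) :
  (forall i, mu.-integrable setT (EFin \o F i)) ->
  mu.-integrable setT (EFin \o (fun x => \sum_(i <- s) F i x)).
Proof.
move=> Fi; elim: s => [|i s IH].
  under eq_fun do rewrite big_nil; exact: integrable0.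
under eq_fun do rewrite big_cons; exact: integrable_realD.
Qed.

Lemma Rintegral_sum (I : Type) (s : seq I) (F : I -> T -> R) :
  (forall i, mu.-integrable setT (EFin \o F i)) ->
  \int[mu]_x (\sum_(i <- s) F i x) = \sum_(i <- s) \int[mu]_x F i x.
Proof.
move=> Fi; elim: s => [|i s IH].
  under eq_Rintegral do rewrite big_nil.
  by rewrite Rintegral_cst// mul0r big_nil.
under eq_Rintegral do rewrite big_cons.
by rewrite RintegralD ?big_cons ?IH//; exact: integrable_real_sum.
Qed.

End RealIntegrable.

Section SquareIntegrableTheory.
Context d (T : measurableType d) (R : realType) (mu : probability T R).
Implicit Types f g : T -> R.

Lemma Lfun2_measurable f : f \in Lfun mu 2%:E -> measurable_fun setT f.
Proof. by move=> /Lfun2P[]. Qed.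

Lemma bounded_measurable_Lfun2 f : bounded_measurable f -> f \in Lfun mu 2%:E.
Proof.
move=> bf; apply/Lfun2P; split; first exact: bf.1.
apply: (integrable_lty measurableT (f := EFin \o (fun x => f x ^+ 2))).
by apply: bounded_measurable_integrable => //; exact: bounded_measurableX.
Qed.

Lemma Lfun2_integrable2 f : f \in Lfun mu 2%:E ->
  mu.-integrable setT (EFin \o (fun x => f x ^+ 2)).
Proof. exact: Lfun2_integrable_sqr. Qed.

Lemma Lfun2_integrableM f g : f \in Lfun mu 2%:E -> g \in Lfun mu 2%:E ->
  mu.-integrable setT (EFin \o (fun x => f x * g x)).
Proof.
move=> fL gL; rewrite -[X in EFin \o X]/(f \* g).
by apply/Lfun1_integrable; exact: Lfun2_mul_Lfun1.
Qed.

Lemma Lfun2_integrable f : f \in Lfun mu 2%:E -> mu.-integrable setT (EFin \o f).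
Proof.
move=> fL; have := Lfun2_integrableM fL (bounded_measurable_Lfun2 (@bounded_measurable_cst R d T 1)).
by under eq_fun do rewrite mulr1.
Qed.

Let Lfun2_of f : measurable_fun setT f ->
  mu.-integrable setT (EFin \o (fun x => f x ^+ 2)) -> f \in Lfun mu 2%:E.
Proof.
move=> mf fi; apply/Lfun2P; split=> //.
exact: (integrable_lty measurableT fi).
Qed.

Lemma Lfun2Z c f : f \in Lfun mu 2%:E -> (fun x => c * f x) \in Lfun mu 2%:E.
Proof.
move=> fL; apply: Lfun2_of; first by apply: measurable_funM => //; exact: Lfun2_measurable.
under eq_fun do rewrite exprMn; apply: integrable_realZ; exact: Lfun2_integrable2.
Qed.

Lemma Lfun2D f g : f \in Lfun mu 2%:E -> g \in Lfun mu 2%:E ->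
  (fun x => f x + g x) \in Lfun mu 2%:E.
Proof.
move=> fL gL; apply: Lfun2_of; first by apply: measurable_funD; exact: Lfun2_measurable.
have e x : (f x + g x) ^+ 2 = (f x ^+ 2 + g x ^+ 2) + 2 * (f x * g x) by ring.
under eq_fun do rewrite e.
apply: integrable_realD; last by apply: integrable_realZ; exact: Lfun2_integrableM.
by apply: integrable_realD; exact: Lfun2_integrable2.
Qed.

Lemma Lfun2B f g : f \in Lfun mu 2%:E -> g \in Lfun mu 2%:E ->
  (fun x => f x - g x) \in Lfun mu 2%:E.
Proof.
move=> fL gL; have := Lfun2D fL (Lfun2Z (-1) gL).
by under eq_fun do rewrite mulN1r.
Qed.

Lemma Lfun2_sum (I : Type) (s : seq I) (F : I -> T -> R) :
  (forall i, F i \in Lfun mu 2%:E) ->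
  (fun x => \sum_(i <- s) F i x) \in Lfun mu 2%:E.
Proof.
move=> FL; elim: s => [|i s IH].
  under eq_fun do rewrite big_nil; exact/bounded_measurable_Lfun2/bounded_measurable_cst.
under eq_fun do rewrite big_cons; exact: Lfun2D.
Qed.

Lemma Lfun2_cst (c : R) : (fun _ : T => c) \in Lfun mu 2%:E.
Proof. exact/bounded_measurable_Lfun2/bounded_measurable_cst. Qed.

Lemma integral_sqrE f : f \in Lfun mu 2%:E ->
  (\int[mu]_x (f x ^+ 2)%:E = (\int[mu]_x (f x ^+ 2))%:E)%E.
Proof.
move=> fL; rewrite fineK//; apply: integrable_fin_num => //.
exact: (Lfun2_integrable2 fL).
Qed.

Lemma L2norm_ltE f (e : R) : 0 < e -> f \in Lfun mu 2%:E ->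
  ('N[mu]_(2%:E)[EFin \o f] < e%:E)%E = (\int[mu]_x (f x ^+ 2) < e ^+ 2).
Proof. by move=> e0 fL; rewrite L2norm_lt// integral_sqrE. Qed.

Lemma Rintegral_sqr_ge0 f : 0 <= \int[mu]_x (f x ^+ 2).
Proof. by apply: Rintegral_ge0 => x _; exact: sqr_ge0. Qed.

Lemma Rintegral_sqrD_le f g : f \in Lfun mu 2%:E -> g \in Lfun mu 2%:E ->
  \int[mu]_x ((f x + g x) ^+ 2) <=
  2 * (\int[mu]_x (f x ^+ 2)) + 2 * (\int[mu]_x (g x ^+ 2)).
Proof.
move=> fL gL.
have fi := Lfun2_integrable2 fL; have gi := Lfun2_integrable2 gL.
rewrite -!RintegralZl// -RintegralD//; try exact: integrable_realZ.
apply: le_Rintegral => //.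
- exact: (Lfun2_integrable2 (Lfun2D fL gL)).
- by apply: integrable_realD; exact: integrable_realZ.
- move=> x _; have := sqr_ge0 (f x - g x); nra.
Qed.

Lemma Rintegral_sqrB_le f g : f \in Lfun mu 2%:E -> g \in Lfun mu 2%:E ->
  \int[mu]_x ((f x - g x) ^+ 2) <=
  2 * (\int[mu]_x (f x ^+ 2)) + 2 * (\int[mu]_x (g x ^+ 2)).
Proof.
move=> fL gL; have := Rintegral_sqrD_le fL (Lfun2Z (-1) gL).
under eq_Rintegral do rewrite mulN1r.
by under [X in _ <= _ + 2 * X -> _]eq_Rintegral do rewrite mulN1r sqrrN.
Qed.

(** Only upper bounds [p] and [q] of the norms are used, so that the norms, which may
    vanish, are never divided by: the inequality is the arithmetic-geometric one with
    the weight [(p + e) / (q + e)], in the limit where [e] vanishes. *)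
Lemma Cauchy_Schwarz f g (p q : R) : f \in Lfun mu 2%:E -> g \in Lfun mu 2%:E ->
  0 <= p -> 0 <= q ->
  \int[mu]_x (f x ^+ 2) <= p ^+ 2 -> \int[mu]_x (g x ^+ 2) <= q ^+ 2 ->
  `|\int[mu]_x (f x * g x)| <= p * q.
Proof.
move=> fL gL p0 q0 fp gq.
have bound (e : R) : 0 < e -> `|\int[mu]_x (f x * g x)| <= (p + e) * (q + e).
  move=> e0; pose c := (p + e) / (q + e).
  have pe : 0 < p + e by rewrite ltr_wpDl.
  have qe : 0 < q + e by rewrite ltr_wpDl.
  have c0 : 0 < c by rewrite divr_gt0.
  have fg := Lfun2_integrableM fL gL.
  apply: (le_trans (le_normr_Rintegral measurableT fg)).
  apply: (@le_trans _ _ (\int[mu]_x ((2 * c)^-1 * f x ^+ 2 + c / 2 * g x ^+ 2))).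
    apply: le_Rintegral => //.
    - have := integrable_norm fg; by apply: eq_integrable.
    - by apply: integrable_realD; apply: integrable_realZ; exact: Lfun2_integrable2.
    - move=> x _; rewrite normrM -(real_normK (num_real (f x))) -(real_normK (num_real (g x))).
      move: (normr_ge0 (f x)) (normr_ge0 (g x)); set u := `|f x|; set w := `|g x| => u0 w0.
      have : 0 <= (2 * c)^-1 * (u - c * w) ^+ 2.
        by rewrite mulr_ge0 ?sqr_ge0// invr_ge0 mulr_ge0// ltW.
      have -> : (2 * c)^-1 * (u - c * w) ^+ 2 = (2 * c)^-1 * u ^+ 2 + c / 2 * w ^+ 2 - u * w.
        field; exact: lt0r_neq0.
      by rewrite subr_ge0.
  rewrite RintegralD//; try by apply: integrable_realZ; exact: Lfun2_integrable2.
  rewrite !RintegralZl//; try exact: Lfun2_integrable2.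
  apply: (@le_trans _ _ ((2 * c)^-1 * (p + e) ^+ 2 + c / 2 * (q + e) ^+ 2)).
    apply: lerD; apply: ler_wpM2l.
    - by rewrite invr_ge0 mulr_ge0// ltW.
    - apply: (le_trans fp); nra.
    - by rewrite divr_ge0// ltW.
    - apply: (le_trans gq); nra.
  rewrite le_eqVlt; apply/orP; left; apply/eqP; rewrite /c; field.
  by rewrite !lt0r_neq0.
apply/ler_addgt0Pr => e e0.
pose e' := Num.min 1 (e / (p + q + 1)).
have pq1 : 0 < p + q + 1 by lra.
have e'0 : 0 < e' by rewrite lt_min ltr01 divr_gt0.
apply: (le_trans (bound _ e'0)).
have e'1 : e' <= 1 by rewrite ge_min lexx.
have : e' * (p + q + 1) <= e by rewrite -ler_pdivlMr// ge_min lexx orbT.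
nra.
Qed.

End SquareIntegrableTheory.

Lemma cvge0P (R : realType) (F : set_system R) (FF : ProperFilter F) (h : R -> \bar R) :
  (forall t, 0 <= h t)%E ->
  (h @ F --> 0%E) <-> (forall e : R, 0 < e -> \forall t \near F, (h t < e%:E)%E).
Proof.
move=> h0; split.
  move=> /fine_cvgP[hfin /cvgrPdist_lt hc] e e0.
  near=> t; have tf : h t \is a fin_num by near: t.
  rewrite -[h t]fineK// lte_fin.
  have : `|0 - fine (h t)| < e by near: t; exact: hc.
  by rewrite sub0r normrN ger0_norm// fine_ge0.
move=> H; apply/fine_cvgP; split.
  near=> t; rewrite ge0_fin_numE//; apply: (@lt_trans _ _ 1%:E); last exact: ltry.
  by near: t; apply: H.
apply/cvgrPdist_lt => e e0; near=> t.
rewrite sub0r normrN ger0_norm ?fine_ge0//.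
have te : (h t < e%:E)%E by near: t; exact: H.
have tf : h t \is a fin_num by rewrite ge0_fin_numE// (lt_trans te) ?ltry.
by rewrite -lte_fin fineK.
Unshelve. all: by end_near.
Qed.

(** * Completeness of the square-integrable functions *)

Lemma sum_le_esum (R : realType) (I : choiceType) (Y : seq I) (f : I -> \bar R) : uniq Y ->
  (\sum_(y <- Y) f y <= \esum_(y in [set: I]) f y)%E.
Proof.
move=> uY; apply: esum_ge; exists [set` Y]; first by split=> //; exact: finite_seq.
by rewrite fsbig_seq.
Qed.

Section RieszFischer.
Context d (T : measurableType d) (R : realType) (mu : probability T R).

Let norm_le_sqr (p y : R) : 0 < p -> `|y| <= p * y ^+ 2 + p^-1.
Proof.
move=> p0; have q0 : 0 < p^-1 by rewrite invr_gt0.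
have h : 0 <= p^-1 * (p * `|y| - 1) ^+ 2 by rewrite mulr_ge0 ?sqr_ge0// ltW.
have E : p^-1 * (p * `|y| - 1) ^+ 2 = p * `|y| ^+ 2 - 2 * `|y| + p^-1.
  by field; exact: lt0r_neq0.
by move: h; rewrite E real_normK ?num_real//; have := normr_ge0 y; lra.
Qed.

(** The sum of the absolute increments is integrable, because
    [|y| <= 2 ^ k * y ^ 2 + 2 ^ (-k)]; hence it is almost surely finite and the sequence
    converges almost surely. Fatou's lemma turns the Cauchy estimate into the estimate of
    the distance to the limit. *)
Lemma rapid_L2_limit (g : nat -> T -> R) (K : R) : 0 <= K ->
  (forall k, g k \in Lfun mu 2%:E) ->
  (forall k m, (k <= m)%N -> \int[mu]_x ((g m x - g k x) ^+ 2) <= K * 4^-1 ^+ k) ->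
  exists2 F, F \in Lfun mu 2%:E & forall k, \int[mu]_x ((F x - g k x) ^+ 2) <= K * 4^-1 ^+ k.
Proof.
move=> K0 gL gK; pose D k x := telescope (g ^~ x) k.
have mg k : measurable_fun setT (g k) := Lfun2_measurable (gL k).
have DL k : D k \in Lfun mu 2%:E by exact: (Lfun2B (gL k.+1) (gL k)).
have mD k : measurable_fun setT (fun x => `|D k x|%:E).
  by apply/measurable_EFinP; apply: measurableT_comp => //; exact: Lfun2_measurable (DL k).
pose h x := (\sum_(k <oo) `|D k x|%:E)%E.
have mh : measurable_fun setT h by apply: (@ge0_emeasurable_sum _ _ _ _ _ xpredT) => // k x _ _; rewrite lee_fin.
have D1 k : (\int[mu]_x `|D k x|%:E <= ((K + 1) * 2^-1 ^+ k)%:E)%E.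
  have iD : mu.-integrable setT (EFin \o (fun x => 2 ^+ k * D k x ^+ 2 + 2^-1 ^+ k)).
    apply: integrable_realD; last exact: Lfun2_integrable (Lfun2_cst mu (2^-1 ^+ k)).
    exact: integrable_realZ (Lfun2_integrable2 (DL k)).
  apply: (@le_trans _ _ (\int[mu]_x (2 ^+ k * D k x ^+ 2 + 2^-1 ^+ k)%:E)%E).
    apply: ge0_le_integral => //.
    - by move/integrableP : iD => [].
    - move=> x _; rewrite lee_fin exprVn.
      exact: norm_le_sqr.
  have <- := @fineK _ (\int[mu]_x (2 ^+ k * D k x ^+ 2 + 2^-1 ^+ k)%:E)%E; last exact: integrable_fin_num.
  rewrite lee_fin -/(Rintegral _ _ _) RintegralD//; last 2 first.
  - exact: integrable_realZ (Lfun2_integrable2 (DL k)).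
  - exact: Lfun2_integrable (Lfun2_cst mu (2^-1 ^+ k)).
  rewrite RintegralZl//; last exact: Lfun2_integrable2.
  rewrite Rintegral_cst//= probability_setT mulr1 mulrDl mul1r lerD2r.
  apply: (@le_trans _ _ (2 ^+ k * (K * 4^-1 ^+ k))).
    by apply: ler_wpM2l; [exact: exprn_ge0|exact: gK].
  rewrite mulrCA -exprMn; apply: ler_wpM2l => //.
  by rewrite le_eqVlt; apply/orP; left; apply/eqP; congr (_ ^+ _); field.
have ih : (\int[mu]_x h x <= (2 * (K + 1))%:E)%E.
  rewrite integral_nneseries//.
  apply: lime_le; first by apply: is_cvg_nneseries => k _ _; apply: integral_ge0 => x _; rewrite lee_fin.
  apply: nearW => m; apply: (@le_trans _ _ (\sum_(0 <= k < m) ((K + 1) * 2^-1 ^+ k)%:E)%E).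
    by apply: lee_sum => k _; exact: D1.
  rewrite sumEFin lee_fin.
  have := @geometric_le_lim R m (K + 1) 2^-1; rewrite seriesEnat/= => H.
  apply: le_trans (H _ _ _) _; [lra|lra|by rewrite ger0_norm; lra|].
  by rewrite le_eqVlt; apply/orP; left; apply/eqP; field.
(* the limit is set to zero outside this set of full measure *)
pose E := [set x | (h x < +oo)%E].
have h0 x : (0 <= h x)%E by apply: nneseries_ge0 => k _ _; rewrite lee_fin.
have mE : measurable E.
  by have := @emeasurable_fun_infty_o _ _ _ setT h measurableT mh +oo%E; rewrite setTI.
have muE : mu (~` E) = 0%E.
  apply: measure_negligible; first exact: measurableC.
  have : mu.-integrable setT h.
    apply/integrableP; split=> //; under eq_integral do rewrite gee0_abs//.
    exact: le_lt_trans ih (ltry _).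
  move=> /(integrable_ae measurableT) [N [mN N0 HN]]; exists N; split=> // x Ex; apply: HN => /(_ I) hx.
  by apply: Ex; rewrite /E /= ltey_eq hx.
have cvE x : E x -> cvgn (g ^~ x).
  move=> Ex; have cD : cvgn (series (telescope (g ^~ x))).
    apply: normed_cvg; apply: nondecreasing_is_cvgn.
      apply/nondecreasing_seqP => m; rewrite /= seriesEnat /= big_nat_recr//=.
      by rewrite lerDl.
    exists (fine (h x)) => _ [m _ <-].
    rewrite -lee_fin fineK; last by rewrite ge0_fin_numE.
    by rewrite /normed_series_of /series /= -sumEFin; apply: nneseries_lim_ge => k _ _; rewrite lee_fin.
  rewrite (_ : g ^~ x = cst (g 0 x) + series (telescope (g ^~ x))).
    by apply: is_cvgD => //; exact: is_cvg_cst.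
  by apply/funext => m; rewrite [LHS](eq_sum_telescope (g ^~ x)).
pose F x := limn (fun m => g m x * \1_E x).
have cF x : (fun m => g m x * \1_E x) @ \oo --> F x.
  rewrite /F indicE; have [Ex|nEx] := pselect (E x).
    by rewrite mem_set//; apply: is_cvgM; [exact: cvE|exact: is_cvg_cst].
  by rewrite memNset//; under eq_fun do rewrite mulr0; exact: is_cvg_cst.
have mF : measurable_fun setT F.
  apply: measurable_fun_cvg (fun x _ => cF x) => m.
  by apply: measurable_funM => //; exact: measurable_indic.
have FK k : (\int[mu]_x ((F x - g k x) ^+ 2)%:E <= (K * 4^-1 ^+ k)%:E)%E.
  have mFk : measurable_fun setT (fun x => ((F x - g k x) ^+ 2)%:E).
    by apply/measurable_EFinP; apply: measurable_funX; exact: measurable_funB.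
  rewrite (@ge0_negligible_integral _ _ _ _ setT (~` E))//; last 2 first.
  - exact: measurableC.
  - by move=> x _; rewrite lee_fin sqr_ge0.
  rewrite setTD setCK.
  rewrite (_ : (\int[mu]_(x in E) _ = \int[mu]_(x in E)
      limn_einf (fun m => ((g (m + k)%N x - g k x) ^+ 2)%:E))%E); last first.
    apply: eq_integral => x /set_mem Ex; apply/esym.
    suff /cvg_limn_einf_sup[-> _] : (fun m => ((g (m + k)%N x - g k x) ^+ 2)%:E) @ \oo --> ((F x - g k x) ^+ 2)%:E by [].
    apply: cvg_EFin; first exact: nearW.
    have gF : g ^~ x @ \oo --> F x.
      by have := cF x; rewrite indicE mem_set//; under eq_fun do rewrite mulr1.
    have gF' : (fun m => g (m + k)%N x - g k x) @ \oo --> F x - g k x.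
      by apply: cvgB; [rewrite (cvg_shiftn k (g ^~ x))|exact: cvg_cst].
    by rewrite expr2; apply: cvgM.
  apply: le_trans (fatou _ _ _ _) _ => //.
  - move=> m; apply/measurable_EFinP; apply: measurable_funX; apply: measurable_funB; exact: measurable_funTS.
  - by move=> m x _; rewrite lee_fin sqr_ge0.
  rewrite limn_einf_lim; apply: lime_le; first exact: is_cvg_einfs.
  apply: nearW => m; apply: (@le_trans _ _ (\int[mu]_(x in E) ((g (m + k)%N x - g k x) ^+ 2)%:E)%E).
    by apply: ereal_inf_lbound; exists m => /=.
  apply: (@le_trans _ _ (\int[mu]_x ((g (m + k)%N x - g k x) ^+ 2)%:E)%E).
    apply: ge0_subset_integral => //; last by move=> x _; rewrite lee_fin sqr_ge0.
    by apply/measurable_EFinP; apply: measurable_funX; exact: measurable_funB.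
  by rewrite integral_sqrE ?lee_fin ?gK ?leq_addl//; exact: Lfun2B.
have FgL k : (fun x => F x - g k x) \in Lfun mu 2%:E.
  by apply/Lfun2P; split; [exact: measurable_funB|exact: le_lt_trans (FK k) (ltry _)].
exists F; last by move=> k; rewrite -lee_fin -integral_sqrE.
rewrite (_ : F = (fun x => (F x - g 0 x) + g 0 x)); first exact: Lfun2D.
by apply/funext => x; rewrite subrK.
Qed.

Let sum_fsetD (V : nmodType) (G : int -> V) (A B : {fset int}) : fsubset A B ->
  \sum_(x <- B) G x = \sum_(x <- A) G x + \sum_(x <- fsetD B A) G x.
Proof.
move=> /fsubsetP AB; rewrite -big_cat /=; apply: perm_big; apply: uniq_perm; rewrite ?fset_uniq//.
  rewrite cat_uniq !fset_uniq /= andbT; apply/hasPn => x /=.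
  by rewrite in_fsetD => /andP[].
move=> x; rewrite mem_cat in_fsetD; case: (boolP (x \in A)) => //= /AB; exact: id.
Qed.

(** Increasing finite sets that exhaust the mass of [s] fast enough give a rapidly Cauchy
    sequence of partial sums. Its limit is the unconditional sum, since the partial sum
    over any larger finite set differs from the chosen one by indices of small mass. *)
Lemma unconditional_L2_sum (u : int -> T -> R) (s : int -> R) (K : R) : 0 <= K ->
  (forall x, u x \in Lfun mu 2%:E) -> (forall x, 0 <= s x) ->
  (\esum_(x in [set: int]) (s x)%:E < +oo)%E ->
  (forall A : {fset int}, \int[mu]_eta ((\sum_(x <- A) u x eta) ^+ 2) <= K * \sum_(x <- A) s x) ->
  exists2 F, F \in Lfun mu 2%:E & forall e : R, 0 < e ->
    exists A0 : {fset int}, forall A : {fset int}, fsubset A0 A ->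
      ('N[mu]_(2%:E)[EFin \o (fun eta => F eta - \sum_(x <- A) u x eta)%R] < e%:E)%E.
Proof.
move=> K0 uL s0 soo uK.
pose S (A : {fset int}) eta := \sum_(x <- A) u x eta.
have SL A : S A \in Lfun mu 2%:E by exact: Lfun2_sum.
have tail (e : R) : 0 < e -> exists A0 : {fset int}, forall A B, fsubset A0 A -> fsubset A B ->
    \int[mu]_eta ((S B eta - S A eta) ^+ 2) <= K * e.
  move=> e0; have fin : (\esum_(x in [set: int]) (s x)%:E)%E \is a fin_num.
    by rewrite ge0_fin_numE//; apply: esum_ge0 => x _; rewrite lee_fin.
  have [_ [A0 [finA0 _] <-] sA0] := ub_ereal_sup_adherent e0 fin.
  exists (fset_set A0) => A B A0A AB.
  rewrite /S; under eq_Rintegral do rewrite (sum_fsetD _ AB) addrAC subrr add0r.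
  apply: le_trans (uK _) _; apply: ler_wpM2l => //.
  have : (\sum_(x <- B) (s x)%:E <= \esum_(x in [set: int]) (s x)%:E)%E.
    by apply: sum_le_esum; exact: fset_uniq.
  move: sA0; rewrite -/(esum [set: int] (fun x => (s x)%:E)) fsbig_finite// !sumEFin.
  rewrite -(fineK fin) -EFinB lte_fin !lee_fin.
  rewrite (sum_fsetD _ AB) (sum_fsetD _ A0A).
  have : 0 <= \sum_(x <- fsetD A (fset_set A0)) s x by apply: sumr_ge0.
  lra.
have q0 k : 0 < 4^-1 ^+ k :> R by rewrite exprn_gt0// invr_gt0.
have [A HA] := choice (fun k => tail _ (q0 k)).
pose B := fix B k := if k is j.+1 then fsetU (B j) (A k) else A 0.
have BS k m : (k <= m)%N -> fsubset (B k) (B m).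
  move=> /subnK <-; elim: (m - k)%N => [|j IH]; first exact: fsubset_refl.
  by rewrite addSn; apply: fsubset_trans IH (fsubsetUl _ _).
have AB k : fsubset (A k) (B k).
  by case: k => [|k]; [exact: fsubset_refl|exact: fsubsetUr].
have [F FL HF] := rapid_L2_limit K0 (fun k => SL (B k)) (fun k m km => HA k _ _ (AB k) (BS _ _ km)).
exists F => // e e0.
have z1 : `|4^-1 : R| < 1 by rewrite ger0_norm; lra.
have e20 : 0 < e ^+ 2 by rewrite exprn_gt0.
have [k _ /(_ k (leqnn k)) /= ke] := cvgr_lt _ (cvg_geometric (4 * K) z1) _ e20.
exists (B k) => C BC; rewrite L2norm_ltE//; last exact: (Lfun2B FL (SL C)).
apply: le_lt_trans ke.
have E eta : F eta - \sum_(x <- C) u x eta = (F eta - S (B k) eta) - (S C eta - S (B k) eta).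
  by rewrite /S; ring.
under eq_Rintegral do rewrite E.
apply: le_trans (Rintegral_sqrB_le (Lfun2B FL (SL (B k))) (Lfun2B (SL C) (SL (B k)))) _.
have := HF k; have := HA k _ _ (AB k) BC; lra.
Qed.

End RieszFischer.

(** * Integration over a bounded time interval *)

Section TimeIntegral.
Context {R : realType}.
Notation leb := (@lebesgue_measure R).
Implicit Types (f : R -> R) (s t : R).

Lemma lebesgue_itv_lty t : (leb `[0%R, t]%classic < +oo)%E.
Proof. by rewrite lebesgue_measure_itv; case: ifPn => _; rewrite ltry. Qed.

Let lebesgue_trace t (A : set R) : \bar R := leb (A `&` `[0%R, t]%classic).

Let lebesgue_trace0 t : lebesgue_trace t set0 = 0%E.
Proof. by rewrite /lebesgue_trace set0I measure0. Qed.

Let lebesgue_trace_ge0 t A : (0 <= lebesgue_trace t A)%E.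
Proof. exact: measure_ge0. Qed.

Let lebesgue_trace_sigma_additive t : semi_sigma_additive (lebesgue_trace t).
Proof.
exact: (@measure_semi_sigma_additive _ _ _ (mrestr leb (measurable_itv `[0%R, t]))).
Qed.

(** Lebesgue measure restricted to [0, t], for the sigma-algebra that the real
    line carries as a factor of a product space. *)
Definition lebesgue_on t : set R -> \bar R := lebesgue_trace t.

HB.instance Definition _ t := isMeasure.Build _ R R (lebesgue_on t)
  (lebesgue_trace0 t) (lebesgue_trace_ge0 t) (@lebesgue_trace_sigma_additive t).

Let lebesgue_on_fin t : fin_num_fun (lebesgue_on t).
Proof.
move=> A mA; rewrite ge0_fin_numE//; apply: le_lt_trans (lebesgue_itv_lty t).
by apply: le_measure; rewrite ?inE//; exact: measurableI.
Qed.

HB.instance Definition _ t := Measure_isFinite.Build _ _ _ (lebesgue_on t)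
  (lebesgue_on_fin t).

Let idTR : measurableTypeR R -> R := idfun.

Let measurable_idTR : measurable_fun setT idTR.
Proof. by move=> _ B mB; rewrite setTI; exact: mB. Qed.

Definition time_integral t f : R := \int[leb]_(r in `[0%R, t]) f r.

Lemma lebesgue_onT t : 0 <= t -> lebesgue_on t setT = t%:E.
Proof.
move=> t0; rewrite /lebesgue_on /lebesgue_trace setTI lebesgue_measure_itv /=.
by rewrite lte_fin; case: ltgtP t0 => // [|<-] _; rewrite ?sube0.
Qed.

Let lebesgue_onE t D (f : R -> \bar R) : measurable D -> D `<=` `[0%R, t]%classic ->
  measurable_fun D f -> {in D, forall r, (0 <= f r)%E} ->
  (\int[lebesgue_on t]_(r in D) f r = \int[leb]_(r in D) f r)%E.
Proof.
move=> mD DI mf f0.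
transitivity (\int[pushforward leb idTR]_(r in D) f r)%E.
  by apply: eq_measure_integral => A mA AD;
     rewrite /= /lebesgue_on /lebesgue_trace setIidl// => r /AD /DI.
by rewrite ge0_integral_pushforward.
Qed.

Lemma ge0_integral_lebesgue_on t (f : R -> \bar R) :
  measurable_fun setT f -> (forall r, 0 <= f r)%E ->
  (\int[lebesgue_on t]_r f r = \int[leb]_(r in `[0%R, t]) f r)%E.
Proof.
move=> mf f0.
rewrite (@ge0_negligible_integral _ _ _ _ _ (~` `[0%R, t]%classic))//.
- rewrite setDE setCK setTI lebesgue_onE//.
  exact: measurable_funTS.
- exact: measurableC.
- by rewrite /= /lebesgue_on /lebesgue_trace setICl measure0.
Qed.

Lemma integral_lebesgue_on t (f : R -> \bar R) : measurable_fun setT f ->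
  (\int[lebesgue_on t]_r f r = \int[leb]_(r in `[0%R, t]) f r)%E.
Proof.
move=> mf; rewrite integralE [RHS]integralE.
congr (_ - _)%E; apply: ge0_integral_lebesgue_on => //.
  exact: measurable_funepos.
exact: measurable_funeneg.
Qed.

Lemma Rintegral_lebesgue_on t f : bounded_measurable f ->
  \int[lebesgue_on t]_r f r = time_integral t f.
Proof.
move=> [mf _]; rewrite /time_integral /Rintegral; congr fine.
by apply: integral_lebesgue_on; exact/measurable_EFinP.
Qed.

Lemma time_integral_integrable t f : bounded_measurable f ->
  leb.-integrable `[0%R, t] (EFin \o f).
Proof.
move=> [mf [M fM]]; apply: measurable_bounded_integrable => //.
- exact: lebesgue_itv_lty.
- exact: measurable_funTS.
- exists M; split; first exact: num_real.
  by move=> N MN x _ /=; rewrite (le_trans (fM x))// ltW.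
Qed.

Lemma eq_time_integral t f g : (forall r, 0 <= r <= t -> f r = g r) ->
  time_integral t f = time_integral t g.
Proof. by move=> fg; apply: eq_Rintegral => r /[!inE]/=; rewrite in_itv; exact: fg. Qed.

Lemma le_time_integral t f g : bounded_measurable f -> bounded_measurable g ->
  (forall r, 0 <= r <= t -> f r <= g r) ->
  time_integral t f <= time_integral t g.
Proof.
by move=> bf bg fg; apply: le_Rintegral => //; exact: time_integral_integrable.
Qed.

Lemma time_integral_cst t (c : R) : 0 <= t -> time_integral t (fun=> c) = c * t.
Proof.
move=> t0; rewrite -Rintegral_lebesgue_on; last exact: bounded_measurable_cst.
by rewrite Rintegral_cst//= lebesgue_onT.
Qed.

Lemma time_integralD t f g : bounded_measurable f -> bounded_measurable g ->
  time_integral t (fun r => f r + g r) = time_integral t f + time_integral t g.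
Proof. by move=> bf bg; apply: RintegralD => //; exact: time_integral_integrable. Qed.

Lemma time_integralB t f g : bounded_measurable f -> bounded_measurable g ->
  time_integral t (fun r => f r - g r) = time_integral t f - time_integral t g.
Proof. by move=> bf bg; apply: RintegralB => //; exact: time_integral_integrable. Qed.

Lemma time_integralZ t c f : bounded_measurable f ->
  time_integral t (fun r => c * f r) = c * time_integral t f.
Proof. by move=> bf; apply: RintegralZl => //; exact: time_integral_integrable. Qed.

Lemma bounded_measurable_ler d (T : measurableType d) (f g : T -> R) :
  measurable_fun setT f -> measurable_fun setT g ->
  bounded_measurable (fun z => (f z <= g z)%R%:R : R).
Proof.
move=> mf mg; have -> : (fun z => (f z <= g z)%R%:R : R) =
    (\1_((fun z => g z - f z) @^-1` `[0, +oo[%classic)).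
  apply/funext => z; rewrite indicE; congr (nat_of_bool _)%:R.
  by apply/idP/idP => [fg|/set_mem/=]; [apply/mem_set => /=|];
    rewrite in_itv /= andbT subr_ge0.
apply: bounded_measurable_indic; rewrite -[X in measurable X]setTI.
by apply: measurable_funB.
Qed.

Lemma time_integral_trunc s t f : 0 <= s <= t ->
  time_integral t (fun r => (r <= s)%R%:R * f r) = time_integral s f.
Proof.
move=> /andP[s0 st]; rewrite /time_integral.
have -> : `[0%R, s]%classic = `[0%R, t]%classic `&` `]-oo, s]%classic.
  apply/seteqP; split => r /=; rewrite !in_itv /=.
    by move=> /andP[-> rs]; rewrite rs (le_trans rs).
  by move=> [/andP[-> _] ->].
rewrite Rintegral_mkcondr; apply: eq_Rintegral => r _.
by rewrite patchE mem_setE in_itv /=; case: ifPn; rewrite ?mul1r ?mul0r.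
Qed.

Let pushforward_invariant (phi : R -> R) :
  measurable_fun setT (phi : measurableTypeR R -> measurableTypeR R) ->
  (forall a b, leb (phi @^-1` `]a, b]%classic) = leb `]a, b]%classic) ->
  forall A, measurable A -> leb (phi @^-1` A) = leb A.
Proof.
move=> mphi inv A mA; apply/esym.
pose psi : measurableTypeR R -> measurableTypeR R := phi.
apply: (@lebesgue_measure_unique R (pushforward leb psi)) => //.
by move=> _ [[a b]] _ <- /=; rewrite /pushforward inv.
Qed.

(** Change of variables for the reflections and the translations of the line. *)
Let integral_invariant (phi : R -> R) (D : set R) f :
  measurable_fun setT (phi : measurableTypeR R -> measurableTypeR R) ->
  (forall a b, leb (phi @^-1` `]a, b]%classic) = leb `]a, b]%classic) ->
  measurable D -> bounded_measurable f ->
  (leb D < +oo)%E ->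
  \int[leb]_(r in D) f r = \int[leb]_(r in phi @^-1` D) f (phi r).
Proof.
move=> mphi inv mD bf Doo; rewrite /Rintegral; congr fine.
have invA := pushforward_invariant mphi inv.
pose psi : measurableTypeR R -> measurableTypeR R := phi.
transitivity (\int[pushforward leb psi]_(r in D) (f r)%:E)%E.
  by apply: eq_measure_integral => A mA _; rewrite /= /pushforward invA.
rewrite (@integral_pushforward _ _ _ _ _ psi mphi leb D (EFin \o f))//.
  by apply/measurable_EFinP; exact: bf.1.
have [mf [M fM]] := bf.
have mphiD : measurable (phi @^-1` D).
  by rewrite -[X in measurable X]setTI; exact: mphi.
apply: measurable_bounded_integrable => //.
- by rewrite [X in (X < _)%E](invA _ mD).
- by apply: measurable_funTS; exact: (measurableT_comp mf mphi).
- exists M; split; first exact: num_real.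
  by move=> N MN x _ /=; rewrite (le_trans (fM _))// ltW.
Qed.

Lemma time_integral_reflect t f : bounded_measurable f ->
  time_integral t f = time_integral t (fun r => f (t - r)).
Proof.
move=> bf; rewrite /time_integral.
rewrite (@integral_invariant (fun r => t - r) `[0%R, t]%classic f)//.
- congr Rintegral; apply/seteqP; split => r /=; rewrite !in_itv /= => /andP[? ?]; apply/andP; split; lra.
- exact: measurable_funB.
- move=> a b; have -> : (fun r => t - r) @^-1` `]a, b]%classic = `[t - b, t - a[%classic.
    by apply/seteqP; split => r /=; rewrite !in_itv /= => /andP[? ?]; apply/andP; split; lra.
  rewrite !lebesgue_measure_itv /= !lte_fin; have -> : (t - b < t - a) = (a < b) by lra.
  by case: ifPn => // _; rewrite -!EFinB; congr EFin; lra.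
- exact: lebesgue_itv_lty.
Qed.

Lemma time_integral_split s t f : 0 <= s -> 0 <= t -> bounded_measurable f ->
  time_integral (s + t) f = time_integral s f + time_integral t (fun r => f (s + r)).
Proof.
move=> s0 t0 bf.
have int := time_integral_integrable (s + t) bf.
rewrite -[X in X = _](subrK (time_integral s f)) addrC; congr (_ + _).
rewrite /time_integral Rintegral_itvB ?bnd_simp//; last lra.
rewrite Rintegral_itv_obnd_cbnd; last first.
  apply: integrableS int => //.
  by move=> r /=; rewrite !in_itv /= => /andP[sr ->]; rewrite andbT (le_trans s0)// ltW.
rewrite (@integral_invariant (fun r => s + r) `[s, (s + t)%R]%classic f)//.
- congr Rintegral; apply/seteqP; split => r /=; rewrite !in_itv /= => /andP[? ?]; apply/andP; split; lra.
- exact: measurable_funD.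
- move=> a b; have -> : (fun r => s + r) @^-1` `]a, b]%classic = `]a - s, b - s]%classic.
    by apply/seteqP; split => r /=; rewrite !in_itv /= => /andP[? ?]; apply/andP; split; lra.
  rewrite !lebesgue_measure_itv /= !lte_fin; have -> : (a - s < b - s) = (a < b) by lra.
  by case: ifPn => // _; rewrite -!EFinB; congr EFin; lra.
- by rewrite lebesgue_measure_itv /=; case: ifPn => _; rewrite ltry.
Qed.

Lemma bounded_measurable_time_integral d (T : measurableType d) t (f : T * R -> R) :
  bounded_measurable f -> bounded_measurable (fun x => time_integral t (fun r => f (x, r))).
Proof.
move=> bf; have -> : (fun x => time_integral t (fun r => f (x, r))) =
    (fun x => \int[lebesgue_on t]_r f (x, r)).
  apply/funext => x; rewrite Rintegral_lebesgue_on//.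
  exact: bounded_measurable_section2.
exact: (bounded_measurable_Rintegral (lebesgue_on t) bf).
Qed.

Lemma bounded_measurable_swap d1 d2 (T1 : measurableType d1) (T2 : measurableType d2)
    (f : T1 * T2 -> R) :
  bounded_measurable f -> bounded_measurable (fun z : T2 * T1 => f (z.2, z.1)).
Proof.
move=> bf; apply: (bounded_measurable_comp bf).
by apply: measurable_fun_pair => /=.
Qed.

Lemma time_integral_Fubini d (T : measurableType d) t
    (m : {finite_measure set T -> \bar R}) (f : T * R -> R) :
  bounded_measurable f ->
  \int[m]_x time_integral t (fun r => f (x, r)) =
  time_integral t (fun r => \int[m]_x f (x, r)).
Proof.
move=> bf.
transitivity (\int[m]_x \int[lebesgue_on t]_r f (x, r)).
  apply: eq_Rintegral => x _; rewrite Rintegral_lebesgue_on//.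
  exact: bounded_measurable_section2.
rewrite (Rintegral_Fubini m (lebesgue_on t) bf) Rintegral_lebesgue_on//.
exact: (bounded_measurable_Rintegral m (bounded_measurable_swap bf)).
Qed.

Lemma time_integral_swap t (f : R * R -> R) : bounded_measurable f ->
  time_integral t (fun s => time_integral t (fun r => f (s, r))) =
  time_integral t (fun r => time_integral t (fun s => f (s, r))).
Proof.
move=> bf; rewrite -Rintegral_lebesgue_on; last first.
  exact: bounded_measurable_time_integral.
rewrite time_integral_Fubini//; apply: eq_time_integral => r _.
rewrite Rintegral_lebesgue_on//; exact: bounded_measurable_section1.
Qed.

Lemma time_integral_symmetric t (g : R * R -> R) :
  bounded_measurable g -> (forall r s, g (r, s) = g (s, r)) ->
  time_integral t (fun s => time_integral t (fun r => g (s, r))) =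
  2 * time_integral t (fun s => time_integral s (fun r => g (s, r))).
Proof.
move=> bg gC.
pose ind (z : R * R) : R := (z.2 <= z.1)%R%:R.
have bind : bounded_measurable ind by apply: bounded_measurable_ler.
have bindg : bounded_measurable (fun z => ind z * g z) by exact: bounded_measurableM.
have bindg' : bounded_measurable (fun z => (1 - ind z) * g z).
  apply: bounded_measurableM => //; apply: bounded_measurableB => //.
  exact: bounded_measurable_cst.
pose low := time_integral t (fun s => time_integral t (fun r => ind (s, r) * g (s, r))).
have -> : time_integral t (fun s => time_integral s (fun r => g (s, r))) = low.
  by apply: eq_time_integral => s st; rewrite (time_integral_trunc _ st).
transitivity (low + time_integral t (fun s => time_integral t (fun r => (1 - ind (s, r)) * g (s, r)))).
  rewrite /low -time_integralD.
  - apply: eq_time_integral => s _; rewrite -time_integralD.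
    + by apply: eq_time_integral => r _; ring.
    + exact: (bounded_measurable_section2 s bindg).
    + exact: (bounded_measurable_section2 s bindg').
  - exact: (bounded_measurable_time_integral t bindg).
  - exact: (bounded_measurable_time_integral t bindg').
rewrite mulrDl mul1r; congr (_ + _).
rewrite (time_integral_swap t bindg'); apply: eq_time_integral => s /andP[s0 st].
apply/eqP; rewrite eq_sym -subr_eq0 -time_integralB; last 2 first.
- exact: (bounded_measurable_section2 s bindg).
- exact: (bounded_measurable_section1 s bindg').
(* the two integrands differ only on the diagonal, a Lebesgue-null set *)
apply/eqP; rewrite /time_integral.
transitivity (\int[leb]_(r in `[0%R, t]) ((fun r => g (s, r)) \_ [set s]) r); last first.
  rewrite -Rintegral_mkcondr setIidr ?Rintegral_set1//.
  by move=> r /= ->; rewrite in_itv /= s0.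
apply: eq_Rintegral => r _; rewrite patchE /ind /= gC.
have [->|rs] := eqVneq r s; first by rewrite mem_set// lexx /= subrr mul0r subr0 mul1r.
rewrite memNset; last by move=> /= rs'; rewrite rs' eqxx in rs.
by case: ltgtP rs => //= _ _; rewrite ?subr0 ?subrr ?mul0r ?mul1r ?subrr ?subr0.
Qed.

End TimeIntegral.

(** * Markov semigroups *)

Section Mixture.
Context d1 d2 (X : measurableType d1) (Y : measurableType d2) (R : realType).
Variables (mu : {measure set X -> \bar R}) (m : {measure set Y -> \bar R}).
Variable l : X -> {measure set Y -> \bar R}.
Hypothesis ml : forall U, measurable U -> measurable_fun setT (l ^~ U).
Hypothesis mE : forall U, measurable U -> (m U = \int[mu]_x l x U)%E.

Import HBNNSimple.

Let nnsfun_mixture (f : {nnsfun Y >-> R}) :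
  (\int[m]_y (f y)%:E = \int[mu]_x \int[l x]_y (f y)%:E)%E.
Proof.
rewrite integralT_nnsfun sintegralE.
transitivity (\int[mu]_x \sum_(r \in range f) (r%:E * l x (f @^-1` [set r])))%E; last first.
  by apply: eq_integral => x _; rewrite integralT_nnsfun sintegralE.
rewrite ge0_integral_fsum//; last 2 first.
- by move=> r; apply: measurable_funeM; exact: ml.
- by move=> r x _; apply: (mulemu_ge0 (fun r => f @^-1` [set r])); exact: preimage_nnfun0.
apply: eq_fsbigr => r _; rewrite mE//.
have [r0|r0] := leP 0 r; first by rewrite ge0_integralZl//; exact: ml.
rewrite preimage_nnfun0// integral0_eq ?mule0; last by move=> x _; rewrite measure0.
by rewrite integral0_eq// => x _; rewrite measure0 mule0.
Qed.

(** The formula for sets extends to simple functions by linearity and to nonnegative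
    functions by monotone convergence. *)
Lemma integral_mixture (f : Y -> \bar R) : (forall y, 0 <= f y)%E ->
  measurable_fun setT f -> (\int[m]_y f y = \int[mu]_x \int[l x]_y f y)%E.
Proof.
move=> f0 mf; pose f_ := nnsfun_approx measurableT mf.
have limf (m' : {measure set Y -> \bar R}) :
    (\int[m']_y f y = limn (fun n => \int[m']_y (f_ n y)%:E))%E.
  rewrite -monotone_convergence//.
  - by apply: eq_integral => y _; apply/esym/cvg_lim => //; exact: cvg_nnsfun_approx.
  - by move=> n; exact/measurable_EFinP.
  - by move=> n y _; rewrite lee_fin.
  - by move=> y _ a b ab; rewrite lee_fin; exact/lefP/nd_nnsfun_approx.
rewrite limf; under eq_fun do rewrite nnsfun_mixture.
rewrite -monotone_convergence//.
- by apply: eq_integral => x _; rewrite limf.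
- move=> n; apply: measurable_fun_integral_kernel => //; last exact/measurable_EFinP.
  by move=> y; rewrite lee_fin.
- by move=> n x _; apply: integral_ge0 => y _; rewrite lee_fin.
- move=> x _ a b ab; apply: ge0_le_integral => //.
  + by move=> y _; rewrite lee_fin.
  + exact/measurable_EFinP.
  + exact/measurable_EFinP.
  + by move=> y _; rewrite lee_fin; exact/lefP/nd_nnsfun_approx.
Qed.

End Mixture.

Section RintegralMixture.
Context d1 d2 (X : measurableType d1) (Y : measurableType d2) (R : realType).
Variables (mu : {measure set X -> \bar R}) (m : {measure set Y -> \bar R}).
Variable l : X -> {measure set Y -> \bar R}.
Hypothesis ml : forall U, measurable U -> measurable_fun setT (l ^~ U).
Hypothesis lT : forall x, l x setT = 1%E.
Hypothesis muT : (mu setT < +oo)%E.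
Hypothesis mE : forall U, measurable U -> (m U = \int[mu]_x l x U)%E.

(** Adding a constant reduces the bounded case to the nonnegative one. *)
Lemma Rintegral_mixture (f : Y -> R) : bounded_measurable f ->
  \int[m]_y f y = \int[mu]_x \int[l x]_y f y.
Proof.
move=> bf; have [mf [M fM]] := bf.
have mT : (m setT = mu setT)%E.
  by rewrite mE//; under eq_integral do rewrite lT; rewrite integral_cst// mul1e.
have fM0 y : 0 <= f y + M by rewrite -lerBlDr sub0r; have := fM y; rewrite ler_norml => /andP[].
have mfM : measurable_fun setT (EFin \o (fun y => f y + M)).
  by apply/measurable_EFinP; exact: measurable_funD.
have fin_shift (m' : {measure set Y -> \bar R}) : (m' setT < +oo)%E ->
    (\int[m']_y (f y + M)%:E)%E = (\int[m']_y f y + M * fine (m' setT))%:E.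
  move=> moo; rewrite -Rintegral_cst// -RintegralD//.
  - rewrite fineK//; apply: integrable_fin_num => //.
    exact/bounded_measurable_integrable/bounded_measurableD/bounded_measurable_cst.
  - exact: bounded_measurable_integrable.
  - exact/bounded_measurable_integrable/bounded_measurable_cst.
have := integral_mixture ml mE (fun y => _ : (0 <= (f y + M)%:E)%E) mfM.
rewrite fin_shift ?mT// => /(_ (fun y => fM0 y)).
under eq_integral do rewrite fin_shift ?lT ?ltry//= mulr1.
have bl : bounded_measurable (fun x => \int[l x]_y f y).
  split; last first.
    exists M => x; have := @le_norm_Rintegral_bounded _ _ _ (l x) f M.
    by rewrite lT ltry /= mulr1; apply.
  have -> : (fun x => \int[l x]_y f y) = (fun x => fine (\int[l x]_y (f y + M)%:E)%E - M).
    by apply/funext => x; rewrite fin_shift ?lT ?ltry//= mulr1 addrK.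
  apply: measurable_funB => //; apply: measurableT_comp => //.
  by apply: measurable_fun_integral_kernel => // y; rewrite lee_fin.
have -> : (\int[mu]_x (\int[l x]_y f y + M)%:E)%E =
    ((\int[mu]_x \int[l x]_y f y) + M * fine (mu setT))%:E.
  rewrite -Rintegral_cst// -RintegralD//.
  - rewrite fineK//; apply: integrable_fin_num => //.
    exact/bounded_measurable_integrable/bounded_measurableD/bounded_measurable_cst.
  - exact: bounded_measurable_integrable.
  - exact/bounded_measurable_integrable/bounded_measurable_cst.
by move=> [/addIr].
Qed.

End RintegralMixture.

(** Integrate the square of [m setT * f - J], where [J] is the integral of [f]. *)
Lemma sqr_Rintegral_le d (T : measurableType d) (R : realType)
    (m : {measure set T -> \bar R}) (f : T -> R) :
  (m setT < +oo)%E -> m.-integrable setT (EFin \o f) ->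
  m.-integrable setT (EFin \o (fun x => f x ^+ 2)) ->
  (\int[m]_x f x) ^+ 2 <= fine (m setT) * \int[m]_x (f x ^+ 2).
Proof.
move=> moo fi f2i; set c := fine _; set J := \int[m]_x f x; set S := \int[m]_x (f x ^+ 2).
have ic (a : R) : m.-integrable setT (EFin \o (fun _ : T => a)).
  exact/bounded_measurable_integrable/bounded_measurable_cst.
have c0 : 0 <= c by exact: fine_ge0.
have [c00|cN0] := eqVneq c 0.
  have m0 : m setT = 0%E.
    by rewrite -[m setT]fineK ?ge0_fin_numE// -/c c00.
  have -> : J = 0; last by rewrite c00 mul0r expr0n.
  rewrite /J /Rintegral (@negligible_integral _ _ _ _ _ setT)// setDv integral_set0//.
have : 0 <= \int[m]_x (c * f x - J) ^+ 2.
  by apply: Rintegral_ge0 => x _; exact: sqr_ge0.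
have -> : \int[m]_x (c * f x - J) ^+ 2 = \int[m]_x (c ^+ 2 * f x ^+ 2 + (J ^+ 2 - (2 * c * J) * f x)).
  by apply: eq_Rintegral => x _; ring.
have zf a := @integrable_realZ _ _ _ m a _ fi.
rewrite RintegralD//; last 2 first.
- exact: integrable_realZ.
- exact: integrable_realB.
rewrite RintegralB// RintegralZl// [X in _ - X]RintegralZl//.
rewrite Rintegral_cst// -/c -/J -/S => h.
have : 0 <= c * (c * S - J ^+ 2).
  have e : c * (c * S - J ^+ 2) = c ^+ 2 * S + (J ^+ 2 * c - 2 * c * J * J) by ring.
  by rewrite e.
by rewrite pmulr_rge0 ?subr_ge0// lt_neqAle eq_sym cN0.
Qed.

Lemma sqr_time_integral_le (R : realType) (t : R) (f : R -> R) : 0 <= t ->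
  bounded_measurable f ->
  (time_integral t f) ^+ 2 <= t * time_integral t (fun r => f r ^+ 2).
Proof.
move=> t0 bf; rewrite -!Rintegral_lebesgue_on//; last exact: bounded_measurableX.
have bf2 := bounded_measurableX 2 bf.
have := sqr_Rintegral_le (finite_total_lty (lebesgue_on t))
  (bounded_measurable_integrable (finite_total_lty _) bf)
  (bounded_measurable_integrable (finite_total_lty _) bf2).
by rewrite /= lebesgue_onT.
Qed.

Section Semigroup.
Context {R : realType} {dX : measure_display} {X : measurableType dX}.
Variable k : R.-pker (R * config X) ~> (config X).
Variable nu : probability (config X) R.
Hypothesis hk : markov_semigroup k nu.
Hypothesis hnu : invariant_measure k nu.
Implicit Types (U : config X -> R).

Lemma bounded_measurable_evolve U : bounded_measurable U ->
  bounded_measurable (fun z : R * config X => evolve k z.1 U z.2).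
Proof.
move=> bU; have := bounded_measurable_integral_kernel k
  (@bounded_measurable_comp R _ _ _ _ U (fun z : (R * config X) * config X => z.2) bU measurable_snd).
by congr bounded_measurable; apply/funext => -[].
Qed.

Lemma bounded_measurable_evolve_at t U : bounded_measurable U ->
  bounded_measurable (evolve k t U).
Proof. by move=> bU; exact: (bounded_measurable_section2 t (bounded_measurable_evolve bU)). Qed.

Lemma evolveD s t U eta : 0 <= s -> 0 <= t -> bounded_measurable U ->
  evolve k (s + t) U eta = evolve k s (evolve k t U) eta.
Proof.
move=> s0 t0 bU; apply: Rintegral_mixture => //.
- by move=> A mA; exact: measurableT_comp (measurable_kernel k _ mA) _.
- by move=> x; rewrite prob_kernel.
- by move=> A mA; exact: (semigroupD hk).
Qed.

Lemma Rintegral_evolve t U : 0 <= t -> bounded_measurable U ->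
  \int[nu]_eta evolve k t U eta = \int[nu]_eta U eta.
Proof.
move=> t0 bU; apply/esym; apply: Rintegral_mixture => //.
- by move=> A mA; exact: measurableT_comp (measurable_kernel k _ mA) _.
- by move=> x; rewrite prob_kernel.
- by move=> A mA; rewrite hnu.
Qed.

(** The Cauchy-Schwarz inequality for each transition law, followed by the invariance of [nu]. *)
Lemma evolve_contraction t U : 0 <= t -> bounded_measurable U ->
  \int[nu]_eta (evolve k t U eta ^+ 2) <= \int[nu]_eta (U eta ^+ 2).
Proof.
move=> t0 bU; have bU2 := bounded_measurableX 2 bU.
rewrite -(Rintegral_evolve t0 bU2); apply: le_Rintegral => //.
- exact/bounded_measurable_integrable/bounded_measurableX/bounded_measurable_evolve_at.
- exact/bounded_measurable_integrable/bounded_measurable_evolve_at.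
- move=> eta _; have moo := kernel_total_lty k (t, eta).
  have := sqr_Rintegral_le moo (bounded_measurable_integrable moo bU)
    (bounded_measurable_integrable moo bU2).
  by rewrite (@prob_kernel _ _ _ _ _ k) mul1r.
Qed.

Lemma evolveB t U U' eta : bounded_measurable U -> bounded_measurable U' ->
  evolve k t (fun x => U x - U' x) eta = evolve k t U eta - evolve k t U' eta.
Proof. by move=> bU bU'; apply: RintegralB => //; exact: bounded_measurable_integrable. Qed.

(** The occupation integral of the semigroup: the solution at time [s] of the
    evolution equation driven by the source [U], started from zero. *)
Definition duhamel U s eta : R := time_integral s (fun r => evolve k r U eta).

Lemma bounded_measurable_duhamel U s : bounded_measurable U ->
  bounded_measurable (duhamel U s).
Proof.
move=> bU; apply: (@bounded_measurable_time_integral _ _ _ s (fun z => evolve k z.2 U z.1)).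
exact: bounded_measurable_swap (bounded_measurable_evolve bU).
Qed.

Definition correlation U (z : R * R) : R :=
  \int[nu]_eta (evolve k z.1 U eta * evolve k z.2 U eta).

Lemma bounded_measurable_correlation U : bounded_measurable U ->
  bounded_measurable (correlation U).
Proof.
move=> bU.
apply: (@bounded_measurable_Rintegral R _ _ _ _ nu (fun w : (R * R) * config X =>
  evolve k w.1.1 U w.2 * evolve k w.1.2 U w.2)).
by apply: bounded_measurableM;
  [apply: (bounded_measurable_comp (h := fun w : (R * R) * config X => (w.1.1, w.2)) (bounded_measurable_evolve bU))
  |apply: (bounded_measurable_comp (h := fun w : (R * R) * config X => (w.1.2, w.2)) (bounded_measurable_evolve bU))];
  apply: measurable_fun_pair => //=; apply: measurableT_comp.
Qed.

Lemma Rintegral_mul_duhamel V U s : bounded_measurable V -> bounded_measurable U ->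
  \int[nu]_eta (V eta * duhamel U s eta) =
  time_integral s (fun r => \int[nu]_eta (V eta * evolve k r U eta)).
Proof.
move=> bV bU.
have bE : bounded_measurable (fun z : config X * R => V z.1 * evolve k z.2 U z.1).
  apply: bounded_measurableM; first exact: (bounded_measurable_comp bV).
  exact: bounded_measurable_swap (bounded_measurable_evolve bU).
rewrite -(time_integral_Fubini s nu bE); apply: eq_Rintegral => eta _.
rewrite /= time_integralZ//.
exact: (bounded_measurable_section1 eta (bounded_measurable_evolve bU)).
Qed.

Lemma sqr_duhamel_le U s : 0 <= s -> bounded_measurable U ->
  \int[nu]_eta (duhamel U s eta ^+ 2) <= s ^+ 2 * \int[nu]_eta (U eta ^+ 2).
Proof.
move=> s0 bU.
have bE2 : bounded_measurable (fun z : config X * R => evolve k z.2 U z.1 ^+ 2).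
  exact/bounded_measurableX/(bounded_measurable_swap (bounded_measurable_evolve bU)).
have bE eta := bounded_measurable_section1 eta (bounded_measurable_evolve bU).
apply: (@le_trans _ _ (\int[nu]_eta (s * time_integral s (fun r => evolve k r U eta ^+ 2)))).
  apply: le_Rintegral => //.
  - exact/bounded_measurable_integrable/bounded_measurableX/bounded_measurable_duhamel.
  - apply: bounded_measurable_integrable => //.
    apply: bounded_measurableM; first exact: bounded_measurable_cst.
    exact: (bounded_measurable_time_integral s bE2).
  - by move=> eta _; exact: (sqr_time_integral_le s0 (bE eta)).
rewrite RintegralZl//; last first.
  apply: bounded_measurable_integrable => //.
  exact: (bounded_measurable_time_integral s bE2).
rewrite (time_integral_Fubini s nu bE2) expr2 -mulrA ler_wpM2l//.
rewrite mulrC -(time_integral_cst _ s0).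
apply: le_time_integral.
- exact: (bounded_measurable_Rintegral nu (bounded_measurable_swap bE2)).
- exact: bounded_measurable_cst.
- by move=> r /andP[r0 _]; exact: evolve_contraction.
Qed.

(** Correlations are symmetric in the two times, so the integral over the triangle is half
    the integral over the square, which is the squared norm of the occupation integral up
    to time [t]. This positivity replaces the spectral calculus of the reversible case. *)
Lemma time_integral_correlation_ge0 U t : 0 <= t -> bounded_measurable U ->
  0 <= time_integral t (fun s => time_integral s (fun r => correlation U (s, r))).
Proof.
move=> t0 bU.
have bE eta := bounded_measurable_section1 eta (bounded_measurable_evolve bU).
have := time_integral_symmetric t (bounded_measurable_correlation bU).
have symm r s : correlation U (r, s) = correlation U (s, r).
  by apply: eq_Rintegral => eta _; rewrite mulrC.
move=> /(_ symm) E; rewrite -(pmulr_rge0 _ (ltr0n R 2)) -E.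
have -> : time_integral t (fun s => time_integral t (fun r => correlation U (s, r))) =
    \int[nu]_eta (duhamel U t eta * duhamel U t eta).
  rewrite Rintegral_mul_duhamel//; last exact: bounded_measurable_duhamel.
  apply: eq_time_integral => s _.
  under [RHS]eq_Rintegral do rewrite mulrC.
  rewrite Rintegral_mul_duhamel//; exact: bounded_measurable_evolve_at.
by apply: Rintegral_ge0 => eta _; rewrite -expr2 sqr_ge0.
Qed.

End Semigroup.

(** * The generator on occupation integrals *)

Section GeneratorDuhamel.
Context {R : realType} {dX : measure_display} {X : measurableType dX}.
Variable k : R.-pker (R * config X) ~> (config X).
Variable nu : probability (config X) R.
Hypothesis hk : markov_semigroup k nu.
Hypothesis hnu : invariant_measure k nu.
Implicit Types (U : config X -> R).

Lemma evolve0 U eta : bounded_measurable U -> evolve k 0 U eta = U eta.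
Proof.
move=> [mU _]; rewrite /evolve /Rintegral.
rewrite (@eq_measure_integral _ _ _ setT (\d_eta)); last by move=> A mA _; exact: (semigroup0 hk).
rewrite integral_dirac//=; last exact/measurable_EFinP.
by rewrite indicE in_setT mul1r.
Qed.

Lemma evolve_duhamel t s U eta : 0 <= t -> bounded_measurable U ->
  evolve k t (duhamel k U s) eta = time_integral s (fun r => evolve k (t + r) U eta).
Proof.
move=> t0 bU.
pose law : {finite_measure set (config X) -> \bar R} :=
  mfrestr measurableT (kernel_total_lty k (t, eta)).
have lawE (f : config X -> R) : \int[k (t, eta)]_xi f xi = \int[law]_xi f xi.
  by congr fine; apply: eq_measure_integral => A mA _; rewrite /= /mfrestr /mrestr setIT.
rewrite /evolve lawE (time_integral_Fubini s law (f := fun z => evolve k z.2 U z.1)); last first.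
  exact: bounded_measurable_swap (bounded_measurable_evolve k bU).
apply: eq_time_integral => r /andP[r0 _].
by rewrite -lawE -/(evolve k t (evolve k r U) eta) -(evolveD hk)// ltW.
Qed.

(** Moving the window of integration from [[0, s]] to [[t, s + t]] removes the integral of
    [evolve k r U] over [[0, t]] and adds the one over [[s, s + t]]. Divided by [t], these
    converge to [U] and to [evolve k s U] by strong continuity at time zero. *)
Lemma generator_duhamel U s : 0 <= s -> bounded_measurable U ->
  generator k nu (duhamel k U s) (fun eta => evolve k s U eta - U eta).
Proof.
move=> s0 bU.
have bEs t := bounded_measurable_evolve_at k t bU.
have bE eta : bounded_measurable (fun r => evolve k r U eta).
  exact: (bounded_measurable_section1 eta (bounded_measurable_evolve k bU)).
split.
- exact/bounded_measurable_Lfun2/bounded_measurable_duhamel.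
- exact/bounded_measurable_Lfun2/bounded_measurableB.
apply/cvge0P => [t|e e0]; first exact: Lnorm_ge0.
have e2 : 0 < e / 3 by rewrite divr_gt0.
have := semigroup_cont hk (bounded_measurable_Lfun2 nu bU).
move/(cvge0P _ (fun t => Lnorm_ge0 _ _ _)) => /(_ _ e2) [d /= d0 near0].
exists d => //= t td t0.
have {}near0 r : 0 <= r <= t ->
    \int[nu]_eta ((evolve k r U eta - U eta) ^+ 2) <= (e / 3) ^+ 2.
  move=> /andP[]; rewrite le_eqVlt => /predU1P[<- _|r0 rt].
    under eq_Rintegral do rewrite evolve0// subrr expr0n.
    by rewrite Rintegral_cst// mul0r sqr_ge0.
  have rd : r < d.
    by move: td; rewrite /= sub0r normrN gtr0_norm//; exact: le_lt_trans.
  have := near0 r; rewrite /= sub0r normrN gtr0_norm// => /(_ rd r0).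
  rewrite L2norm_ltE// => [/ltW//|].
  by apply/bounded_measurable_Lfun2/bounded_measurableB.
(* the error at the time r of the window; its mean over [0, t] is the error of the
   difference quotient *)
pose g (z : config X * R) := (evolve k (s + z.2) U z.1 - evolve k s U z.1)
  - (evolve k z.2 U z.1 - U z.1).
have bg : bounded_measurable g.
  apply: bounded_measurableB; apply: bounded_measurableB.
  - apply: (bounded_measurable_comp (h := fun z : config X * R => (s + z.2, z.1))
      (bounded_measurable_evolve k bU)).
    by apply: measurable_fun_pair => //=; apply: measurable_funD.
  - exact: (bounded_measurable_comp (bEs s)).
  - exact: bounded_measurable_swap (bounded_measurable_evolve k bU).
  - exact: (bounded_measurable_comp bU).
have gE eta : t^-1 * (evolve k t (duhamel k U s) eta - duhamel k U s eta)
    - (evolve k s U eta - U eta) = t^-1 * time_integral t (fun r => g (eta, r)).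
  rewrite evolve_duhamel ?ltW//.
  have bEs' : bounded_measurable (fun r => evolve k (s + r) U eta).
    by apply: (bounded_measurable_comp (bE eta)); apply: measurable_funD.
  have := time_integral_split s0 (ltW t0) (bE eta).
  rewrite [s + t]addrC (time_integral_split (ltW t0) s0 (bE eta)) => split_eq.
  have -> : time_integral s (fun r => evolve k (t + r) U eta) - duhamel k U s eta =
      time_integral t (fun r => evolve k (s + r) U eta) - time_integral t (fun r => evolve k r U eta).
    by move: split_eq; rewrite /duhamel => split_eq; lra.
  have bc (c : R) := @bounded_measurable_cst R _ R c.
  rewrite /g !time_integralB//=; try exact: bounded_measurableB.
  rewrite !time_integral_cst ?ltW//; field; exact: lt0r_neq0.
under eq_fun do rewrite gE.
have bI := bounded_measurable_time_integral t bg.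
have bg2 := bounded_measurableX 2 bg.
rewrite L2norm_ltE//; last first.
  exact/bounded_measurable_Lfun2/bounded_measurableM/bI/bounded_measurable_cst.
apply: (@le_lt_trans _ _ (4 * (e / 3) ^+ 2)); last by nra.
apply: (@le_trans _ _ (\int[nu]_eta (t^-1 * time_integral t (fun r => g (eta, r) ^+ 2)))).
  apply: le_Rintegral => //.
  - apply/bounded_measurable_integrable => //; apply/bounded_measurableX/bounded_measurableM/bI.
    exact: bounded_measurable_cst.
  - apply/bounded_measurable_integrable => //.
    apply: bounded_measurableM; first exact: bounded_measurable_cst.
    exact: (bounded_measurable_time_integral t bg2).
  - move=> eta _; rewrite exprMn expr2 -mulrA.
    apply: ler_wpM2l; first by rewrite invr_ge0 ltW.
    rewrite ler_pdivrMl//; apply: sqr_time_integral_le; first exact: ltW.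
    exact: (bounded_measurable_section2 eta bg).
rewrite RintegralZl//; last first.
  apply: bounded_measurable_integrable => //; exact: (bounded_measurable_time_integral t bg2).
rewrite (time_integral_Fubini t nu bg2) ler_pdivrMl// mulrC -(time_integral_cst _ (ltW t0)).
apply: le_time_integral.
- exact: (bounded_measurable_Rintegral nu (bounded_measurable_swap bg2)).
- exact: bounded_measurable_cst.
- move=> r /andP[r0 rt].
  have bD : bounded_measurable (fun eta => evolve k r U eta - U eta) by exact: bounded_measurableB.
  have bDs : bounded_measurable (fun eta => evolve k (s + r) U eta - evolve k s U eta).
    exact: bounded_measurableB.
  apply: (le_trans (Rintegral_sqrB_le (bounded_measurable_Lfun2 nu bDs) (bounded_measurable_Lfun2 nu bD))).
  have nearr := near0 r (introT andP (conj r0 rt)).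
  have : \int[nu]_eta ((evolve k (s + r) U eta - evolve k s U eta) ^+ 2) <= (e / 3) ^+ 2.
    apply: le_trans nearr.
    under eq_Rintegral => eta _ do rewrite (evolveD hk)// -(evolveB k)//.
    exact: (evolve_contraction hnu).
  lra.
Qed.

(** The variational bound extends from the local functions to the whole domain
    of the generator because the local functions form a core. *)
Lemma core_extension (V : config X -> R) (A : R) : V \in Lfun nu 2%:E ->
  (forall f g, local_fun f -> generator k nu f g ->
     2 * \int[nu]_eta (V eta * f eta) <= A - \int[nu]_eta (f eta * g eta)) ->
  forall f g, generator k nu f g ->
     2 * \int[nu]_eta (V eta * f eta) <= A - \int[nu]_eta (f eta * g eta).
Proof.
move=> VL HV f g fg; have [fL gL _] := fg.
pose nrm (h : config X -> R) := Num.sqrt (\int[nu]_eta (h eta ^+ 2)).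
have nrm0 h : 0 <= nrm h by exact: sqrtr_ge0.
have nrmE h : \int[nu]_eta (h eta ^+ 2) <= nrm h ^+ 2.
  by rewrite sqr_sqrtr// Rintegral_sqr_ge0.
apply/ler_addgt0Pr => e e0.
pose K := 2 * nrm V + nrm f + nrm g + 1.
have K0 : 0 < K by have := (nrm0 V, nrm0 f, nrm0 g) => -[[]]; rewrite /K; lra.
pose e' := Num.min 1 (e / K).
have e'0 : 0 < e' by rewrite lt_min ltr01 divr_gt0.
have e'1 : e' <= 1 by rewrite ge_min lexx.
have e'K : e' * K <= e by rewrite -ler_pdivlMr// ge_min lexx orbT.
have [f' [g' [lf' gen' ff' gg']]] := local_core hk fg e'0.
have [f'L g'L _] := gen'.
have dfL := Lfun2B fL f'L; have dgL := Lfun2B gL g'L.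
move: ff'; rewrite /L2norm L2norm_ltE// => /ltW ff'.
move: gg'; rewrite /L2norm L2norm_ltE// => /ltW gg'.
have := HV _ _ lf' gen'.
have h1 := Cauchy_Schwarz VL dfL (nrm0 V) (ltW e'0) (nrmE V) ff'.
have h2 := Cauchy_Schwarz dfL gL (ltW e'0) (nrm0 g) ff' (nrmE g).
have h3 := Cauchy_Schwarz fL dgL (nrm0 f) (ltW e'0) (nrmE f) gg'.
have h4 := Cauchy_Schwarz dfL dgL (ltW e'0) (ltW e'0) ff' gg'.
have E1 : \int[nu]_eta (V eta * f eta) =
    \int[nu]_eta (V eta * f' eta) + \int[nu]_eta (V eta * (f eta - f' eta)).
  rewrite -RintegralD//; try exact: Lfun2_integrableM.
  by apply: eq_Rintegral => eta _; ring.
have E2 : \int[nu]_eta (f' eta * g' eta) = \int[nu]_eta (f eta * g eta)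
    - \int[nu]_eta ((f eta - f' eta) * g eta) - \int[nu]_eta (f eta * (g eta - g' eta))
    + \int[nu]_eta ((f eta - f' eta) * (g eta - g' eta)).
  have i1 := Lfun2_integrableM fL gL; have i2 := Lfun2_integrableM dfL gL.
  have i3 := Lfun2_integrableM fL dgL; have i4 := Lfun2_integrableM dfL dgL.
  have i12 := integrable_realB i1 i2; have i123 := integrable_realB i12 i3.
  rewrite -(RintegralB measurableT i1 i2) -(RintegralB measurableT i12 i3).
  rewrite -(RintegralD measurableT i123 i4).
  by apply: eq_Rintegral => eta _; ring.
rewrite E2 E1 => h0.
move: h1 h2 h3 h4; rewrite !ler_norml => /andP[_ h1] /andP[_ h2] /andP[_ h3] /andP[h4 _].
have := nrm0 V; have := nrm0 f; have := nrm0 g; move: e'K; rewrite /K.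
nra.
Qed.

End GeneratorDuhamel.

(** * Stationary Markov processes *)

Section RectangleUniqueness.
Context d1 d2 (T1 : measurableType d1) (T2 : measurableType d2) (R : realType).

Lemma measure_rectangle_unique (m1 m2 : {measure set (T1 * T2) -> \bar R}) :
  (m1 setT < +oo)%E ->
  (forall A B, measurable A -> measurable B -> m1 (A `*` B) = m2 (A `*` B)) ->
  forall C, measurable C -> m1 C = m2 C.
Proof.
move=> moo mAB C; rewrite measurable_prod_measurableType => mC.
apply: (@g_sigma_algebra_measure_unique _ _ _ _ _ (fun=> setT)) mC => //.
- by move=> _ [A mA [B mB <-]]; exact: measurableX.
- by move=> _; exists setT => //; exists setT => //; rewrite setXTT.
- by rewrite bigcup_const//; exists 0%N.
- move=> _ _ [A1 mA1 [B1 mB1 <-]] [A2 mA2 [B2 mB2 <-]].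
  exists (A1 `&` A2); first exact: measurableI.
  by exists (B1 `&` B2); [exact: measurableI|rewrite setXI].
- by move=> _ [A mA [B mB <-]]; exact: mAB.
Qed.

End RectangleUniqueness.

Lemma Rintegral_image d1 d2 (T1 : measurableType d1) (T2 : measurableType d2)
    (R : realType) (mu : {measure set T1 -> \bar R}) (phi : T1 -> T2)
    (mu' : {measure set T2 -> \bar R}) (f : T2 -> R) :
  measurable_fun setT phi -> (mu setT < +oo)%E ->
  (forall C, measurable C -> mu' C = mu (phi @^-1` C)) -> bounded_measurable f ->
  \int[mu']_y f y = \int[mu]_x f (phi x).
Proof.
move=> mphi moo mu'E bf; rewrite /Rintegral; congr fine.
pose mu2 : {measure set T2 -> \bar R} := pushforward mu phi.
rewrite (eq_measure_integral (mu2 mphi)) => [|C mC _]; last by rewrite mu'E.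
rewrite (integral_pushforward mphi)//; first by apply/measurable_EFinP; exact: bf.1.
exact: (bounded_measurable_integrable moo (bounded_measurable_comp bf mphi)).
Qed.

Section MixtureMeasure.
Context d1 d2 (X : measurableType d1) (Y : measurableType d2) (R : realType).
Variables (mu : {measure set X -> \bar R}) (l : X -> {measure set Y -> \bar R}).
Variable ml : forall U, measurable U -> measurable_fun setT (l ^~ U).

(** The law of a point drawn from [l x] when [x] is drawn from [mu]. The measurability of
    [l] is an argument so that the measure structure can be inferred from the term. *)
Definition mixture & (forall U, measurable U -> measurable_fun setT (l ^~ U)) :=
  fun U => (\int[mu]_x l x U)%E.

Local Notation mix := (mixture ml).

Let mixture0 : mix set0 = 0%E.
Proof. by apply: integral0_eq => x _; rewrite measure0. Qed.

Let mixture_ge0 U : (0 <= mix U)%E.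
Proof. exact: integral_ge0. Qed.

Let mixture_sigma_additive : semi_sigma_additive mix.
Proof.
move=> F mF tF mUF; rewrite [X in _ --> X](_ : _ =
  (\int[mu]_x (\sum_(n <oo) l x (F n)))%E); last first.
  apply: eq_integral => V _.
  by apply/esym/cvg_lim => //; exact/measure_semi_sigma_additive.
apply/cvg_closeP; split.
  by apply: is_cvg_nneseries => n _ _; exact: integral_ge0.
by rewrite closeE// integral_nneseries// => n; exact: ml.
Qed.

HB.instance Definition _ := isMeasure.Build _ _ _ mix
  mixture0 mixture_ge0 mixture_sigma_additive.

End MixtureMeasure.

Section Process.
Context {R : realType} {dX : measure_display} {X : measurableType dX}.
Variable k : R.-pker (R * config X) ~> (config X).
Variable nu : probability (config X) R.
Hypothesis hk : markov_semigroup k nu.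
Hypothesis hnu : invariant_measure k nu.
Context {dW : measure_display} {W : measurableType dW}.
Variables (P : probability W R) (xi : R -> W -> config X).
Hypothesis hxi : markov_process k nu P xi.
Implicit Types (U F : config X -> R).

Let D : set (R * W) := `[0%R, +oo[ `*` [set: W].

(** The process is jointly measurable at nonnegative times only; a constant value at the
    negative ones makes it measurable on the whole product. *)
Definition extended_process : R * W -> config X := (fun z => xi z.1 z.2) \_ D.
Local Notation xi' := extended_process.

Lemma measurable_extended_process : measurable_fun setT xi'.
Proof.
have mD : measurable D by apply: measurableX.
apply/(measurable_restrictT _ mD).
exact: (process_measurable hxi).
Qed.

Lemma extended_processE s w : 0 <= s -> xi' (s, w) = xi s w.
Proof.
by move=> s0; rewrite /extended_process patchE mem_set//; split => //=; rewrite in_itv /= s0.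
Qed.

Lemma measurable_process s : 0 <= s -> measurable_fun setT (xi s).
Proof.
move=> s0; have -> : xi s = (fun w => xi' (s, w)).
  by apply/funext => w; rewrite extended_processE.
by apply: (measurableT_comp measurable_extended_process).
Qed.

Let transition_measurable t (U : set (config X)) : measurable U ->
  measurable_fun setT (fun eta => k (t, eta) U).
Proof. by move=> mU; exact: measurableT_comp (measurable_kernel k _ mU) _. Qed.

(** The Markov property with a trivial past, and the invariance of the initial law. *)
Lemma process_law s (A : set (config X)) : 0 <= s -> measurable A ->
  P (xi s @^-1` A) = nu A.
Proof.
move=> s0 mA.
have past_setT : past xi 0 setT.
  have [p0 pD _] := @smallest_sigma_algebra _ setT
    (\bigcup_(r in `[0%R, 0%R]) preimage_set_system setT (xi r) measurable).
  by have := pD _ p0; rewrite setD0.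
have := process_markov hxi (lexx 0) s0 past_setT mA.
rewrite setTI subr0 => ->.
have m0 := measurable_process (lexx 0).
pose P0 : {measure set (config X) -> \bar R} := pushforward P (xi 0).
rewrite -(hnu s0 mA) (eq_measure_integral (P0 m0)); last first.
  by move=> B mB _; rewrite /= /pushforward (process_init hxi).
rewrite (ge0_integral_pushforward m0)//=; exact: transition_measurable.
Qed.

Lemma ge0_integral_process s (f : config X -> \bar R) : 0 <= s ->
  measurable_fun setT f -> (forall x, 0 <= f x)%E ->
  (\int[P]_w f (xi s w) = \int[nu]_eta f eta)%E.
Proof.
move=> s0 mf f0.
have ms := measurable_process s0.
pose Ps : {measure set (config X) -> \bar R} := pushforward P (xi s).
rewrite (@eq_measure_integral _ _ _ _ (Ps ms) nu); last first.
  by move=> B mB _; rewrite /= /pushforward process_law.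
by rewrite (ge0_integral_pushforward ms).
Qed.

(** The pair [(xi r, xi s)] and the mixture of the transition laws under [nu] give the same
    mass to rectangles, by the Markov property and stationarity, hence have the same law. *)
Lemma two_time_law r s U U' : 0 <= r -> r <= s ->
  bounded_measurable U -> bounded_measurable U' ->
  \int[P]_w (U (xi r w) * U' (xi s w)) =
  \int[nu]_eta (U eta * evolve k (s - r) U' eta).
Proof.
move=> r0 rs bU bU'.
have s0 := le_trans r0 rs.
have mr := measurable_process r0; have ms := measurable_process s0.
have mrs : measurable_fun setT (fun w => (xi r w, xi s w)) by exact: measurable_fun_pair.
have mpair (eta : config X) : measurable_fun setT (pair eta : config X -> config X * config X).
  by apply: measurable_fun_pair.
pose t := s - r.
pose l (eta : config X) : {measure set (config X * config X) -> \bar R} :=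
  pushforward (k (t, eta)) (pair eta : config X -> config X * config X).
pose m : {measure set (config X * config X) -> \bar R} :=
  pushforward P (fun w => (xi r w, xi s w)).
have ml C : measurable C -> measurable_fun setT (l mpair ^~ C).
  move=> mC; rewrite /l /= /pushforward.
  pose C' := (fun z : (R * config X) * config X => (z.1.2, z.2)) @^-1` C.
  have mC' : measurable C'.
    rewrite -[X in measurable X]setTI; apply: measurable_fun_pair => //=.
    exact: (measurableT_comp measurable_snd measurable_fst).
  have mk := measurable_fun_xsection_finite_kernel k (mem_set mC').
  have := measurableT_comp mk (pair1_measurable t).
  congr (measurable_fun setT _); apply/funext => eta /=; congr (k _ _).
  by apply/seteqP; split => x; rewrite /xsection /= inE.
have mE C : measurable C -> (m mrs C = mixture nu ml C)%E.
  apply: measure_rectangle_unique => [|A B mA mB].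
    by rewrite /= /pushforward preimage_setT.
  rewrite /= /pushforward.
  have pastA : past xi r (xi r @^-1` A).
    apply: sub_sigma_algebra; exists r => /=; first by rewrite in_itv /= r0 lexx.
    by exists A => //; rewrite setTI.
  transitivity (P (xi r @^-1` A `&` xi s @^-1` B)); first by [].
  rewrite (process_markov hxi r0 rs pastA mB) -/t.
  pose Pr : {measure set (config X) -> \bar R} := pushforward P (xi r).
  transitivity (\int[Pr mr]_(eta in A) k (t, eta) B)%E.
    rewrite (ge0_integral_pushforward mr)//; apply: measurable_funTS; exact: transition_measurable.
  transitivity (\int[nu]_(eta in A) k (t, eta) B)%E.
    by apply: eq_measure_integral => C' mC' _; rewrite /= /pushforward process_law.
  rewrite integral_mkcond /mixture; apply: eq_integral => eta _.
  rewrite patchE /l /= /pushforward; case: ifPn => [|/negP] etaA.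
    by congr (k _ _); apply/seteqP; split => x //=; [split => //; exact: set_mem|case].
  rewrite (_ : _ @^-1` _ = set0) ?measure0//.
  by apply/seteqP; split => x // [/= /mem_set].
have bf : bounded_measurable (fun z : config X * config X => U z.1 * U' z.2).
  by apply: bounded_measurableM; [exact: (bounded_measurable_comp bU)|exact: (bounded_measurable_comp bU')].
transitivity (\int[m mrs]_z (U z.1 * U' z.2)).
  by rewrite (Rintegral_image mrs (probability_total_lty P)).
rewrite (@Rintegral_mixture _ _ _ _ R nu (m mrs) (l mpair) ml _ _ mE)//; last first.
  by move=> eta; rewrite /l /= /pushforward preimage_setT prob_kernel.
apply: eq_Rintegral => eta _.
rewrite (Rintegral_image (mpair eta) (kernel_total_lty k (t, eta)))//=.
by rewrite RintegralZl//; exact: bounded_measurable_integrable.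
Qed.

End Process.

Section MeanSquare.
Context {R : realType} {dX : measure_display} {X : measurableType dX}.
Variable k : R.-pker (R * config X) ~> (config X).
Variable nu : probability (config X) R.
Hypothesis hk : markov_semigroup k nu.
Hypothesis hnu : invariant_measure k nu.
Context {dW : measure_display} {W : measurableType dW}.
Variables (P : probability W R) (xi : R -> W -> config X).
Hypothesis hxi : markov_process k nu P xi.
Implicit Types (U F : config X -> R).
Local Notation xi' := (extended_process xi).

Let mxi' : measurable_fun setT xi' := measurable_extended_process hxi.

Lemma mean_square_extended F t : mean_square_time_integral P xi F t =
  (\int[P]_w ((\int[lebesgue_measure]_(s in `[0%R, t]) (F (xi' (s, w)))%:E) ^+ 2))%E.
Proof.
apply: eq_integral => w _; congr (_ ^+ 2)%E; apply: eq_integral => s /[!inE]/=.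
by rewrite in_itv /= => /andP[s0 _]; rewrite extended_processE.
Qed.

(** The square of the time integral is twice an integral over the pairs of times [r <= s],
    where the Markov property and stationarity make the expectation a function of [s - r];
    reflecting [r] on [[0, s]] gives the occupation integral. *)
Lemma mean_square_bounded U t : 0 <= t -> bounded_measurable U ->
  mean_square_time_integral P xi U t =
  (2 * time_integral t (fun s => \int[nu]_eta (U eta * duhamel k U s eta)))%:E.
Proof.
move=> t0 bU; rewrite mean_square_extended.
have bf : bounded_measurable (fun z : R * W => U (xi' z)) by exact: bounded_measurable_comp.
have bfw w : bounded_measurable (fun s => U (xi' (s, w))).
  exact: (bounded_measurable_section1 w bf).
pose f2 (z : W * (R * R)) := U (xi' (z.2.1, z.1)) * U (xi' (z.2.2, z.1)).
have bf2 : bounded_measurable f2.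
  by apply: bounded_measurableM;
    [apply: (bounded_measurable_comp (h := fun z : W * (R * R) => (z.2.1, z.1)) bf)
    |apply: (bounded_measurable_comp (h := fun z : W * (R * R) => (z.2.2, z.1)) bf)];
    apply: measurable_fun_pair => //=; apply: measurableT_comp.
pose G (z : R * R) := \int[P]_w f2 (w, z).
have bG : bounded_measurable G.
  exact: (bounded_measurable_Rintegral P (bounded_measurable_swap bf2)).
transitivity (\int[P]_w ((time_integral t (fun s => U (xi' (s, w)))) ^+ 2)%:E)%E.
  apply: eq_integral => w _; rewrite EFin_expe; congr (_ ^+ 2)%E.
  rewrite /time_integral fineK//; apply: integrable_fin_num => //.
  exact: time_integral_integrable.
have bfI : bounded_measurable (fun w => time_integral t (fun s => U (xi' (s, w)))).
  exact: (bounded_measurable_time_integral t (bounded_measurable_swap bf)).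
rewrite integral_sqrE; last exact: bounded_measurable_Lfun2.
congr EFin.
transitivity (\int[P]_w (time_integral t (fun s => time_integral t (fun r => f2 (w, (s, r)))))).
  apply: eq_Rintegral => w _; rewrite expr2 -time_integralZ//.
  by apply: eq_time_integral => s _; rewrite mulrC -time_integralZ.
have b1 : bounded_measurable (fun z : W * R => time_integral t (fun r => f2 (z.1, (z.2, r)))).
  apply: (bounded_measurable_time_integral t (f := fun z : (W * R) * R => f2 (z.1.1, (z.1.2, z.2)))).
  apply: (bounded_measurable_comp (h := fun z : (W * R) * R => (z.1.1, (z.1.2, z.2))) bf2).
  apply: measurable_fun_pair => /=; first exact: measurableT_comp.
  by apply: measurable_fun_pair => //=; exact: measurableT_comp.
rewrite (time_integral_Fubini t P b1) /=.
transitivity (time_integral t (fun s => time_integral t (fun r => G (s, r)))).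
  apply: eq_time_integral => s _.
  apply: (time_integral_Fubini t P (f := fun z : W * R => f2 (z.1, (s, z.2)))).
  apply: (bounded_measurable_comp (h := fun z : W * R => (z.1, (s, z.2))) bf2).
  apply: measurable_fun_pair => //=.
  by apply: measurable_fun_pair.
rewrite time_integral_symmetric//; last by move=> r s; apply: eq_Rintegral => w _; rewrite /f2 mulrC.
congr (_ * _); apply: eq_time_integral => s /andP[s0 st].
rewrite Rintegral_mul_duhamel//.
have bphi : bounded_measurable (fun r => \int[nu]_eta (U eta * evolve k r U eta)).
  have := bounded_measurable_section2 (0 : R) (bounded_measurable_correlation k nu bU).
  congr bounded_measurable; apply/funext => r; apply: eq_Rintegral => eta _.
  by rewrite (evolve0 hk).
rewrite [RHS]time_integral_reflect//; apply: eq_time_integral => r /andP[r0 rs].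
rewrite -(two_time_law hnu hxi r0 rs bU bU); apply: eq_Rintegral => w _.
by rewrite /f2 /= !extended_processE// mulrC.
Qed.

(** Replacing [F] by [U] costs, by the Cauchy-Schwarz inequality in time and stationarity,
    [t ^ 2] times a static mean square. *)
Lemma mean_square_le F U t : 0 < t -> F \in Lfun nu 2%:E -> bounded_measurable U ->
  (mean_square_time_integral P xi F t <=
   2%:E * mean_square_time_integral P xi U t +
   (2 * t ^+ 2 * \int[nu]_eta ((F eta - U eta) ^+ 2))%:E)%E.
Proof.
move=> t0 FL bU; rewrite !mean_square_extended.
have mF := Lfun2_measurable FL; have [mU _] := bU.
have FUL := Lfun2B FL (bounded_measurable_Lfun2 nu bU).
have mFU : measurable_fun setT (fun eta => F eta - U eta) by exact: measurable_funB.
have mdiff : measurable_fun setT (fun z : R * W => ((F (xi' z) - U (xi' z)) ^+ 2)%:E).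
  apply/measurable_EFinP; apply: (measurable_funX 2).
  exact: (measurableT_comp mFU mxi').
pose dif w := (\int[lebesgue_on t]_s ((F (xi' (s, w)) - U (xi' (s, w))) ^+ 2)%:E)%E.
have dif0 w : (0 <= dif w)%E by apply: integral_ge0 => s _; rewrite lee_fin sqr_ge0.
have mdif : measurable_fun setT dif.
  apply: (@measurable_fun_fubini_tonelli_G _ _ _ _ _ (lebesgue_on t) (fun z => ((F (xi' z) - U (xi' z)) ^+ 2)%:E)) => //.
  by move=> z; rewrite lee_fin sqr_ge0.
have bf : bounded_measurable (fun z : R * W => U (xi' z)) by exact: bounded_measurable_comp.
have bfw w : bounded_measurable (fun s => U (xi' (s, w))).
  exact: (bounded_measurable_section1 w bf).
have msec F' w : measurable_fun setT F' -> measurable_fun setT (fun s : R => F' (xi' (s, w))).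
  move=> mF'; apply: (measurableT_comp mF'); apply: (measurableT_comp mxi').
  exact: pair2_measurable.
have IU w : (\int[lebesgue_measure]_(s in `[0%R, t]) (U (xi' (s, w)))%:E =
    (\int[lebesgue_on t]_s U (xi' (s, w)))%:E)%E.
  rewrite fineK; last by apply: integrable_fin_num => //; exact: bounded_measurable_integrable.
  by rewrite integral_lebesgue_on//; apply/measurable_EFinP; exact: msec.
have pointwise w :
    ((\int[lebesgue_measure]_(s in `[0%R, t]) (F (xi' (s, w)))%:E) ^+ 2 <=
     2%:E * (\int[lebesgue_measure]_(s in `[0%R, t]) (U (xi' (s, w)))%:E) ^+ 2
     + (2 * t)%:E * dif w)%E.
  have := dif0 w; rewrite le_eqVlt => /predU1P.
  (* where [dif] is infinite, the integral of [F] need not exist, but the bound is infinite *)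
  have [difoo _|difoo _] := eqVneq (dif w) +oo%E.
    by rewrite difoo mulry gtr0_sg ?mulr_gt0// mul1e IU -EFin_expe -EFinM addey// leey.
  pose c s := F (xi' (s, w)) - U (xi' (s, w)).
  have mc : measurable_fun setT c by apply: measurable_funB; exact: msec.
  have ic2 : (lebesgue_on t).-integrable setT (EFin \o (fun s => c s ^+ 2)).
    apply/integrableP; split; first by apply/measurable_EFinP; exact: measurable_funX.
    under eq_integral => s _ do rewrite /= ger0_norm ?sqr_ge0//.
    by rewrite ltey.
  have ic : (lebesgue_on t).-integrable setT (EFin \o c).
    apply: (@le_integrable _ _ _ (lebesgue_on t) setT measurableT _ (EFin \o (fun s => 1 + c s ^+ 2))).
    - exact/measurable_EFinP.
    - move=> s _ /=; rewrite lee_fin [leRHS]ger0_norm ?addr_ge0 ?sqr_ge0//.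
      by rewrite ler_norml; have := sqr_ge0 (c s - 1); have := sqr_ge0 (c s + 1); nra.
    - apply: integrable_realD => //; apply: bounded_measurable_integrable => //.
      exact: bounded_measurable_cst.
  have iU : (lebesgue_on t).-integrable setT (EFin \o (fun s => U (xi' (s, w)))).
    exact: bounded_measurable_integrable.
  have -> : (\int[lebesgue_measure]_(s in `[0%R, t]) (F (xi' (s, w)))%:E =
      (\int[lebesgue_on t]_s U (xi' (s, w)) + \int[lebesgue_on t]_s c s)%:E)%E.
    rewrite -RintegralD// -integral_lebesgue_on; last by apply/measurable_EFinP; exact: msec.
    rewrite fineK; last by apply: integrable_fin_num => //; exact: integrable_realD.
    by apply: eq_integral => s _; rewrite /c addrC subrK.
  have -> : dif w = (\int[lebesgue_on t]_s (c s ^+ 2))%:E.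
    by rewrite fineK//; apply: integrable_fin_num.
  rewrite IU -!EFin_expe -!EFinM -EFinD lee_fin.
  have := sqr_Rintegral_le (finite_total_lty (lebesgue_on t)) ic ic2.
  rewrite [X in fine X](lebesgue_onT (ltW t0)) /=.
  set a := Rintegral _ _ _; set b := Rintegral _ _ _; set e := Rintegral _ _ _ => abe.
  by have := sqr_ge0 (e - a); nra.
pose u w := \int[lebesgue_on t]_s U (xi' (s, w)).
have bu : bounded_measurable u.
  exact: (bounded_measurable_Rintegral (lebesgue_on t) (bounded_measurable_swap bf)).
have bu2 := bounded_measurableX 2 bu.
apply: (@le_trans _ _ (\int[P]_w (2%:E * (u w ^+ 2)%:E + (2 * t)%:E * dif w))%E).
  apply: ge0_le_integral => //.
  - by move=> w _; exact: sqre_ge0.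
  - have -> : (fun w => (\int[lebesgue_measure]_(s in `[0%R, t]) (F (xi' (s, w)))%:E) ^+ 2)%E =
        (fun w => (\int[lebesgue_on t]_s (F (xi' (s, w)))%:E) *
          (\int[lebesgue_on t]_s (F (xi' (s, w)))%:E))%E.
      apply/funext => w; rewrite -expe2 integral_lebesgue_on//.
      by apply/measurable_EFinP; exact: msec.
    have mI : measurable_fun setT (fun w => \int[lebesgue_on t]_s (F (xi' (s, w)))%:E)%E.
      have mG : measurable_fun setT (fun z => (F (xi' z))%:E).
        by apply/measurable_EFinP; exact: measurableT_comp.
      pose G (z : R * W) := (F (xi' z))%:E.
      have -> : (fun w => \int[lebesgue_on t]_s (F (xi' (s, w)))%:E)%E =
          (fun w => fubini_G (lebesgue_on t) (G^\+)%E w - fubini_G (lebesgue_on t) (G^\-)%E w)%E.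
        by apply/funext => w; rewrite integralE; congr (_ - _)%E;
          apply: eq_integral => s _; rewrite ?funeposE ?funenegE.
      apply: emeasurable_funB.
      + by apply: measurable_fun_fubini_tonelli_G; [exact: measurable_funepos|].
      + by apply: measurable_fun_fubini_tonelli_G; [exact: measurable_funeneg|].
    exact: emeasurable_funM.
  - apply: emeasurable_funD; apply: emeasurable_funM => //.
    by apply/measurable_EFinP; exact: bu2.1.
  - by move=> w _; have := pointwise w; rewrite IU -EFin_expe.
rewrite ge0_integralD//; last 4 first.
- by move=> w _; rewrite mule_ge0// lee_fin ?sqr_ge0.
- by apply: emeasurable_funM => //; apply/measurable_EFinP; exact: bu2.1.
- by move=> w _; rewrite mule_ge0// lee_fin mulr_ge0// ltW.
- exact: emeasurable_funM.
apply: leeD.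
  rewrite ge0_integralZl//; last 2 first.
  - by apply/measurable_EFinP; exact: bu2.1.
  - by move=> w _; rewrite lee_fin sqr_ge0.
  apply: lee_wpmul2l => //; rewrite le_eqVlt; apply/orP; left; apply/eqP.
  by apply: eq_integral => w _; rewrite IU -EFin_expe.
rewrite ge0_integralZl//; last by rewrite lee_fin mulr_ge0// ltW.
have -> : (\int[P]_w dif w = (t * \int[nu]_eta ((F eta - U eta) ^+ 2))%:E)%E.
  rewrite /dif -(@fubini_tonelli _ _ _ _ _ (lebesgue_on t) P
    (fun z => ((F (xi' z) - U (xi' z)) ^+ 2)%:E) mdiff); last first.
    by move=> z; rewrite lee_fin sqr_ge0.
  rewrite ge0_integral_lebesgue_on; last 2 first.
  - have mF2 := @measurable_fun_fubini_tonelli_F _ _ _ _ _ P _ mdiff.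
    by apply: mF2 => z; rewrite lee_fin sqr_ge0.
  - by move=> s; apply: integral_ge0 => w _; rewrite lee_fin sqr_ge0.
  transitivity (\int[lebesgue_measure]_(s in `[0%R, t]) (\int[nu]_eta ((F eta - U eta) ^+ 2))%:E)%E.
    apply: eq_integral => s /[!inE]/=; rewrite in_itv /= => /andP[s0 _].
    rewrite -integral_sqrE// -(ge0_integral_process hnu hxi s0); last 2 first.
    - by apply/measurable_EFinP; exact: measurable_funX.
    - by move=> x; rewrite lee_fin sqr_ge0.
    by apply: eq_integral => w _; rewrite extended_processE.
  rewrite integral_cst//= [X in (_ * X)%E](_ : _ = t%:E); first by rewrite -EFinM mulrC.
  by rewrite -(lebesgue_onT (ltW t0)) /lebesgue_on setTI.
by rewrite -EFinM lee_fin; have := Rintegral_sqr_ge0 nu (fun eta => F eta - U eta); lra.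
Qed.

End MeanSquare.

(** * The variational bound on the variance of additive functionals *)

Section Truncation.
Context d (T : measurableType d) (R : realType) (mu : probability T R).

(** Truncation, by dominated convergence. *)
Lemma bounded_approximation (V : T -> R) (e : R) : V \in Lfun mu 2%:E -> 0 < e ->
  exists U, [/\ bounded_measurable U, \int[mu]_x ((V x - U x) ^+ 2) <= e &
    \int[mu]_x (U x ^+ 2) <= \int[mu]_x (V x ^+ 2)].
Proof.
move=> VL e0; have mV := Lfun2_measurable VL.
pose ind (n : nat) (x : T) : R := (`|V x| <= n%:R)%R%:R.
have bind n : bounded_measurable (ind n).
  by apply: bounded_measurable_ler => //; exact: measurableT_comp.
have ind01 n x : ind n x = 0 \/ ind n x = 1 by rewrite /ind; case: (_ <= _)%R; [right|left].
pose U n x := V x * ind n x.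
have bU n : bounded_measurable (U n).
  split; first by apply: measurable_funM => //; exact: (bind n).1.
  exists n%:R => x; rewrite /U /ind normrM.
  by case: (leP (`|V x|) n%:R) => Vn /=; rewrite ?normr1 ?mulr1// normr0 mulr0.
have iV2 := Lfun2_integrable2 VL.
have mdif n : measurable_fun setT (fun x => (V x - U n x) ^+ 2).
  by apply: measurable_funX; apply: measurable_funB => //; exact: (bU n).1.
have dif_le n x : (V x - U n x) ^+ 2 <= V x ^+ 2.
  by rewrite /U; case: (ind01 n x) => ->; rewrite ?mulr0 ?subr0// mulr1 subrr expr0n sqr_ge0.
have cvg : (\int[mu]_x ((V x - U n x) ^+ 2)%:E @[n --> \oo] --> \int[mu]_x 0%:E)%E.
  apply: (@dominated_cvg _ _ _ mu setT measurableT (fun n x => ((V x - U n x) ^+ 2)%:E)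
    (fun=> 0%E) (fun x => (V x ^+ 2)%:E)) => //.
  - by move=> n; apply/measurable_EFinP.
  - move=> x _; apply: cvg_near_cst; exists (Num.truncn `|V x|).+1 => // n /= Vn.
    rewrite /U /ind (_ : `|V x| <= n%:R) ?mulr1 ?subrr ?expr0n//.
    apply: ltW; apply: (lt_le_trans (truncnS_gt _)); by rewrite ler_nat.
  - by move=> n x _; rewrite /= ger0_norm ?sqr_ge0// lee_fin.
move: cvg; rewrite integral0.
move/(@fine_cvgP R _ _ _ _ 0) => [_ /cvgrPdist_lt /(_ _ e0)] [N _ /(_ N (leqnn N))].
rewrite /= sub0r normrN ger0_norm ?fine_ge0//; last by apply: integral_ge0 => x _; rewrite lee_fin sqr_ge0.
move=> eN; exists (U N); split => //; first exact: ltW.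
apply: le_Rintegral => //.
- exact/bounded_measurable_integrable/bounded_measurableX.
- move=> x _; rewrite /U; case: (ind01 N x) => ->; rewrite ?mulr1// mulr0 expr0n sqr_ge0//.
Qed.

End Truncation.

Section Variational.
Context {R : realType} {dX : measure_display} {X : measurableType dX}.
Variable k : R.-pker (R * config X) ~> (config X).
Variable nu : probability (config X) R.
Hypothesis hk : markov_semigroup k nu.
Hypothesis hnu : invariant_measure k nu.
Context {dW : measure_display} {W : measurableType dW}.
Variables (P : probability W R) (xi : R -> W -> config X).
Hypothesis hxi : markov_process k nu P xi.
Implicit Types (U F V : config X -> R).

(** The variational inequality is tested against the occupation integral [f] up to time [s],
    on which the generator acts as [evolve k s U - U]: up to the error from [V - U], it reads
    [2 <U, f> <= A + <U, f> - <f, evolve k s U>], which bounds [<U, f>] by [A] minus a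
    correlation whose integral over [[0, t]] is nonnegative. *)
Lemma mean_square_bounded_variational U V (A t e B : R) : 0 <= t ->
  bounded_measurable U -> V \in Lfun nu 2%:E -> 0 <= e -> 0 <= B ->
  \int[nu]_eta ((V eta - U eta) ^+ 2) <= e ^+ 2 ->
  \int[nu]_eta (U eta ^+ 2) <= B ^+ 2 ->
  (forall f g, local_fun f -> generator k nu f g ->
     2 * \int[nu]_eta (V eta * f eta) <= A - \int[nu]_eta (f eta * g eta)) ->
  (mean_square_time_integral P xi U t <= (2 * ((A + 2 * e * (t * B)) * t))%:E)%E.
Proof.
move=> t0 bU VL e0 B0 VU UB HV.
have HV' := core_extension hk VL HV.
rewrite (mean_square_bounded hk hnu hxi)// lee_fin ler_pM2l//.
have bW s := bounded_measurable_duhamel k s bU.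
have bP s := bounded_measurable_evolve_at k s bU.
have bcorr := bounded_measurable_correlation k nu bU.
(* integration over the triangle r <= s, written over the whole square so as to be
   jointly measurable *)
pose low (g : R * R -> R) s := time_integral t (fun r => (r <= s)%R%:R * g (s, r)).
have blow g : bounded_measurable g -> bounded_measurable (low g).
  move=> bg; apply: (bounded_measurable_time_integral t (f := fun z : R * R => (z.2 <= z.1)%R%:R * g (z.1, z.2))).
  apply: bounded_measurableM; first exact: bounded_measurable_ler.
  by congr bounded_measurable: bg; apply/funext => -[].
pose q := low (fun z => correlation k nu U (0, z.2)).
pose p := low (correlation k nu U).
have bq : bounded_measurable q.
  apply: blow; apply: (bounded_measurable_comp (h := fun z : R * R => (0 : R, z.2)) bcorr).
  by apply: measurable_fun_pair.
have bp : bounded_measurable p by exact: blow.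
have qE s : 0 <= s <= t -> \int[nu]_eta (U eta * duhamel k U s eta) = q s.
  move=> st; rewrite (Rintegral_mul_duhamel _ _ _ bU bU) /q /low (time_integral_trunc _ st).
  apply: eq_time_integral => r _; apply: eq_Rintegral => eta _.
  by rewrite /= (evolve0 hk).
have pE s : 0 <= s <= t -> \int[nu]_eta (duhamel k U s eta * evolve k s U eta) = p s.
  move=> st; under eq_Rintegral do rewrite mulrC.
  by rewrite (Rintegral_mul_duhamel _ _ _ (bP s) bU) /p /low (time_integral_trunc _ st).
have bc (c : R) := @bounded_measurable_cst R _ R c.
rewrite (eq_time_integral qE).
apply: (@le_trans _ _ (time_integral t (fun s => (A + 2 * e * (t * B)) - p s))).
  apply: le_time_integral => //; first exact: bounded_measurableB.
  move=> s st; rewrite -qE// -pE//; have /andP[s0 sT] := st.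
  have WL := bounded_measurable_Lfun2 nu (bW s).
  have UL := bounded_measurable_Lfun2 nu bU.
  have VUL := Lfun2B VL UL.
  have WB : \int[nu]_eta (duhamel k U s eta ^+ 2) <= (t * B) ^+ 2.
    apply: (le_trans (sqr_duhamel_le hnu s0 bU)); rewrite exprMn.
    by apply: ler_pM; rewrite ?sqr_ge0 ?Rintegral_sqr_ge0// lerXn2r ?nnegrE.
  have := Cauchy_Schwarz VUL WL e0 (mulr_ge0 t0 B0) VU WB.
  rewrite ler_norml => /andP[h1 _].
  have := HV' _ _ (generator_duhamel hk hnu s0 bU).
  have -> : \int[nu]_eta (V eta * duhamel k U s eta) =
      \int[nu]_eta (U eta * duhamel k U s eta) + \int[nu]_eta ((V eta - U eta) * duhamel k U s eta).
    rewrite -RintegralD//; try exact: Lfun2_integrableM.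
    by apply: eq_Rintegral => eta _; ring.
  have -> : \int[nu]_eta (duhamel k U s eta * (evolve k s U eta - U eta)) =
      \int[nu]_eta (duhamel k U s eta * evolve k s U eta) - \int[nu]_eta (U eta * duhamel k U s eta).
    rewrite -RintegralB//; last 2 first.
    - exact/bounded_measurable_integrable/bounded_measurableM.
    - exact/bounded_measurable_integrable/bounded_measurableM.
    by apply: eq_Rintegral => eta _; ring.
  lra.
rewrite time_integralB// time_integral_cst// lerBlDr lerDl.
have := time_integral_correlation_ge0 k nu t0 bU.
have pE' s : 0 <= s <= t -> time_integral s (fun r => correlation k nu U (s, r)) = p s.
  by move=> st; rewrite /p /low (time_integral_trunc _ st).
by rewrite (eq_time_integral pE').
Qed.

(** The part [V] of [F] that satisfies a variational inequality against local functions
    contributes linearly in time; the remainder contributes quadratically. The truncation of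
    [V] to a bounded function is removed by letting its error vanish. *)
Theorem mean_square_variational F V (A t : R) : 0 < t ->
  F \in Lfun nu 2%:E -> V \in Lfun nu 2%:E ->
  (forall f g, local_fun f -> generator k nu f g ->
     2 * \int[nu]_eta (V eta * f eta) <= A - \int[nu]_eta (f eta * g eta)) ->
  (mean_square_time_integral P xi F t <=
   (4 * A * t + 4 * t ^+ 2 * \int[nu]_eta ((F eta - V eta) ^+ 2))%:E)%E.
Proof.
move=> t0 FL VL HV; apply/lee_addgt0Pr => eps eps0.
pose B := Num.sqrt (\int[nu]_eta (V eta ^+ 2)).
have B0 : 0 <= B by exact: sqrtr_ge0.
pose K := 8 * t ^+ 2 * B + 4 * t ^+ 2 + 1.
have K0 : 0 < K.
  have t2 := sqr_ge0 t; have t2B := mulr_ge0 t2 B0; rewrite /K -mulrA.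
  by move: t2 t2B; lra.
pose e := Num.min 1 (eps / K).
have e0 : 0 < e by rewrite lt_min ltr01 divr_gt0.
have e1 : e <= 1 by rewrite ge_min lexx.
have eK : e * K <= eps by rewrite -ler_pdivlMr// ge_min lexx orbT.
have [U [bU VU UB]] := bounded_approximation VL (exprn_gt0 2 e0).
have UB2 : \int[nu]_eta (U eta ^+ 2) <= B ^+ 2 by rewrite sqr_sqrtr ?Rintegral_sqr_ge0.
have UL := bounded_measurable_Lfun2 nu bU.
apply: (le_trans (mean_square_le hnu hxi t0 FL bU)).
have h1 := mean_square_bounded_variational (ltW t0) bU VL (ltW e0) B0 VU UB2 HV.
have h2 : \int[nu]_eta ((F eta - U eta) ^+ 2) <=
    2 * \int[nu]_eta ((F eta - V eta) ^+ 2) + 2 * e ^+ 2.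
  have := Rintegral_sqrD_le (Lfun2B FL VL) (Lfun2B VL UL).
  have split_diff eta : F eta - V eta + (V eta - U eta) = F eta - U eta by ring.
  under eq_Rintegral do rewrite split_diff.
  move=> h; apply: (le_trans h); rewrite lerD2l ler_pM2l//.
apply: (@le_trans _ _ (2%:E * (2 * ((A + 2 * e * (t * B)) * t))%:E +
  (2 * t ^+ 2 * (2 * \int[nu]_eta ((F eta - V eta) ^+ 2) + 2 * e ^+ 2))%:E)%E).
  apply: leeD; first exact: lee_wpmul2l.
  rewrite lee_fin; apply: ler_wpM2l h2; by rewrite mulr_ge0// sqr_ge0.
rewrite -EFinM -!EFinD lee_fin.
have e2 : 4 * t ^+ 2 * e ^+ 2 <= 4 * t ^+ 2 * e.
  apply: ler_wpM2l; first by rewrite mulr_ge0// sqr_ge0.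
  by rewrite expr2 ler_piMr// ltW.
have : 8 * t ^+ 2 * B * e + 4 * t ^+ 2 * e <= eps by move: eK; rewrite /K; lra.
set I := Rintegral _ _ _; lra.
Qed.

End Variational.

(** * Product measures on the configuration space *)

Section Configurations.
Context {dX : measure_display} {X : measurableType dX}.

Definition finite_rectangle (S : {fset int}) (A : int -> set X) : set (config X) :=
  [set eta | forall x, x \in S -> A x (eta x)].

Lemma measurable_coordinate x : measurable_fun setT (fun eta : config X => eta x).
Proof.
by move=> _ A mA; rewrite setTI; apply: sub_sigma_algebra; exists x, A.
Qed.

Lemma measurable_finite_rectangle S A : (forall x, measurable (A x)) ->
  measurable (finite_rectangle S A).
Proof.
move=> mA; rewrite (_ : finite_rectangle S A =
    \bigcap_(x in [set` S]) ((fun eta : config X => eta x) @^-1` A x)) //.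
apply: fin_bigcap_measurable => // x _.
by rewrite -[X in measurable X]setTI; exact: measurable_coordinate.
Qed.

Lemma measurable_fun_config d (T : measurableType d) (h : T -> config X) :
  (forall x, measurable_fun setT (fun t => h t x)) -> measurable_fun setT h.
Proof.
move=> mh; apply: (@measurability _ _ _ _ setT h (cylinders (X := X))) => //.
by move=> _ [_ [x [A [mA ->]]] <-]; exact: mh.
Qed.

(** Finite rectangles are stable under intersection and generate the sigma-algebra. *)
Lemma config_measure_unique (R : realType) (m1 m2 : {measure set (config X) -> \bar R}) :
  (m1 setT < +oo)%E ->
  (forall S A, (forall x, measurable (A x)) ->
     m1 (finite_rectangle S A) = m2 (finite_rectangle S A)) ->
  forall B, measurable B -> m1 B = m2 B.
Proof.
move=> m1oo m12 B mB.
pose G : set (set (config X)) := [set C | exists S A,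
  (forall x, measurable (A x)) /\ C = finite_rectangle S A].
apply: (@g_sigma_algebra_measure_unique _ _ _ G _ (fun=> setT)) => //.
- by move=> _ [S [A [mA ->]]]; exact: measurable_finite_rectangle.
- move=> _; exists fset0, (fun=> setT); split => //.
  by apply/seteqP; split => eta.
- by rewrite bigcup_const//; exists 0%N.
- move=> _ _ [S [A [mA ->]]] [S' [A' [mA' ->]]].
  exists (S `|` S')%fset, (fun x => (if x \in S then A x else setT) `&`
                           (if x \in S' then A' x else setT)); split.
    by move=> x; apply: measurableI; case: ifP.
  apply/seteqP; split => eta /=.
    move=> [etaA etaA'] x _; split.
      by case: ifP => // /etaA.
    by case: ifP => // /etaA'.
  move=> H; split => x xS.
    by have /H[] : x \in (S `|` S')%fset; [rewrite inE xS|rewrite xS].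
  by have /H[_] : x \in (S `|` S')%fset; [rewrite inE xS orbT|rewrite xS].
- by move=> _ [S [A [mA ->]]]; exact: m12.
- have sigmaG := @smallest_sigma_algebra _ setT G.
  apply: (smallest_sub sigmaG _ mB).
  move=> _ [x [A [mA ->]]]; apply: sub_sigma_algebra.
  exists [fset x]%fset, (fun=> A); split => //.
  by apply/seteqP; split => eta /= => [etaA y|]; [rewrite inE => /eqP ->|apply; rewrite inE].
Qed.

Lemma measurable_shift x : measurable_fun setT (@Defs.shift _ X x).
Proof. by apply: measurable_fun_config => y; exact: measurable_coordinate. Qed.

Definition swap (z y : int) : int := if y == z then z + 1 else if y == z + 1 then z else y.

Lemma swapK z : involutive (swap z).
Proof.
move=> y; rewrite /swap; have [->|yz] := eqVneq y z.
  by rewrite eqxx; case: eqP => // ; lia.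
have [->|yz1] := eqVneq y (z + 1); first by rewrite eqxx.
by rewrite (negbTE yz) (negbTE yz1).
Qed.

Lemma exchangeE z (eta : config X) y : exchange z eta y = eta (swap z y).
Proof. by rewrite /exchange /swap; case: ifP => // _; case: ifP. Qed.

Lemma measurable_exchange z : measurable_fun setT (@exchange _ X z).
Proof.
apply: measurable_fun_config => y.
rewrite (_ : (fun eta => exchange z eta y) = (fun eta : config X => eta (swap z y))).
  exact: measurable_coordinate.
by apply/funext => eta; rewrite exchangeE.
Qed.

Definition splice (S : pred int) (p : config X * config X) : config X :=
  fun x => if S x then p.1 x else p.2 x.

Lemma measurable_splice S : measurable_fun setT (splice S).
Proof.
apply: measurable_fun_config => x; rewrite /splice; case: (S x).
  exact: (measurableT_comp (measurable_coordinate x) measurable_fst).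
exact: (measurableT_comp (measurable_coordinate x) measurable_snd).
Qed.

Context {R : realType}.
Variable nu : probability (config X) R.
Hypothesis hprod : product_measure_on_Z nu.
Hypothesis htrans : translation_invariant nu.

Let coord_set x (A : set X) : set (config X) := [set eta | A (eta x)].

Let measurable_coord_set x A : measurable A -> measurable (coord_set x A).
Proof.
by move=> mA; rewrite -[X in measurable X]setTI; exact: (measurable_coordinate x measurableT).
Qed.

Lemma identically_distributed x y (A : set X) : measurable A ->
  nu [set eta | A (eta x)] = nu [set eta | A (eta y)].
Proof.
suff H z : measurable A -> nu (coord_set z A) = nu (coord_set 0 A).
  by move=> mA; rewrite -/(coord_set x A) -/(coord_set y A) !H.
move=> mA; rewrite -(htrans z (measurable_coord_set 0 mA)); congr (nu _).
by apply/seteqP; split => eta; rewrite /coord_set /= /Defs.shift addr0.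
Qed.

(** An exchange permutes the sides of a finite rectangle, and the sites have the same law. *)
Lemma exchange_invariant z (B : set (config X)) : measurable B ->
  nu (@exchange _ X z @^-1` B) = nu B.
Proof.
move=> mB; pose m : {measure set (config X) -> \bar R} := pushforward nu (@exchange _ X z).
rewrite -[LHS]/(m (measurable_exchange z) B).
apply: config_measure_unique mB => [|S A mA].
  by rewrite /= /pushforward preimage_setT probability_setT ltry.
rewrite /= /pushforward.
have -> : @exchange _ X z @^-1` finite_rectangle S A =
    finite_rectangle [fset swap z x | x in S]%fset (A \o swap z).
  apply/seteqP; split => eta /= H x.
    by move=> /imfsetP[/= y yS ->]; have := H _ yS; rewrite exchangeE swapK.
  move=> xS; rewrite exchangeE; have := H (swap z x); rewrite /= swapK; apply.
  exact: in_imfset.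
rewrite !hprod//; last by move=> x; exact: mA.
rewrite big_imfset/=; last by move=> x y _ _; exact: (can_inj (swapK z)).
by apply: eq_bigr => x _; rewrite swapK; exact: identically_distributed.
Qed.

(** A product measure does not see whether two disjoint sets of sites are filled
    from one sample or from two independent samples: this is independence. *)
Lemma splice_law S (B : set (config X)) : measurable B ->
  (nu \x nu)%E (splice S @^-1` B) = nu B.
Proof.
move=> mB; pose m : {measure set (config X) -> \bar R} := pushforward (nu \x nu)%E (splice S).
rewrite -[LHS]/(m (measurable_splice S) B).
apply: config_measure_unique mB => [|T A mA].
  rewrite /= /pushforward preimage_setT -setXTT product_measure1E//.
  by rewrite ltey_eq fin_numM// fin_num_measure.
rewrite /= /pushforward.
have -> : splice S @^-1` finite_rectangle T A =
    finite_rectangle [fset x in T | S x]%fset A `*` finite_rectangle [fset x in T | ~~ S x]%fset A.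
  apply/seteqP; split => -[eta eta'] /=.
    move=> H; split => x; rewrite !inE /= => /andP[xT Sx]; have := H x xT; rewrite /splice /=.
      by rewrite Sx.
    by rewrite (negbTE Sx).
  move=> [H H'] x xT; rewrite /splice /=; case: ifPn => Sx.
    by apply: H; rewrite !inE /= xT.
  by apply: H'; rewrite !inE /= xT.
rewrite product_measure1E; [|exact: measurable_finite_rectangle..].
have hr T' : nu (finite_rectangle T' A) = (\prod_(x <- T') nu [set eta | A x (eta x)])%E.
  exact: hprod.
rewrite [RHS]hr [RHS](big_fsetID _ S)/=; congr (_ * _)%E; exact: hr.
Qed.

Definition depends_on (S : pred int) (T : Type) (f : config X -> T) : Prop :=
  forall eta eta' : config X, (forall x, S x -> eta x = eta' x) -> f eta = f eta'.

Lemma splice_inside S T (f : config X -> T) p : depends_on S f -> f (splice S p) = f p.1.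
Proof. by move=> Sf; apply: Sf => x Sx; rewrite /splice Sx. Qed.

Lemma splice_outside S T (f : config X -> T) p :
  depends_on (predC S) f -> f (splice S p) = f p.2.
Proof. by move=> Sf; apply: Sf => x /negbTE Sx; rewrite /splice Sx. Qed.

(** After the configuration is replaced by the splicing of two independent samples, [f]
    depends on the first one only and [g] on the second one only. *)
Lemma Rintegral_independent S (f g : config X -> R) :
  nu.-integrable setT (EFin \o f) -> nu.-integrable setT (EFin \o g) ->
  nu.-integrable setT (EFin \o (fun eta => f eta * g eta)) ->
  depends_on S f -> depends_on (predC S) g ->
  \int[nu]_eta (f eta * g eta) = (\int[nu]_eta f eta) * (\int[nu]_eta g eta).
Proof.
move=> fi gi fgi Sf Sg.
pose m : {measure set (config X) -> \bar R} := pushforward (nu \x nu)%E (splice S).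
have mS := measurable_splice S.
have [mfg fgoo] := integrableP _ _ _ fgi.
have fgi' : (nu \x nu)%E.-integrable setT ((EFin \o (fun eta => f eta * g eta)) \o splice S).
  apply/integrableP; split; first exact: (measurableT_comp mfg mS).
  move: fgoo; rewrite (eq_measure_integral (m mS)) => [|B mB _]; last by rewrite /= /pushforward splice_law.
  by rewrite (ge0_integral_pushforward mS)//; exact: measurableT_comp.
transitivity (fine (\int[(nu \x nu)%E]_z ((f (splice S z) * g (splice S z))%:E))%E).
  congr fine; rewrite (eq_measure_integral (m mS)) => [|B mB _]; last by rewrite /= /pushforward splice_law.
  by rewrite (integral_pushforward mS).
rewrite -(integral12_prod_meas1 fgi') /fubini_F.
transitivity (\int[nu]_x (f x * \int[nu]_y g y)).
  congr fine; apply: eq_integral => x _ /=.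
  transitivity (\int[nu]_y (f x * g y)%:E)%E.
    by apply: eq_integral => y _ /=; rewrite (splice_inside _ Sf) (splice_outside _ Sg).
  rewrite -RintegralZl// fineK//; apply: integrable_fin_num => //; exact: integrable_realZ.
by rewrite RintegralZr.
Qed.

End Configurations.

(** * Moments *)

Section FourthMoments.
Context d (T : measurableType d) (R : realType) (mu : probability T R).
Implicit Types f g : T -> R.

Definition fourth_moment f : Prop := measurable_fun setT f /\
  mu.-integrable setT (EFin \o (fun x => f x ^+ 4)).

Lemma fourth_moment_le f g : measurable_fun setT f ->
  mu.-integrable setT (EFin \o g) -> (forall x, f x ^+ 4 <= g x) -> fourth_moment f.
Proof.
move=> mf gi fg; split=> //.
apply: (le_integrable measurableT _ _ gi).
  by apply/measurable_EFinP; exact: measurable_funX.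
move=> x _; have f40 : 0 <= f x ^+ 4 by rewrite exprn_even_ge0.
by rewrite /= lee_fin !ger0_norm// (le_trans f40).
Qed.

Lemma fourth_momentD f g : fourth_moment f -> fourth_moment g ->
  fourth_moment (fun x => f x + g x).
Proof.
move=> [mf f4] [mg g4].
apply: (@fourth_moment_le _ (fun x => 8 * f x ^+ 4 + 8 * g x ^+ 4)).
- exact: measurable_funD.
- by apply: integrable_realD; exact: integrable_realZ.
- move=> x; have p0 := sqr_ge0 (f x + g x); have q0 := sqr_ge0 (f x); have r0 := sqr_ge0 (g x).
  have pqr : 0 <= 2 * (f x ^+ 2 + g x ^+ 2) - (f x + g x) ^+ 2.
    by have := sqr_ge0 (f x - g x); nra.
  have pqr' : 0 <= 2 * (f x ^+ 2 + g x ^+ 2) + (f x + g x) ^+ 2 by lra.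
  have h1 := mulr_ge0 pqr pqr'; have h2 := sqr_ge0 (f x ^+ 2 - g x ^+ 2); rewrite -subr_ge0.
  have -> : 8 * f x ^+ 4 + 8 * g x ^+ 4 - (f x + g x) ^+ 4 =
    (2 * (f x ^+ 2 + g x ^+ 2) - (f x + g x) ^+ 2) * (2 * (f x ^+ 2 + g x ^+ 2) + (f x + g x) ^+ 2)
    + 4 * (f x ^+ 2 - g x ^+ 2) ^+ 2 by ring.
  by rewrite addr_ge0// mulr_ge0.
Qed.

Lemma fourth_momentZ c f : fourth_moment f -> fourth_moment (fun x => c * f x).
Proof.
move=> [mf f4]; split; first exact: measurable_funM.
by under eq_fun do rewrite exprMn; exact: integrable_realZ.
Qed.

Lemma fourth_moment_sum (I : Type) (s : seq I) (F : I -> T -> R) (Q : pred I) :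
  (forall i, fourth_moment (F i)) -> fourth_moment (fun x => \sum_(i <- s | Q i) F i x).
Proof.
move=> F4; elim: s => [|i s IH].
  under eq_fun do rewrite big_nil; split => //.
  exact/bounded_measurable_integrable/bounded_measurable_cst.
under eq_fun do rewrite big_cons; case: (Q i) => //; exact: fourth_momentD.
Qed.

Lemma fourth_momentM f g : fourth_moment f -> fourth_moment g ->
  (fun x => f x * g x) \in Lfun mu 2%:E.
Proof.
move=> [mf f4] [mg g4]; apply/Lfun2P; split; first exact: measurable_funM.
have i4 := integrable_realD f4 g4.
apply: le_lt_trans (integrable_lty measurableT i4).
apply: ge0_le_integral => //.
- by move=> x _; rewrite lee_fin sqr_ge0.
- by apply/measurable_EFinP/measurable_funX; exact: measurable_funM.
- by apply/measurable_EFinP; apply: measurable_funD; exact: measurable_funX.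
- move=> x _ /=; rewrite lee_fin.
  have := sqr_ge0 (f x ^+ 2 - g x ^+ 2); have := sqr_ge0 (f x * g x); nra.
Qed.

Lemma fourth_moment_Lfun2 f : fourth_moment f -> f \in Lfun mu 2%:E.
Proof.
move=> f4; have [mf _] := f4.
have one4 : fourth_moment (fun=> 1 : R).
  split => //; exact/bounded_measurable_integrable/bounded_measurable_cst.
by have := fourth_momentM f4 one4; under eq_fun do rewrite mulr1.
Qed.

End FourthMoments.

Section AlmostOrthogonal.
Context d (T : measurableType d) (R : realType) (mu : probability T R).

(** Only the pairs of neighbours contribute to the square of the sum, and each
    of them is split by the arithmetic-geometric inequality. *)
Lemma sqr_sum_le (I : eqType) (s : seq I) (c : I -> R) (u : I -> T -> R)
    (N : rel I) (K : R) (m : nat) :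
  (forall i, u i \in Lfun mu 2%:E) -> (forall i, \int[mu]_x (u i x ^+ 2) <= K) ->
  symmetric N -> (forall i j, ~~ N i j -> \int[mu]_x (u i x * u j x) = 0) ->
  (forall i, i \in s -> (count (N i) s <= m)%N) ->
  \int[mu]_x ((\sum_(i <- s) c i * u i x) ^+ 2) <= m%:R * K * \sum_(i <- s) c i ^+ 2.
Proof.
move=> uL uK Nsym orth cnt.
have prodi i j := Lfun2_integrableM (uL i) (uL j).
have termi i j : mu.-integrable setT (EFin \o (fun x => c i * c j * (u i x * u j x))).
  exact: integrable_realZ.
have -> : \int[mu]_x ((\sum_(i <- s) c i * u i x) ^+ 2) =
    \sum_(i <- s) \sum_(j <- s) c i * c j * \int[mu]_x (u i x * u j x).
  transitivity (\int[mu]_x \sum_(i <- s) \sum_(j <- s) c i * c j * (u i x * u j x)).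
    apply: eq_Rintegral => x _; rewrite expr2 big_distrlr /=.
    by apply: eq_bigr => i _; apply: eq_bigr => j _; ring.
  rewrite Rintegral_sum; last by move=> i; exact: integrable_real_sum.
  apply: eq_bigr => i _; rewrite Rintegral_sum//.
  by apply: eq_bigr => j _; rewrite RintegralZl.
apply: (@le_trans _ _ (\sum_(i <- s) \sum_(j <- s) (N i j)%:R * (K / 2 * c i ^+ 2 + K / 2 * c j ^+ 2))).
  apply: ler_sum => i _; apply: ler_sum => j _.
  case: (boolP (N i j)) => [_|Nij]; last by rewrite orth// mulr0 mul0r.
  rewrite mul1r -RintegralZl//.
  apply: (@le_trans _ _ (\int[mu]_x (c i ^+ 2 / 2 * u i x ^+ 2 + c j ^+ 2 / 2 * u j x ^+ 2))).
    apply: le_Rintegral => //.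
    - by apply: integrable_realD; apply: integrable_realZ; exact: Lfun2_integrable2.
    - by move=> x _; have := sqr_ge0 (c i * u i x - c j * u j x); nra.
  rewrite RintegralD//; try by apply: integrable_realZ; exact: Lfun2_integrable2.
  rewrite !RintegralZl//; try exact: Lfun2_integrable2.
  by have := uK i; have := uK j; have := sqr_ge0 (c i); have := sqr_ge0 (c j); nra.
have K0 (i : I) : 0 <= K by exact: le_trans (Rintegral_sqr_ge0 mu (u i)) (uK i).
have E : \sum_(i <- s) \sum_(j <- s) (N i j)%:R * (K / 2 * c i ^+ 2 + K / 2 * c j ^+ 2) =
    \sum_(i <- s) (count (N i) s)%:R * (K * c i ^+ 2).
  transitivity (\sum_(i <- s) \sum_(j <- s) (N i j)%:R * (K / 2 * c i ^+ 2) +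
     \sum_(i <- s) \sum_(j <- s) (N i j)%:R * (K / 2 * c j ^+ 2)).
    rewrite -big_split; apply: eq_bigr => i _; rewrite -big_split.
    by apply: eq_bigr => j _; rewrite mulrDr.
  rewrite [X in _ + X]exchange_big /= -big_split; apply: eq_bigr => i _ /=.
  have -> : \sum_(j <- s) (N j i)%:R * (K / 2 * c i ^+ 2) =
      \sum_(j <- s) (N i j)%:R * (K / 2 * c i ^+ 2).
    by apply: eq_bigr => j _; rewrite Nsym.
  by rewrite -mulr_suml -natr_sum -big_mkcond /= sum1_count -mulrDr -mulrDl -splitr.
rewrite E mulr_sumr big_seq [leRHS]big_seq; apply: ler_sum => i si.
rewrite -mulrA; apply: ler_wpM2r; last by rewrite ler_nat cnt.
by rewrite mulr_ge0 ?sqr_ge0 ?(K0 i).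
Qed.

End AlmostOrthogonal.

Lemma count_near_le (r : nat) (s : seq int) (x : int) : uniq s ->
  (count (fun y : int => (`|x - y| <= r)%N) s <= 2 * r + 1)%N.
Proof.
move=> us; rewrite -size_filter.
rewrite (leq_trans (uniq_leq_size (s2 := [seq (x - r%:Z + k%:Z)%R | k <- iota 0 (2 * r + 1)]) _ _))//.
- exact: filter_uniq.
- move=> y; rewrite mem_filter => /andP[xy _]; apply/mapP.
  exists `|(y - (x - r%:Z))%R|%N; first by rewrite mem_iota; lia.
  lia.
- by rewrite size_map size_iota.
Qed.

(** * The algebraic decomposition *)

Lemma Abel_telescope (R : comNzRingType) (c : R) (a : nat -> R) m :
  \sum_(0 <= i < m) (c - i%:R) * (a i - a i.+1) =
  c * a 0%N - (c - m%:R) * a m - \sum_(1 <= j < m.+1) a j.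
Proof.
elim: m => [|m IH]; first by rewrite !big_geq// subr0; ring.
rewrite big_nat_recr//= IH [in RHS]big_nat_recr//= -natr1; ring.
Qed.

Section OneBlock.
Context {R : realType}.
Variables (L : nat) (a : nat -> R).
Hypothesis L0 : (0 < L)%N.

(** The weight of the pair [a i, a i.+1] inside the factor of its own gradient. For [i = 0]
    the natural factor contains [a 1] but not [a 0]; sharing its weight between the two
    makes the factor symmetric and leaves the square of the first gradient as a remainder. *)
Definition exchange_weight (i : nat) : R := if i == 0%N then 2^-1 else 1.

Definition block_rest i : R := \sum_(1 <= j < L.+1 | (j != i) && (j != i.+1)) a j.

(** The factor of the gradient [a i - a i.+1]; it involves [a i] and [a i.+1]
    through their sum only. *)
Definition gradient_factor i : R :=
  (i != 0%N)%:R * a 0%N +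
  L%:R^-1 * (block_rest i + exchange_weight i * (a i + a i.+1)).

(** Write [avg] for the average. The product minus its square is
    [(a 0 - avg) * (a 0 + avg) - a 0 * (a 0 - a 1)], and summation by parts expresses
    [a 0 - avg] through the gradients with the weights [1 - i / L]. For [0 < i] the factor
    [a 0 + avg] involves [a i] and [a i.+1] through their sum only; for [i = 0] the last term
    reduces the factor to [avg], which is symmetric up to [(2 * L)^-1 * (a 0 - a 1)]. *)
Lemma one_block_decomposition :
  a 0%N * a 1%N - (L%:R^-1 * \sum_(1 <= j < L.+1) a j) ^+ 2 =
  \sum_(0 <= i < L) (1 - i%:R / L%:R) * ((a i - a i.+1) * gradient_factor i)
  - (2 * L%:R)^-1 * (a 0%N - a 1%N) ^+ 2.
Proof.
have LN0 : L%:R != 0 :> R by rewrite pnatr_eq0 -lt0n.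
set avg := L%:R^-1 * _.
have rest0 : gradient_factor 0 = avg + (2 * L%:R)^-1 * (a 0%N - a 1%N).
  rewrite /gradient_factor /exchange_weight /block_rest /avg eqxx mul0r add0r.
  rewrite [in RHS]big_ltn// [in LHS]big_mkcond/= [in LHS]big_ltn//= add0r.
  have -> : \sum_(2 <= j < L.+1) (if (j != 0%N) && (j != 1%N) then a j else 0) =
      \sum_(2 <= j < L.+1) a j.
    by apply: eq_big_nat => j /andP[]; case: j => [|[|j]].
  by field.
have restS i : (0 < i < L)%N -> gradient_factor i = a 0%N + avg.
  move=> /andP[i0 iL]; rewrite /gradient_factor /exchange_weight -lt0n i0 mul1r.
  have i1 : (i <= L.+1)%N by lia.
  have i2 : (i <= i.+2)%N by lia.
  have i3 : (i.+2 <= L.+1)%N by lia.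
  rewrite (gtn_eqF i0) mul1r /avg /block_rest; congr (_ + _ * _).
  rewrite [in RHS](@big_cat_nat _ _ _ i)//=.
  rewrite [in LHS](@big_cat_nat _ _ _ i)//=.
  rewrite [in RHS](@big_cat_nat _ _ _ i.+2 i)//=.
  rewrite [in LHS](@big_cat_nat _ _ _ i.+2 i)//=.
  have -> : \sum_(i <= j < i.+2 | (j != i) && (j != i.+1)) a j = 0.
    by rewrite big_mkcond/= big_ltn// big_ltn// big_geq// !eqxx /= ?andbF ?add0r ?addr0.
  have -> : \sum_(i <= j < i.+2) a j = a i + a i.+1.
    by rewrite big_ltn// big_ltn// big_geq// addr0.
  have -> : \sum_(1 <= j < i | (j != i) && (j != i.+1)) a j = \sum_(1 <= j < i) a j.
    rewrite big_mkcond/=; apply: eq_big_nat => j /andP[_ ji].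
    by rewrite (ltn_eqF ji) (ltn_eqF (ltnW _))// ltnS.
  have -> : \sum_(i.+2 <= j < L.+1 | (j != i) && (j != i.+1)) a j = \sum_(i.+2 <= j < L.+1) a j.
    rewrite big_mkcond/=; apply: eq_big_nat => j /andP[ji _].
    by rewrite (gtn_eqF ji) (gtn_eqF (ltnW ji)).
  by ring.
have tele : \sum_(0 <= i < L) (1 - i%:R / L%:R) * (a i - a i.+1) = a 0%N - avg.
  transitivity (L%:R^-1 * \sum_(0 <= i < L) (L%:R - i%:R) * (a i - a i.+1)).
    by rewrite mulr_sumr; apply: eq_bigr => i _; field.
  by rewrite Abel_telescope subrr mul0r subr0 mulrBr mulrA mulVf// mul1r.
rewrite big_ltn// rest0 mul0r subr0 mul1r.
have -> : \sum_(1 <= i < L) (1 - i%:R / L%:R) * ((a i - a i.+1) * gradient_factor i) =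
    (a 0%N - avg - (a 0%N - a 1%N)) * (a 0%N + avg).
  rewrite -tele [in RHS]big_ltn// mul0r subr0 mul1r addrAC subrr add0r mulr_suml.
  by apply: eq_big_nat => i iL; rewrite restS// mulrA.
by ring.
Qed.

End OneBlock.

(** * The one-block replacement under the product measure *)

Lemma gradient_factor_exchange (R : realType) (L : nat) (a b : nat -> R) i :
  b i = a i.+1 -> b i.+1 = a i ->
  (forall j, j != i -> j != i.+1 -> b j = a j) ->
  gradient_factor L b i = gradient_factor L a i.
Proof.
move=> bi bi1 bj; rewrite /gradient_factor /block_rest bi bi1 [a i + _]addrC.
have -> : (i != 0%N)%:R * b 0%N = (i != 0%N)%:R * a 0%N.
  by have [_|i0] := eqVneq i 0%N; rewrite /= ?mul0r// bj// eq_sym.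
by under eq_bigr => j /andP[? ?] do rewrite bj//.
Qed.

Section StationaryField.
Context {R : realType} {dX : measure_display} {X : measurableType dX}.
Variables (value : X -> R) (nu : probability (config X) R) (rho : R).
Hypothesis hvalue : measurable_fun setT value.
Hypothesis hprod : product_measure_on_Z nu.
Hypothesis htrans : translation_invariant nu.
Hypothesis hmean : forall x : int, (\int[nu]_eta (value (eta x))%:E = rho%:E)%E.
Hypothesis hmom : forall x : int, (\int[nu]_eta (`|value (eta x)| ^+ 4)%:E < +oo)%E.

Local Notation e := (etabar value rho).
Local Notation var := (chi value rho nu).
Local Notation m4 := (\int[nu]_eta (e 0 eta ^+ 4)).

Lemma fourth_moment_etabar x : fourth_moment nu (e x).
Proof.
have mv : measurable_fun setT (fun eta : config X => value (eta x)).
  exact: (measurableT_comp hvalue (measurable_coordinate x)).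
have v4 : fourth_moment nu (fun eta => value (eta x)).
  split=> //; apply/integrableP; split.
    by apply/measurable_EFinP; exact: measurable_funX.
  apply: le_lt_trans (hmom x); rewrite le_eqVlt; apply/orP; left; apply/eqP.
  by apply: eq_integral => eta _ /=; rewrite normrX.
apply: fourth_momentD v4 _; split => //.
exact/bounded_measurable_integrable/bounded_measurable_cst.
Qed.

Let eL x := fourth_moment_Lfun2 (fourth_moment_etabar x).

Lemma Rintegral_shift x (f : config X -> R) : measurable_fun setT f ->
  (forall eta, 0 <= f eta) ->
  \int[nu]_eta f (Defs.shift x eta) = \int[nu]_eta f eta.
Proof.
move=> mf f0; rewrite /Rintegral; congr fine; apply/esym.
pose m : {measure set (config X) -> \bar R} := pushforward nu (@Defs.shift _ X x).
have ms := measurable_shift (X := X) x.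
rewrite (eq_measure_integral (m ms)) => [|B mB _]; last by rewrite /= /pushforward htrans.
rewrite (ge0_integral_pushforward ms)//; first exact/measurable_EFinP.
by move=> y _; rewrite lee_fin.
Qed.

Lemma etabar_shift x y eta : e (x + y) eta = e y (Defs.shift x eta).
Proof. by []. Qed.

Lemma Rintegral_etabar x : \int[nu]_eta e x eta = 0.
Proof.
have vi : nu.-integrable setT (EFin \o (fun eta : config X => value (eta x))).
  have := integrable_realD (Lfun2_integrable (eL x))
    (bounded_measurable_integrable (probability_total_lty nu) (bounded_measurable_cst _ rho)).
  by congr (_.-integrable _ _); apply/funext => eta /=; rewrite subrK.
rewrite /etabar RintegralB//; last first.
  exact/bounded_measurable_integrable/bounded_measurable_cst.
have -> : \int[nu]_eta rho = rho.
  have nu1 : nu [set: config X] = 1%E by exact: probability_setT.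
  by rewrite Rintegral_cst//; move: nu1 => /= ->; rewrite mulr1.
by rewrite /Rintegral hmean /= subrr.
Qed.

Lemma Rintegral_etabar2 x : \int[nu]_eta (e x eta ^+ 2) = var.
Proof.
rewrite -[RHS](@Rintegral_shift x).
- by apply: eq_Rintegral => eta _; rewrite -etabar_shift addr0.
- by apply: measurable_funX; exact: (fourth_moment_etabar 0).1.
- by move=> eta; exact: sqr_ge0.
Qed.

Lemma Rintegral_etabar4 x : \int[nu]_eta (e x eta ^+ 4) = m4.
Proof.
rewrite -[RHS](@Rintegral_shift x).
- by apply: eq_Rintegral => eta _; rewrite -etabar_shift addr0.
- by apply: measurable_funX; exact: (fourth_moment_etabar 0).1.
- by move=> eta; rewrite exprn_even_ge0.
Qed.

Lemma chi_ge0 : 0 <= var.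
Proof. exact: Rintegral_sqr_ge0. Qed.

Lemma m4_ge0 : 0 <= m4.
Proof. by apply: Rintegral_ge0 => eta _; rewrite exprn_even_ge0. Qed.

Lemma depends_etabar (S : pred int) x : S x -> depends_on S (e x).
Proof. by move=> Sx eta eta' H; rewrite /etabar H. Qed.

Lemma Rintegral_etabarM x y : x != y -> \int[nu]_eta (e x eta * e y eta) = 0.
Proof.
move=> xy; rewrite (@Rintegral_independent _ _ _ _ hprod (pred1 x)).
- by rewrite Rintegral_etabar mul0r.
- exact: Lfun2_integrable.
- exact: Lfun2_integrable.
- exact: Lfun2_integrableM.
- by apply: depends_etabar; rewrite /= eqxx.
- by apply: depends_etabar; rewrite /= eq_sym.
Qed.

Definition gradient y eta := e y eta - e (y + 1) eta.

Lemma fourth_moment_gradient y : fourth_moment nu (gradient y).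
Proof.
have := fourth_momentD (fourth_moment_etabar y) (fourth_momentZ (-1) (fourth_moment_etabar (y + 1))).
by congr fourth_moment; apply/funext => eta; rewrite mulN1r.
Qed.

Let dL y := fourth_moment_Lfun2 (fourth_moment_gradient y).

Let neq_succ (y : int) : y != y + 1. Proof. by lia. Qed.

Lemma Rintegral_gradient2 y : \int[nu]_eta (gradient y eta ^+ 2) = 2 * var.
Proof.
have i1 := Lfun2_integrable2 (eL y); have i2 := Lfun2_integrable2 (eL (y + 1)).
have i12 := integrable_realZ 2 (Lfun2_integrableM (eL y) (eL (y + 1))).
transitivity (\int[nu]_eta ((e y eta ^+ 2 + e (y + 1) eta ^+ 2) - 2 * (e y eta * e (y + 1) eta))).
  by apply: eq_Rintegral => eta _; rewrite /gradient; ring.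
rewrite RintegralB//; last exact: integrable_realD.
rewrite RintegralD// RintegralZl//; last exact: Lfun2_integrableM.
by rewrite !Rintegral_etabar2 Rintegral_etabarM//; ring.
Qed.

Definition block (x : int) eta (j : nat) : R := e (x + j%:Z) eta.

(** The summand attached to the bond between [x + i] and [x + i + 1] in the block
    that starts at [x]. *)
Definition bond_term L x i eta : R :=
  (block x eta i - block x eta i.+1) * gradient_factor L (block x eta) i.

Lemma local_differenceE L x eta : (0 < L)%N ->
  local_difference value rho nu L x eta =
  \sum_(0 <= i < L) (1 - i%:R / L%:R) * bond_term L x i eta
  + (2 * L%:R)^-1 * (2 * var - gradient x eta ^+ 2).
Proof.
move=> L0; have LN0 : L%:R != 0 :> R by rewrite pnatr_eq0 -lt0n.
have := one_block_decomposition (block x eta) L0.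
have b0 : block x eta 0 = e x eta by rewrite /block addr0.
have b1 : block x eta 1 = e (x + 1) eta by [].
rewrite b0 b1 /local_difference /right_average /gradient -/(block x eta) => ->.
by rewrite -/(bond_term L x _ _); field.
Qed.

Lemma etabar_exchange z y eta : e y (exchange z eta) = e (swap z y) eta.
Proof. by rewrite /etabar exchangeE. Qed.

Lemma bond_term_exchange L x i eta :
  bond_term L x i (exchange (x + i%:Z) eta) = - bond_term L x i eta.
Proof.
have bi : block x (exchange (x + i%:Z) eta) i = block x eta i.+1.
  by rewrite /block etabar_exchange /swap eqxx; congr (e _ eta); lia.
have bi1 : block x (exchange (x + i%:Z) eta) i.+1 = block x eta i.
  rewrite /block etabar_exchange /swap; have -> : x + i.+1%:Z = x + i%:Z + 1 by lia.
  by rewrite eq_sym (negbTE (neq_succ _)) eqxx.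
rewrite /bond_term (gradient_factor_exchange L bi bi1) ?bi ?bi1; first by ring.
move=> j ji ji1; rewrite /block etabar_exchange /swap.
by case: eqP => [|_]; [lia|case: eqP => [|//]; lia].
Qed.

Lemma fourth_moment_gradient_factor L x i :
  fourth_moment nu (fun eta => gradient_factor L (block x eta) i).
Proof.
rewrite /gradient_factor /block_rest.
apply: fourth_momentD; first exact: fourth_momentZ (fourth_moment_etabar _).
apply: fourth_momentZ; apply: fourth_momentD.
  by apply: fourth_moment_sum => j; exact: fourth_moment_etabar.
by apply: fourth_momentZ; apply: fourth_momentD; exact: fourth_moment_etabar.
Qed.

Lemma bond_termE L x i eta : bond_term L x i eta =
  gradient (x + i%:Z) eta * gradient_factor L (block x eta) i.
Proof.
by rewrite /bond_term /gradient /block; have -> : x + i%:Z + 1 = x + i.+1%:Z by lia.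
Qed.

Lemma bond_term_Lfun2 L x i : bond_term L x i \in Lfun nu 2%:E.
Proof.
rewrite (_ : bond_term L x i = fun eta => gradient (x + i%:Z) eta * gradient_factor L (block x eta) i).
  apply: fourth_momentM; first exact: fourth_moment_gradient.
  exact: fourth_moment_gradient_factor.
by apply/funext => eta; exact: bond_termE.
Qed.

(** The exchange preserves [nu], so an antisymmetric function only sees the antisymmetric
    part of the function it is tested against, which is minus half of its discrete gradient. *)
Lemma Rintegral_antisymmetric z (Phi f : config X -> R) :
  Phi \in Lfun nu 2%:E -> f \in Lfun nu 2%:E ->
  (forall eta, Phi (exchange z eta) = - Phi eta) ->
  nabla z f \in Lfun nu 2%:E /\
  2 * (\int[nu]_eta (Phi eta * f eta)) = - (\int[nu]_eta (Phi eta * nabla z f eta)).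
Proof.
move=> PL fL anti.
have mex := measurable_exchange (X := X) z.
pose m : {measure set (config X) -> \bar R} := pushforward nu (@exchange _ X z).
have fxL : (fun eta => f (exchange z eta)) \in Lfun nu 2%:E.
  have [mf f2] := (Lfun2P _ _).1 fL.
  have mfx : measurable_fun setT (fun eta => f (exchange z eta)) by apply: (measurableT_comp mf mex).
  apply/Lfun2P; split => //.
  move: f2; rewrite (eq_measure_integral (m mex)) => [|B mB _]; last by rewrite /= /pushforward exchange_invariant.
  rewrite (ge0_integral_pushforward mex)//.
    by apply/measurable_EFinP; exact: measurable_funX.
  by move=> x _; rewrite lee_fin sqr_ge0.
have nL : nabla z f \in Lfun nu 2%:E by exact: Lfun2B.
split=> //.
have E : \int[nu]_eta (Phi eta * f eta) = - \int[nu]_eta (Phi eta * f (exchange z eta)).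
  have iPf := Lfun2_integrableM PL fL.
  transitivity (\int[nu]_eta (Phi (exchange z eta) * f (exchange z eta))).
    rewrite /Rintegral; congr fine.
    rewrite [LHS](eq_measure_integral (m mex)) => [|B mB _]; last by rewrite /= /pushforward exchange_invariant.
    rewrite (integral_pushforward mex)//; first by case/integrableP: iPf.
    have := Lfun2_integrableM (Lfun2Z (-1) PL) fxL.
    by congr (_.-integrable _ _); apply/funext => eta /=; rewrite anti mulN1r.
  transitivity (\int[nu]_eta (-1 * (Phi eta * f (exchange z eta)))).
    by apply: eq_Rintegral => eta _; rewrite anti; ring.
  by rewrite RintegralZl ?mulN1r//; exact: Lfun2_integrableM.
rewrite /nabla.
have -> : \int[nu]_eta (Phi eta * (f (exchange z eta) - f eta)) =
    \int[nu]_eta (Phi eta * f (exchange z eta)) - \int[nu]_eta (Phi eta * f eta).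
  rewrite -RintegralB//; try exact: Lfun2_integrableM.
  by apply: eq_Rintegral => eta _; ring.
rewrite {2}E; move: E; set u := Rintegral _ _ _; set w := Rintegral _ _ _ => E; lra.
Qed.

Definition bond_sites (y : int) : pred int := fun x => (x == y) || (x == y + 1).

Lemma depends_gradient y : depends_on (bond_sites y) (gradient y).
Proof.
by move=> eta eta' H; rewrite /gradient !(depends_etabar _ H)// /bond_sites eqxx ?orbT.
Qed.

(** The gradient is independent of the variables outside its bond, and the latter are
    centred and pairwise orthogonal. The mask [b] switches off the sites of the bond. *)
Lemma sqr_gradientM_le (I : eqType) (s : seq I) (c : I -> R) (b : I -> R) (z : I -> int) (y : int) :
  uniq s -> (forall i, 0 <= b i <= 1) ->
  (forall i, b i != 0 -> ~~ bond_sites y (z i)) ->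
  injective z ->
  \int[nu]_eta ((gradient y eta * \sum_(i <- s) c i * (b i * e (z i) eta)) ^+ 2) <=
  2 * var ^+ 2 * \sum_(i <- s) c i ^+ 2.
Proof.
move=> us b01 bz zinj.
have uL i : (fun eta => b i * e (z i) eta) \in Lfun nu 2%:E by exact: Lfun2Z.
have P4 : fourth_moment nu (fun eta => \sum_(i <- s) c i * (b i * e (z i) eta)).
  apply: (fourth_moment_sum _ predT) => i.
  by apply: fourth_momentZ; apply: fourth_momentZ; exact: fourth_moment_etabar.
have PL := fourth_moment_Lfun2 P4.
have gP := fourth_momentM (fourth_moment_gradient y) P4.
apply: (@le_trans _ _ (2 * var * \int[nu]_eta ((\sum_(i <- s) c i * (b i * e (z i) eta)) ^+ 2))).
  rewrite le_eqVlt; apply/orP; left; apply/eqP.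
  rewrite -(Rintegral_gradient2 y) -(Rintegral_independent hprod (S := bond_sites y)).
  - by apply: eq_Rintegral => eta _; rewrite exprMn.
  - exact: Lfun2_integrable2.
  - exact: Lfun2_integrable2.
  - have := Lfun2_integrable2 gP.
    by congr (_.-integrable _ _); apply/funext => eta /=; rewrite exprMn.
  - by move=> eta eta' H; rewrite (depends_gradient H).
  - move=> eta eta' H; congr (_ ^+ 2); apply: eq_bigr => i _.
    have [->|bi] := eqVneq (b i) 0; first by rewrite !mul0r.
    by rewrite (depends_etabar _ H)//=; exact: bz.
have -> : 2 * var ^+ 2 * \sum_(i <- s) c i ^+ 2 = 2 * var * (1%:R * var * \sum_(i <- s) c i ^+ 2).
  by ring.
apply: ler_wpM2l; first by rewrite mulr_ge0// chi_ge0.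
apply: (@sqr_sum_le _ _ _ nu _ s c (fun i eta => b i * e (z i) eta) eq_op _ 1) => //.
- move=> i; have /andP[b0 b1] := b01 i.
  under eq_Rintegral do rewrite exprMn.
  rewrite RintegralZl//; last exact: Lfun2_integrable2.
  rewrite Rintegral_etabar2 ler_piMl ?chi_ge0//.
  by rewrite expr2 mulr_ile1.
- move=> i j ij.
  transitivity (\int[nu]_eta (b i * b j * (e (z i) eta * e (z j) eta))).
    by apply: eq_Rintegral => eta _; ring.
  rewrite RintegralZl//; last exact: Lfun2_integrableM.
  by rewrite Rintegral_etabarM ?mulr0// (inj_eq zinj).
- move=> i si; rewrite (@eq_count _ _ (pred1 i)); last by move=> j; rewrite /= eq_sym.
  by rewrite count_uniq_mem// si.
Qed.

Lemma Rintegral_gradient_sum2 y :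
  \int[nu]_eta ((gradient y eta * (e y eta + e (y + 1) eta)) ^+ 2) <= 4 * m4.
Proof.
have i1 := (fourth_moment_etabar y).2; have i2 := (fourth_moment_etabar (y + 1)).2.
apply: (@le_trans _ _ (\int[nu]_eta (2 * e y eta ^+ 4 + 2 * e (y + 1) eta ^+ 4))).
  apply: le_Rintegral => //.
  - apply: Lfun2_integrable2; apply: fourth_momentM; first exact: fourth_moment_gradient.
    by apply: fourth_momentD; exact: fourth_moment_etabar.
  - by apply: integrable_realD; exact: integrable_realZ.
  - move=> eta _; rewrite /gradient; set p := e y eta; set q := e (y + 1) eta.
    rewrite -subr_ge0; have -> : 2 * p ^+ 4 + 2 * q ^+ 4 - ((p - q) * (p + q)) ^+ 2 = (p ^+ 2 + q ^+ 2) ^+ 2 by ring.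
    exact: sqr_ge0.
rewrite RintegralD//; try exact: integrable_realZ.
by rewrite !RintegralZl// !Rintegral_etabar4; lra.
Qed.

(** Of the [L] blocks that contain a given bond, each contributes its first variable, which
    is of order one, and an average, which is of order [L ^ (-1/2)]. The first variables are
    at different sites, hence orthogonal: this keeps the bound linear in [L] when the
    coefficients are of order one. *)
Lemma sqr_bond_sum_le L y (c : nat -> R) : (0 < L)%N ->
  \int[nu]_eta ((\sum_(0 <= i < L) c i * bond_term L (y - i%:Z) i eta) ^+ 2) <=
  (12 * var ^+ 2 + 16 * m4) * \sum_(0 <= i < L) c i ^+ 2.
Proof.
move=> L0; have LN0 : L%:R != 0 :> R by rewrite pnatr_eq0 -lt0n.
have Lp : 0 < L%:R :> R by rewrite ltr0n.
(* [near] gathers the first variables of the blocks, [far] the averages *)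
pose near eta := gradient y eta * \sum_(0 <= i < L) c i * ((i != 0%N)%:R * e (y - i%:Z) eta).
pose rest i eta := block_rest L (block (y - i%:Z) eta) i.
pose far i eta := L%:R^-1 * (gradient y eta * rest i eta
   + exchange_weight i * (gradient y eta * (e y eta + e (y + 1) eta))).
have splitE eta : \sum_(0 <= i < L) c i * bond_term L (y - i%:Z) i eta =
    near eta + \sum_(0 <= i < L) c i * far i eta.
  rewrite /near mulr_sumr -big_split /=; apply: eq_bigr => i _.
  have bi : block (y - i%:Z) eta i = e y eta by rewrite /block subrK.
  have bi1 : block (y - i%:Z) eta i.+1 = e (y + 1) eta.
    by rewrite /block; have -> : y - i%:Z + i.+1%:Z = y + 1 by lia.
  have b0 : block (y - i%:Z) eta 0 = e (y - i%:Z) eta by rewrite /block addr0.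
  by rewrite bond_termE subrK /gradient_factor bi bi1 b0 /far /rest; ring.
have e4 := fourth_moment_etabar; have g4 := fourth_moment_gradient y.
have nearL : near \in Lfun nu 2%:E.
  apply: fourth_momentM => //; apply: (fourth_moment_sum _ predT) => i.
  by apply: fourth_momentZ; exact: fourth_momentZ.
have restL i : (fun eta => gradient y eta * rest i eta) \in Lfun nu 2%:E.
  by apply: fourth_momentM => //; apply: fourth_moment_sum => j; exact: e4.
have sumL : (fun eta => gradient y eta * (e y eta + e (y + 1) eta)) \in Lfun nu 2%:E.
  by apply: fourth_momentM => //; exact: fourth_momentD.
have farL i : far i \in Lfun nu 2%:E by apply: Lfun2Z; apply: Lfun2D => //; exact: Lfun2Z.
have near_le : \int[nu]_eta (near eta ^+ 2) <= 2 * var ^+ 2 * \sum_(0 <= i < L) c i ^+ 2.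
  apply: (@sqr_gradientM_le _ _ c (fun i => (i != 0%N)%:R) (fun i : nat => y - i%:Z)).
  - exact: iota_uniq.
  - by move=> i; case: (i != 0%N); rewrite ?lexx ler01.
  - move=> i; have [_|i0 _] := eqVneq i 0%N; rewrite /= ?eqxx//.
    by rewrite /bond_sites; apply/norP; split; apply/eqP; move/eqP: i0; lia.
  - by move=> i j; lia.
have rest_le i : \int[nu]_eta ((gradient y eta * rest i eta) ^+ 2) <= 2 * var ^+ 2 * L%:R.
  have := @sqr_gradientM_le _ (index_iota 1 L.+1) (fun=> 1)
    (fun j => ((j != i) && (j != i.+1))%:R) (fun j : nat => y - i%:Z + j%:Z) y (iota_uniq _ _).
  rewrite (eq_bigr (fun=> 1)); last by move=> *; rewrite expr1n.
  rewrite big_const_nat subn1 iter_addr addr0 /=.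
  have E eta : \sum_(1 <= j < L.+1) 1 * (((j != i) && (j != i.+1))%:R * e (y - i%:Z + j%:Z) eta) = rest i eta.
    rewrite /rest /block_rest [in RHS]big_mkcond; apply: eq_bigr => j _.
    by rewrite mul1r; case: ifP; rewrite ?mul1r ?mul0r.
  under eq_Rintegral do rewrite E.
  apply.
  - by move=> j; case: ((j != i) && (j != i.+1)); rewrite ?lexx ?ler01.
  - move=> j; case: (boolP (_ && _)) => [/andP[/eqP ji /eqP ji1] _|_]; last by rewrite /= eqxx.
    by rewrite /bond_sites; apply/norP; split; apply/eqP; lia.
  - by move=> j j'; lia.
have far_le i : \int[nu]_eta (far i eta ^+ 2) <= L%:R^-1 * (4 * var ^+ 2 + 8 * m4).
  have w01 : 0 <= exchange_weight (R := R) i <= 1 by rewrite /exchange_weight; case: ifP => _; lra.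
  apply: (@le_trans _ _ (L%:R^-1 ^+ 2 * (2 * (2 * var ^+ 2 * L%:R) + 2 * (4 * m4)))).
    rewrite /far; under eq_Rintegral do rewrite exprMn.
    rewrite RintegralZl//; last by apply: Lfun2_integrable2; apply: Lfun2D => //; exact: Lfun2Z.
    apply: ler_wpM2l; first exact: sqr_ge0.
    apply: (le_trans (Rintegral_sqrD_le (restL i) (Lfun2Z _ sumL))).
    apply: lerD; apply: ler_wpM2l => //.
    under eq_Rintegral do rewrite exprMn.
    rewrite RintegralZl//; last exact: Lfun2_integrable2.
    apply: le_trans (Rintegral_gradient_sum2 y); rewrite ler_piMl ?Rintegral_sqr_ge0//.
    by move: w01 => /andP[? ?]; rewrite expr2 mulr_ile1.
  rewrite expr2 -mulrA; apply: ler_wpM2l; first by rewrite invr_ge0 ltW.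
  rewrite ler_pdivrMl//; have L1 : 1 <= L%:R :> R by rewrite ler1n.
  by have := m4_ge0; nra.
rewrite (eq_Rintegral _ (g := fun eta => (near eta + \sum_(0 <= i < L) c i * far i eta) ^+ 2)); last first.
  by move=> eta _; rewrite splitE.
have farsL : (fun eta => \sum_(0 <= i < L) c i * far i eta) \in Lfun nu 2%:E.
  by apply: Lfun2_sum => i; exact: Lfun2Z.
apply: (le_trans (Rintegral_sqrD_le nearL farsL)).
have fars_le : \int[nu]_eta ((\sum_(0 <= i < L) c i * far i eta) ^+ 2) <=
    L%:R * (L%:R^-1 * (4 * var ^+ 2 + 8 * m4)) * \sum_(0 <= i < L) c i ^+ 2.
  apply: (@sqr_sum_le _ _ _ nu _ (index_iota 0 L) c far (fun _ _ => true) _ L) => // i _.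
  by rewrite (leq_trans (count_size _ _))// size_iota subn0.
move: fars_le; rewrite mulrA divff// mul1r.
by move: near_le; set S := \sum_(_ <= _ < _) _; lra.
Qed.

(** The remainder of the decomposition into gradients, up to the factor [(2 * L)^-1]: the
    correction [chi / L] of the one-block replacement is exactly what centres it. *)
Definition energy_fluctuation x eta : R := 2 * var - gradient x eta ^+ 2.

Lemma energy_fluctuation_Lfun2 x : energy_fluctuation x \in Lfun nu 2%:E.
Proof.
apply: Lfun2B; first exact: Lfun2_cst.
exact: (fourth_momentM (fourth_moment_gradient x) (fourth_moment_gradient x)).
Qed.

Lemma Rintegral_energy_fluctuation x : \int[nu]_eta energy_fluctuation x eta = 0.
Proof.
rewrite /energy_fluctuation RintegralB//; last 2 first.
- exact: Lfun2_integrable (Lfun2_cst _ _).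
- exact: (Lfun2_integrable2 (dL x)).
rewrite Rintegral_gradient2 Rintegral_cst//.
have nu1 : nu [set: config X] = 1%E by exact: probability_setT.
by move: nu1 => /= ->; rewrite mulr1 subrr.
Qed.

Lemma sqr_energy_fluctuation_le x :
  \int[nu]_eta (energy_fluctuation x eta ^+ 2) <= 8 * var ^+ 2 + 32 * m4.
Proof.
have i1 := (fourth_moment_etabar x).2; have i2 := (fourth_moment_etabar (x + 1)).2.
have ic : nu.-integrable setT (EFin \o (fun _ : config X => 8 * var ^+ 2)).
  exact: Lfun2_integrable (Lfun2_cst _ _).
have i3 := integrable_realD (integrable_realZ 16 i1) (integrable_realZ 16 i2).
apply: (@le_trans _ _ (\int[nu]_eta (8 * var ^+ 2 + (16 * e x eta ^+ 4 + 16 * e (x + 1) eta ^+ 4)))).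
  apply: le_Rintegral => //.
  - exact: (Lfun2_integrable2 (energy_fluctuation_Lfun2 x)).
  - exact: integrable_realD.
  - move=> eta _; rewrite /energy_fluctuation /gradient; set p := e x eta; set q := e (x + 1) eta.
    have h1 : (2 * var - (p - q) ^+ 2) ^+ 2 <= 8 * var ^+ 2 + 2 * (p - q) ^+ 4.
      rewrite -subr_ge0; have -> : 8 * var ^+ 2 + 2 * (p - q) ^+ 4 - (2 * var - (p - q) ^+ 2) ^+ 2 =
        (2 * var + (p - q) ^+ 2) ^+ 2 by ring.
      exact: sqr_ge0.
    have h2 : 2 * (p - q) ^+ 4 <= 16 * p ^+ 4 + 16 * q ^+ 4.
      rewrite -subr_ge0; have -> : 16 * p ^+ 4 + 16 * q ^+ 4 - 2 * (p - q) ^+ 4 =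
        2 * ((p + q) ^+ 2 * (2 * p ^+ 2 + 2 * q ^+ 2 + (p - q) ^+ 2)
        + 4 * (p ^+ 2 - q ^+ 2) ^+ 2) by ring.
      apply: mulr_ge0 => //; apply: addr_ge0; apply: mulr_ge0 => //; rewrite ?sqr_ge0//.
      by have := sqr_ge0 p; have := sqr_ge0 q; have := sqr_ge0 (p - q); lra.
    exact: (le_trans h1 (lerD (lexx _) h2)).
rewrite RintegralD// [X in _ + X]RintegralD//; try exact: integrable_realZ.
rewrite Rintegral_cst// [X in _ + (X + _)]RintegralZl// [X in _ + (_ + X)]RintegralZl//.
rewrite !Rintegral_etabar4.
have nu1 : nu [set: config X] = 1%E by exact: probability_setT.
by move: nu1 => /= ->; rewrite mulr1; lra.
Qed.

(** Fluctuations at distance larger than one are independent and centred. *)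
Lemma sqr_energy_sum_le (A : seq int) (c : int -> R) : uniq A ->
  \int[nu]_eta ((\sum_(x <- A) c x * energy_fluctuation x eta) ^+ 2) <=
  3 * (8 * var ^+ 2 + 32 * m4) * \sum_(x <- A) c x ^+ 2.
Proof.
move=> uA; apply: (@sqr_sum_le _ _ _ nu _ A c energy_fluctuation (fun x y : int => (`|x - y| <= 1)%N) _ 3) => //.
- exact: energy_fluctuation_Lfun2.
- exact: sqr_energy_fluctuation_le.
- by move=> x y; apply/idP/idP; lia.
- move=> x y xy; have EL := energy_fluctuation_Lfun2.
  rewrite (@Rintegral_independent _ _ _ _ hprod (bond_sites x)).
  + by rewrite Rintegral_energy_fluctuation mul0r.
  + exact: Lfun2_integrable.
  + exact: Lfun2_integrable.
  + exact: Lfun2_integrableM.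
  + by move=> eta eta' H; rewrite /energy_fluctuation (depends_gradient H).
  + move=> eta eta' H; rewrite /energy_fluctuation (@depends_gradient y _ eta')// => z.
    by move=> yz; apply: H; move: yz xy; rewrite /bond_sites /=; lia.
- by move=> x _; exact: (count_near_le 1).
Qed.
Lemma local_difference_Lfun2 L x : (0 < L)%N -> local_difference value rho nu L x \in Lfun nu 2%:E.
Proof.
move=> L0.
rewrite (_ : local_difference value rho nu L x = (fun eta =>
  \sum_(0 <= i < L) (1 - i%:R / L%:R) * bond_term L x i eta
  + (2 * L%:R)^-1 * energy_fluctuation x eta)).
  apply: Lfun2D; last exact: Lfun2Z (energy_fluctuation_Lfun2 x).
  by apply: Lfun2_sum => i; apply: Lfun2Z; exact: bond_term_Lfun2.
by apply/funext => eta; exact: local_differenceE.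
Qed.

Lemma Rintegral_bond_term L x i : \int[nu]_eta bond_term L x i eta = 0.
Proof.
have [_ E] := Rintegral_antisymmetric (bond_term_Lfun2 L x i) (Lfun2_cst nu (1 : R)) (bond_term_exchange L x i).
move: E; rewrite /nabla; under [in RHS]eq_Rintegral do rewrite subrr mulr0.
under eq_Rintegral do rewrite mulr1.
by rewrite Rintegral_cst// mul0r oppr0 => /eqP; rewrite mulf_eq0 pnatr_eq0 /= => /eqP.
Qed.

Lemma Rintegral_local_difference L x : (0 < L)%N ->
  \int[nu]_eta local_difference value rho nu L x eta = 0.
Proof.
move=> L0; under eq_Rintegral do rewrite (local_differenceE _ _ L0).
have bL i := Lfun2_integrable (Lfun2Z (1 - i%:R / L%:R) (bond_term_Lfun2 L x i)).
rewrite RintegralD//; last 2 first.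
- exact: integrable_real_sum.
- exact: integrable_realZ (Lfun2_integrable (energy_fluctuation_Lfun2 x)).
rewrite Rintegral_sum// RintegralZl//; last exact: Lfun2_integrable (energy_fluctuation_Lfun2 x).
rewrite Rintegral_energy_fluctuation mulr0 addr0 big1// => i _.
by rewrite RintegralZl ?Rintegral_bond_term ?mulr0//; exact: Lfun2_integrable (bond_term_Lfun2 L x i).
Qed.

Lemma local_difference_shift L x eta :
  local_difference value rho nu L x eta = local_difference value rho nu L 0 (Defs.shift x eta).
Proof.
rewrite /local_difference /right_average -!etabar_shift addr0.
by congr (_ - (_ * _) ^+ 2 + _); apply: eq_bigr => i _.
Qed.

Lemma Rintegral_local_difference2 L x : (0 < L)%N ->
  \int[nu]_eta (local_difference value rho nu L x eta ^+ 2) =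
  \int[nu]_eta (local_difference value rho nu L 0 eta ^+ 2).
Proof.
move=> L0; under eq_Rintegral do rewrite local_difference_shift.
apply: (@Rintegral_shift x (fun eta => local_difference value rho nu L 0 eta ^+ 2)).
  by apply: measurable_funX; exact: Lfun2_measurable (local_difference_Lfun2 0 L0).
by move=> eta; exact: sqr_ge0.
Qed.

Lemma depends_local_difference L x :
  depends_on (fun y : int => x <= y <= x + L.+1%:Z) (local_difference value rho nu L x).
Proof.
move=> eta eta' H; rewrite /local_difference /right_average.
have dep y : x <= y <= x + L.+1%:Z -> e y eta = e y eta'.
  by move=> xy; rewrite /etabar H.
rewrite !dep; [|by lia..].
congr (_ - (_ * _) ^+ 2 + _); apply: eq_big_nat => i iL; apply: dep; lia.
Qed.

(** Local differences are centred and depend on [L + 2] consecutive sites. The bound serves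
    to sum the series only, so its dependence on [L] does not matter. *)
Lemma sqr_local_difference_sum_le L (A : seq int) (c : int -> R) : (0 < L)%N -> uniq A ->
  \int[nu]_eta ((\sum_(x <- A) c x * local_difference value rho nu L x eta) ^+ 2) <=
  (2 * L.+1 + 1)%:R * (\int[nu]_eta (local_difference value rho nu L 0 eta ^+ 2)) *
  \sum_(x <- A) c x ^+ 2.
Proof.
move=> L0 uA; have lL x := local_difference_Lfun2 x L0.
apply: (@sqr_sum_le _ _ _ nu _ A c (local_difference value rho nu L)
  (fun x y : int => (`|x - y| <= L.+1)%N)) => //.
- by move=> x; rewrite Rintegral_local_difference2.
- by move=> x y; apply/idP/idP; lia.
- move=> x y xy.
  rewrite (@Rintegral_independent _ _ _ _ hprod (fun z : int => x <= z <= x + L.+1%:Z)).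
  + by rewrite Rintegral_local_difference// mul0r.
  + exact: Lfun2_integrable.
  + exact: Lfun2_integrable.
  + exact: Lfun2_integrableM.
  + exact: depends_local_difference.
  + move=> eta eta' H; apply: depends_local_difference => z yz; apply: H.
    by move: yz xy; rewrite /=; lia.
- by move=> x _; exact: count_near_le.
Qed.

Lemma sum_translate (A Y : seq int) (F : int -> R) (i : int) : uniq A -> uniq Y ->
  (forall x, x \in A -> x + i \in Y) ->
  \sum_(y <- Y) (if y - i \in A then F (y - i) else 0) = \sum_(x <- A) F x.
Proof.
move=> uA uY AY; rewrite -big_mkcond -big_filter /=.
transitivity (\sum_(y <- [seq x + i | x <- A]) F (y - i)).
  apply: perm_big; apply: uniq_perm; first exact: filter_uniq.
    by rewrite map_inj_uniq//; exact: addIr.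
  move=> y; rewrite mem_filter; apply/andP/mapP => [[yA yY]|[x xA ->]].
    by exists (y - i) => //; rewrite subrK.
  by rewrite addrK; split=> //; exact: AY.
by rewrite big_map; apply: eq_bigr => x _; rewrite addrK.
Qed.

(** Up to fluctuations of size [L^-1], the one-block replacement is a sum [V] over bonds of
    functions that are antisymmetric under the exchange over their bond. Tested against
    [f], each of them sees the gradient of [f] over its bond only, and the inequality between
    a product and the squares of its factors, with a weight [lambda] left to be matched with
    the Dirichlet form, separates the two. *)
Lemma one_block_split L (A : seq int) (c : int -> R) : (0 < L)%N -> uniq A ->
  exists V : config X -> R, [/\ V \in Lfun nu 2%:E,
    \int[nu]_eta ((\sum_(x <- A) c x * local_difference value rho nu L x eta - V eta) ^+ 2)
      <= (6 * var ^+ 2 + 24 * m4) / L%:R ^+ 2 * \sum_(x <- A) c x ^+ 2 &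
    exists2 Y : seq int, uniq Y & forall (lambda : R) f, 0 < lambda -> f \in Lfun nu 2%:E ->
      (forall y, nabla y f \in Lfun nu 2%:E) /\
      2 * (\int[nu]_eta (V eta * f eta)) <=
      (4 * lambda)^-1 * ((12 * var ^+ 2 + 16 * m4) * L%:R * \sum_(x <- A) c x ^+ 2)
      + lambda * \sum_(y <- Y) \int[nu]_eta (nabla y f eta ^+ 2)].
Proof.
move=> L0 uA; have LN0 : L%:R != 0 :> R by rewrite pnatr_eq0 -lt0n.
pose Y := undup [seq x + i%:Z | x <- A, i <- iota 0 L].
have uY : uniq Y by exact: undup_uniq.
have AY i x : (i < L)%N -> x \in A -> x + i%:Z \in Y.
  by move=> iL xA; rewrite mem_undup; apply: allpairs_f => //; rewrite mem_iota.
pose cA x := if x \in A then c x else 0.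
pose coef i : R := 1 - i%:R / L%:R.
(* the terms attached to the bond [y], from the blocks that start at [y - i] *)
pose Phi y eta := \sum_(0 <= i < L) (cA (y - i%:Z) * coef i) * bond_term L (y - i%:Z) i eta.
have bL := bond_term_Lfun2.
have PhiL y : Phi y \in Lfun nu 2%:E by apply: Lfun2_sum => i; exact: Lfun2Z.
pose V eta := \sum_(y <- Y) Phi y eta.
have VL : V \in Lfun nu 2%:E by exact: Lfun2_sum.
have VE eta : V eta = \sum_(x <- A) c x * \sum_(0 <= i < L) coef i * bond_term L x i eta.
  rewrite /V /Phi exchange_big /=.
  under [RHS]eq_bigr do rewrite mulr_sumr.
  rewrite [RHS]exchange_big /=; apply: eq_big_nat => i /andP[_ iL].
  rewrite -(@sum_translate A Y (fun x => c x * (coef i * bond_term L x i eta)) i%:Z uA uY); last first.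
    by move=> x; exact: AY.
  by apply: eq_bigr => y _; rewrite /cA; case: ifP => _; ring.
exists V; split => //.
  have E eta : \sum_(x <- A) c x * local_difference value rho nu L x eta - V eta =
      (2 * L%:R)^-1 * \sum_(x <- A) c x * energy_fluctuation x eta.
    rewrite VE mulr_sumr -sumrB; apply: eq_bigr => x _.
    by rewrite (local_differenceE _ _ L0) -/(energy_fluctuation x eta) /coef; ring.
  under eq_Rintegral do rewrite E exprMn.
  rewrite RintegralZl//; last first.
    by apply: Lfun2_integrable2; apply: Lfun2_sum => x; exact: Lfun2Z (energy_fluctuation_Lfun2 x).
  have := sqr_energy_sum_le c uA; set S := \sum_(x <- A) _; set J := Rintegral _ _ _ => JS.
  apply: (@le_trans _ _ ((2 * L%:R)^-1 ^+ 2 * (3 * (8 * var ^+ 2 + 32 * m4) * S))).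
    by apply: ler_wpM2l JS; exact: sqr_ge0.
  by rewrite le_eqVlt; apply/orP; left; apply/eqP; field.
exists Y => // lambda f l0 fL.
have anti y eta : Phi y (exchange y eta) = - Phi y eta.
  rewrite /Phi -sumrN; apply: eq_bigr => i _.
  by have := bond_term_exchange L (y - i%:Z) i eta; rewrite subrK => ->; ring.
have nL y := (Rintegral_antisymmetric (PhiL y) fL (anti y)).1.
split=> //.
have -> : 2 * (\int[nu]_eta (V eta * f eta)) =
    \sum_(y <- Y) - (\int[nu]_eta (Phi y eta * nabla y f eta)).
  transitivity (2 * \int[nu]_eta (\sum_(y <- Y) Phi y eta * f eta)).
    by congr (_ * _); apply: eq_Rintegral => eta _; rewrite /V mulr_suml.
  rewrite Rintegral_sum; last by move=> y; exact: Lfun2_integrableM.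
  rewrite mulr_sumr; apply: eq_bigr => y _.
  by rewrite (Rintegral_antisymmetric (PhiL y) fL (anti y)).2.
apply: (@le_trans _ _ (\sum_(y <- Y) ((4 * lambda)^-1 * \int[nu]_eta (Phi y eta ^+ 2) +
    lambda * \int[nu]_eta (nabla y f eta ^+ 2)))).
  apply: ler_sum => y _; have iP := Lfun2_integrable2 (PhiL y); have iN := Lfun2_integrable2 (nL y).
  rewrite -!RintegralZl// -RintegralD//; try exact: integrable_realZ.
  rewrite -mulN1r -RintegralZl//; last exact: Lfun2_integrableM.
  apply: le_Rintegral => //.
  - by apply: integrable_realZ; exact: Lfun2_integrableM.
  - by apply: integrable_realD; exact: integrable_realZ.
  - move=> eta _; set p := Phi y eta; set q := nabla y f eta.
    have h : 0 <= (4 * lambda)^-1 * (p + 2 * lambda * q) ^+ 2.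
      by rewrite mulr_ge0 ?sqr_ge0// invr_ge0 mulr_ge0// ltW.
    have E : (4 * lambda)^-1 * (p + 2 * lambda * q) ^+ 2 =
      (4 * lambda)^-1 * p ^+ 2 + lambda * q ^+ 2 + p * q by field; exact: lt0r_neq0.
    by move: h; rewrite E; lra.
rewrite big_split /= -!mulr_sumr lerD2r; apply: ler_wpM2l.
  by rewrite invr_ge0 mulr_ge0// ltW.
apply: (@le_trans _ _ (\sum_(y <- Y) (12 * var ^+ 2 + 16 * m4) * \sum_(0 <= i < L) cA (y - i%:Z) ^+ 2)).
  apply: ler_sum => y _; apply: (le_trans (sqr_bond_sum_le y _ L0)).
  apply: ler_wpM2l; first by have := m4_ge0; have := sqr_ge0 var; lra.
  apply: ler_sum_nat => i /andP[_ iL]; rewrite exprMn ler_piMr ?sqr_ge0//.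
  have i01 : 0 <= i%:R / L%:R :> R /\ i%:R / L%:R <= 1 :> R.
    by rewrite divr_ge0// ler_pdivrMr ?ltr0n// mul1r ler_nat ltnW.
  by rewrite /coef; nra.
rewrite -mulr_sumr -mulrA; apply: ler_wpM2l.
  by have := m4_ge0; have := sqr_ge0 var; lra.
rewrite exchange_big /=.
rewrite (eq_big_nat _ _ (F2 := fun=> \sum_(x <- A) c x ^+ 2)); last first.
  move=> i /andP[_ iL]; rewrite -(@sum_translate A Y (fun x => c x ^+ 2) i%:Z uA uY); last first.
    by move=> x; exact: AY.
  by apply: eq_bigr => y _; rewrite /cA; case: ifP => _; rewrite ?expr0n.
by rewrite big_const_nat subn0 iter_addr addr0 mulr_natl.
Qed.
End StationaryField.

(** * The second-order Boltzmann-Gibbs principle *)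

Section Energy.
Context {R : realType} {dX : measure_display} {X : measurableType dX}.
Variable nu : probability (config X) R.

Lemma exchange_energy_ge (zeta : config X -> R) (delta d : R) f (Y : seq int) :
  measurable_fun setT zeta -> 0 < delta -> (forall eta, delta <= zeta eta) ->
  (forall y, nabla y f \in Lfun nu 2%:E) -> uniq Y ->
  d%:E = (\esum_(z in [set: int]) exchange_energy nu zeta z f)%E ->
  delta * \sum_(y <- Y) \int[nu]_eta (nabla y f eta ^+ 2) <= d.
Proof.
move=> mz d0 dz fL uY dE; rewrite -lee_fin dE; apply: le_trans (sum_le_esum _ uY).
rewrite mulr_sumr -sumEFin; apply: lee_sum => y _.
have mf := Lfun2_measurable (fL y).
rewrite EFinM -integral_sqrE// -ge0_integralZl//=.
- apply: ge0_le_integral => //.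
  + by move=> eta _; rewrite -EFinM lee_fin mulr_ge0 ?sqr_ge0// ltW.
  + by apply/measurable_EFinP; apply: measurable_funM => //; exact: measurable_funX.
  + apply/measurable_EFinP; apply: measurable_funM; last exact: measurable_funX.
    exact: (measurableT_comp mz (measurable_shift y)).
  + by move=> eta _; rewrite -EFinM lee_fin ler_wpM2r ?sqr_ge0.
- by apply/measurable_EFinP; exact: measurable_funX.
- by move=> eta _; rewrite lee_fin sqr_ge0.
- by rewrite lee_fin ltW.
Qed.

End Energy.

Theorem theorem1 (R : realType) (dX : measure_display) (X : measurableType dX)
    (value : X -> R) (a : R) (I : set R) (nu : R -> probability (config X) R)
    (k : nat -> R.-pker (R * config X) ~> (config X))
    (dW : nat -> measure_display) (W : forall n : nat, measurableType (dW n))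
    (P : forall n : nat, probability (W n) R)
    (eta : forall n : nat, R -> W n -> config X) (rho : R)
    (hvalue_inj : injective value) (hvalue_meas : measurable_fun setT value)
    (ha : 0 < a) (hrho : I rho)
    (xi := fun (n : nat) (t : R) => eta n (t * n%:R `^ a))
    (hsemigroup : forall n : nat, (0 < n)%N -> markov_semigroup (k n) (nu rho))
    (hprocess : forall n : nat, (0 < n)%N ->
       markov_process (k n) (nu rho) (P n) (xi n))
    (hA1 : assumption_A1 value k I nu)
    (hA2 : assumption_A2 a (nu rho) k)
    (hA3 : assumption_A3 value a rho (nu rho) k P xi) :
  exists C : R, 0 < C /\
    forall (n L : nat) (t : R) (v : int -> R),
      (0 < n)%N -> (0 < L)%N -> 0 < t -> l2 v ->
      let series := L2_sum (nu rho)
        (fun x conf => v x * local_difference value rho (nu rho) L x conf) in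
      (exists F : config X -> R, series F) /\
      forall F : config X -> R, series F ->
        (mean_square_time_integral (P n) (xi n) F t <=
         (C * t * (L%:R / n%:R `^ (a - 1) + t * n%:R / L%:R ^+ 2))%:E *
         sqnorm2 n v)%E.
Proof.
have hmean x := A1_mean hA1 x hrho.
have hmom x := A1_moments hA1 x hrho (isT : (2 <= 4 <= 4)%N).
have hprod := A1_product hA1 hrho; have htrans := A1_translation hA1 hrho.
have [delta [zeta [d0 Hzeta]]] := hA2.
pose chi2 := chi value rho (nu rho) ^+ 2.
pose m4 := \int[nu rho]_eta (etabar value rho 0 eta ^+ 4).
have chi2_0 : 0 <= chi2 by exact: sqr_ge0.
have m4_0 : 0 <= m4 by apply: Rintegral_ge0 => ? _; exact: exprn_even_ge0.
(* [K1] bounds the gradient part, [K2] the centred fluctuations *)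
pose K1 := 12 * chi2 + 16 * m4; pose K2 := 6 * chi2 + 24 * m4.
have K1_0 : 0 <= K1 by rewrite /K1; lra.
have K2_0 : 0 <= K2 by rewrite /K2; lra.
have K1d : 0 <= K1 / delta by rewrite divr_ge0// ltW.
exists (K1 / delta + 8 * K2 + 1); split; first by lra.
move=> n L t v n0 L0 t0 v2 /=.
have lL x := local_difference_Lfun2 rho hvalue_meas hmom x L0.
have uL x := Lfun2Z (v x) (lL x).
split.
  have [F FL HF] := unconditional_L2_sum
    (mulr_ge0 (ler0n R (2 * L.+1 + 1)) (Rintegral_sqr_ge0 (nu rho) (local_difference value rho (nu rho) L 0)))
    uL (fun x => sqr_ge0 (v x)) v2
    (fun A => sqr_local_difference_sum_le hvalue_meas hprod htrans hmean hmom v L0 (fset_uniq A)).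
  by exists F; split.
move=> F [FL HF].
have sfin : (\esum_(x in [set: int]) (v x ^+ 2)%:E)%E \is a fin_num.
  by rewrite ge0_fin_numE//; apply: esum_ge0 => x _; rewrite lee_fin sqr_ge0.
pose sigma := fine (\esum_(x in [set: int]) (v x ^+ 2)%:E)%E.
have nR0 : 0 < n%:R :> R by rewrite ltr0n.
have LR0 : 0 < L%:R :> R by rewrite ltr0n.
pose na : R := n%:R `^ a; have na0 : 0 < na by exact: powR_gt0.
have naE : na = n%:R `^ (a - 1) * n%:R.
  rewrite -[X in _ * X](powRr1 (ltW nR0)) -powRD; first by rewrite subrK.
  by rewrite (gt_eqF nR0) implybT.
apply/lee_addgt0Pr => eps eps0.
have q0 : 0 < eps / (8 * t ^+ 2) by rewrite divr_gt0// mulr_gt0// exprn_gt0.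
have [A0 /(_ A0 (fsubset_refl _))] := HF (Num.sqrt (eps / (8 * t ^+ 2))) (eq_ind_r is_true q0 (sqrtr_gt0 _)).
pose S conf := \sum_(x <- A0) v x * local_difference value rho (nu rho) L x conf.
have SL : S \in Lfun (nu rho) 2%:E by exact: Lfun2_sum.
rewrite /L2norm L2norm_ltE ?sqrtr_gt0//; last exact: Lfun2B FL SL.
rewrite (sqr_sqrtr (ltW q0)) => FS.
have [V [VL SV [Y uY HY]]] := one_block_split hvalue_meas hprod htrans hmean hmom v L0 (fset_uniq A0).
set sA := \sum_(x <- A0) v x ^+ 2 in SV HY.
have sA_le : sA <= sigma.
  rewrite -lee_fin fineK// -sumEFin; exact: sum_le_esum (fset_uniq A0).
(* the gradients are absorbed by the Dirichlet form of the accelerated generator, which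
   dominates [delta * n ^ a] times the sum of their mean squares *)
have HV f g : local_fun f -> generator (k n) (nu rho) f g ->
    2 * (\int[nu rho]_eta (V eta * f eta)) <=
    (4 * (na * delta))^-1 * (K1 * L%:R * sA) - \int[nu rho]_eta (f eta * g eta).
  move=> lf fg; have fL : f \in Lfun (nu rho) 2%:E by case: fg.
  have gL : g \in Lfun (nu rho) 2%:E by case: fg.
  have [nL Hf] := HY (na * delta) f (mulr_gt0 na0 d0) fL.
  apply: le_trans Hf _; rewrite lerD2l.
  have [mz bz Hd] := Hzeta n n0.
  have sg : scaled_generator a (nu rho) k n f (fun conf => na^-1 * g conf).
    rewrite /scaled_generator -/na (_ : (fun conf => _) = g)//.
    by apply/funext => conf; rewrite mulVKf// gt_eqF.
  have dd : dirichlet_form (nu rho) (scaled_generator a (nu rho) k n) f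
      (- \int[nu rho]_conf (f conf * (na^-1 * g conf))) by exists (fun conf => na^-1 * g conf).
  have := exchange_energy_ge mz d0 (fun conf => proj1 (andP (bz conf))) nL uY (Hd _ _ lf dd).
  under eq_Rintegral do rewrite mulrCA.
  rewrite RintegralZl//; last exact: Lfun2_integrableM.
  rewrite -mulrN ler_pdivlMl// mulrA; lra.
have FV : \int[nu rho]_eta ((F eta - V eta) ^+ 2) <=
    2 * (eps / (8 * t ^+ 2)) + 2 * (K2 / L%:R ^+ 2 * sA).
  have := Rintegral_sqrD_le (Lfun2B FL SL) (Lfun2B SL VL).
  have FSV conf : F conf - S conf + (S conf - V conf) = F conf - V conf by ring.
  under eq_Rintegral do rewrite FSV.
  move=> h; apply: (le_trans h); apply: lerD; apply: ler_wpM2l => //.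
  exact: ltW FS.
apply: le_trans (mean_square_variational (hsemigroup n n0) (A1_invariant hA1 n0 hrho)
  (hprocess n n0) t0 FL VL HV) _.
rewrite /sqnorm2 -(fineK sfin) -/sigma -!EFinM -EFinD lee_fin naE.
have r0 : 0 < n%:R `^ (a - 1) :> R by exact: powR_gt0.
have sA0 : 0 <= sA by apply: sumr_ge0 => x _; exact: sqr_ge0.
move: r0 FV; move: (n%:R `^ (a - 1)) => r r0 FV.
pose p := t * L%:R / (r * n%:R); pose q := t ^+ 2 / L%:R ^+ 2.
have p0 : 0 <= p by rewrite divr_ge0// ?mulr_ge0// ltW.
have q1 : 0 <= q by rewrite divr_ge0// exprn_ge0// ltW.
apply: (@le_trans _ _ (K1 / delta * p * sA + 8 * K2 * q * sA + eps)).
  apply: (@le_trans _ _ (K1 / delta * p * sA +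
      4 * t ^+ 2 * (2 * (eps / (8 * t ^+ 2)) + 2 * (K2 / L%:R ^+ 2 * sA)))).
    apply: lerD; last by apply: ler_wpM2l FV; rewrite mulr_ge0// sqr_ge0.
    rewrite le_eqVlt; apply/orP; left; apply/eqP; rewrite /p; field.
    by rewrite !lt0r_neq0.
  rewrite le_eqVlt; apply/orP; left; apply/eqP; rewrite /q; field.
  by rewrite !lt0r_neq0.
rewrite lerD2r.
have -> : (K1 / delta + 8 * K2 + 1) * t * (L%:R / r + t * n%:R / L%:R ^+ 2) * (n%:R^-1 * sigma) =
    (K1 / delta + 8 * K2 + 1) * p * sigma + (K1 / delta + 8 * K2 + 1) * q * sigma.
  by rewrite /p /q; field; rewrite !lt0r_neq0.
apply: lerD; apply: ler_pM => //.
- by rewrite mulr_ge0.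
- by apply: ler_wpM2r => //; lra.
- by rewrite mulr_ge0// mulr_ge0.
- by apply: ler_wpM2r => //; lra.
Qed.
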